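(* Let $n\in\mathbb{N}$, let $[\cdot]_\beta$ be the unnormalised expectation of the $\mathbb{S}^n_+$ model on $\Lambda$, and let $\mathbb{E}_{i,\boldsymbol{\ell}}$ be the expectation of the vertex-diminished jump process (VDJP). Suppose $g\colon(0,1]^\Lambda\to\mathbb{R}$ is compactly supported. Then for all $a,b\in\Lambda$, $$\big[x_ax_b\,g(\boldsymbol{z})\big]_\beta=\Big[z_a\int_0^\infty\mathbb{E}_{a,\boldsymbol{z}}\big(g(\boldsymbol{L}_t)1_{X_t=b}\big)\,dt\Big]_\beta.$$
   Context: $\Lambda$ is a finite set and $\beta=(\beta_{ij})_{i,j\in\Lambda}$ are edge weights with $\beta_{ij}=\beta_{ji}\ge0$ such that the graph with vertex set $\Lambda$ and edge set $\{\{i,j\}\mid\beta_{ij}>0\}$ is connected. Bold symbols denote objects indexed by $\Lambda$; functions are Borel measurable. Hemisphere: write points of $\mathbb{R}^{n+1}$ as $u=(u^0,u^1,\dots,u^n)$ with Euclidean inner product, $z=u^0$, $x=u^1$. $\mathbb{S}^n_+=\{u\in\mathbb{R}^{n+1}\mid u\cdot u=1,\ z>0\}$ is parametrised by the open unit ball of $\mathbb{R}^n$ via $(u^1,\dots,u^n)$, $z(u)=\sqrt{1-(u^1)^2-\dots-(u^n)^2}$, and carries the measure $du=du^1\cdots du^n/z(u)$. For $\boldsymbol{u}\in(\mathbb{S}^n_+)^\Lambda$ let $H_\beta(\boldsymbol{u})=\frac14\sum_{i,j\in\Lambda}\beta_{ij}(u_i-u_j)\cdot(u_i-u_j)$ and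 $[F]_\beta=\int_{(\mathbb{S}^n_+)^\Lambda}F(\boldsymbol{u})e^{-H_\beta(\boldsymbol{u})}\prod_{i\in\Lambda}du_i$. VDJP: with initial condition $(v,\boldsymbol{L}_0)\in\Lambda\times(0,1]^\Lambda$, the process has $X_0=v$, jump rates $\mathbb{P}_{v,\boldsymbol{L}_0}[X_{t+dt}=j\mid(X_s)_{s\le t},X_t=i]=\beta_{ij}L_t^j\,dt$, where $L_t^j=L_0^j-\int_0^t1_{X_s=j}\,ds$, and is stopped at the time $\zeta=\inf\{s\mid \exists j\in\Lambda:\ L_s^j\le0\}$. Functions on $(0,1]^\Lambda$ are extended by $0$, so the integrand vanishes for $t\ge\zeta$.
   Formalization: The formal theorem additionally assumes that x_a x_b g(z) is integrable, i.e. that the left-hand expectation exists; this is automatic for bounded g, but for unbounded Borel g with compact support both sides can be undefined. *)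

(* Defs.v *)
From HB Require Import structures.
From mathcomp Require Import all_boot all_order all_algebra.
From mathcomp Require Import all_classical all_reals all_analysis.

Set Implicit Arguments.
Unset Strict Implicit.
Unset Printing Implicit Defensive.

Import Order.TTheory GRing.Theory Num.Theory.
Import numFieldNormedType.Exports.

Local Open Scope classical_set_scope.
Local Open Scope ring_scope.

(** * Product measures on tuples *)

(* [cons_measure mu nu] is the product measure [mu \x nu], transported along
   the bijection [T * k.-tuple T -> k.+1.-tuple T]. *)
Section cons_measure.
Context d (T : measurableType d) (R : realType) (k : nat).
Variables (mu : {sigma_finite_measure set T -> \bar R})
  (nu : {sigma_finite_measure set (k.-tuple T) -> \bar R}).

Definition cons_tuple_of (p : T * k.-tuple T) : k.+1.-tuple T :=
  [the k.+1.-tuple T of p.1 :: p.2].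

Definition cons_measure : set (k.+1.-tuple T) -> \bar R :=
  pushforward (mu \x nu)%E cons_tuple_of.

Lemma measurable_cons_tuple_of : measurable_fun [set: _] cons_tuple_of.
Proof. by apply: measurable_cons. Qed.

Let preim_measurable A : measurable A -> measurable (cons_tuple_of @^-1` A).
Proof.
move=> mA; rewrite -[X in measurable X]setTI.
exact: measurable_cons_tuple_of.
Qed.

Let cons_measure0 : cons_measure set0 = 0%E.
Proof. by rewrite /cons_measure /pushforward preimage_set0 measure0. Qed.

Let cons_measure_ge0 A : (0 <= cons_measure A)%E.
Proof. by rewrite /cons_measure /pushforward measure_ge0. Qed.

Let cons_measure_sigma_additive : semi_sigma_additive cons_measure.
Proof.
move=> F mF tF mUF; rewrite /cons_measure /pushforward preimage_bigcup.
apply: measure_semi_sigma_additive.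
- by move=> i; exact: preim_measurable.
- apply/trivIsetP => /= i j _ _ ij; rewrite -preimage_setI.
  by move/trivIsetP : tF => /(_ i j Logic.I Logic.I ij) ->; rewrite preimage_set0.
- by rewrite -preimage_bigcup; exact: preim_measurable.
Qed.

HB.instance Definition _ := isMeasure.Build _ _ _ cons_measure
  cons_measure0 cons_measure_ge0 cons_measure_sigma_additive.

Let cons_measure_sigma_finite : sigma_finite setT cons_measure.
Proof.
have /sigma_finiteP[F [TF ndF Foo]] := sigma_finiteT mu.
have /sigma_finiteP[G [TG ndG Goo]] := sigma_finiteT nu.
pose unc (t : k.+1.-tuple T) : T * k.-tuple T := (thead t, [tuple of behead t]).
have munc : measurable_fun setT unc.
  by apply/measurable_fun_pairP; split;
    [exact: measurable_tnth|exact: measurable_behead].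
have uncK : unc \o cons_tuple_of = id.
  by apply/funext => -[x s]; congr pair; exact/val_inj.
exists (fun i => unc @^-1` (F i `*` G i)).
  rewrite -preimage_bigcup -(preimage_setT unc); congr (_ @^-1` _).
  apply/esym/seteqP; split => // -[x y] _ /=.
  have [i _ Fix] : (\bigcup_i F i) x by rewrite -TF.
  have [j _ Gjy] : (\bigcup_i G i) y by rewrite -TG.
  exists (maxn i j) => //; split => /=.
  - by move: x Fix; exact/subsetPset/ndF/leq_maxl.
  - by move: y Gjy; exact/subsetPset/ndG/leq_maxr.
move=> i; have [mF Fi] := Foo i; have [mG Gi] := Goo i; split.
  by rewrite -[X in measurable X]setTI; apply: munc => //; exact: measurableX.
rewrite /cons_measure /pushforward -comp_preimage uncK preimage_id.
by rewrite product_measure1E// lte_mul_pinfty// ge0_fin_numE.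
Qed.

HB.instance Definition _ := Measure_isSigmaFinite.Build _ _ _ cons_measure
  cons_measure_sigma_finite.

End cons_measure.

Fixpoint tuple_measure d (T : measurableType d) (R : realType)
    (mu : {sigma_finite_measure set T -> \bar R}) (k : nat) :
    {sigma_finite_measure set (k.-tuple T) -> \bar R} :=
  match k with
  | 0%N => [the {sigma_finite_measure set (0.-tuple T) -> \bar R}
             of \d_([tuple] : 0.-tuple T)]
  | k'.+1 => [the {sigma_finite_measure set (k'.+1.-tuple T) -> \bar R}
               of cons_measure mu (tuple_measure mu k')]
  end.

(* A [#|V|.-tuple] is read as a family indexed by the finite type [V]. *)
Definition family_of (V : finType) (T : Type) (s : #|V|.-tuple T) : V -> T :=
  fun i => tnth s (enum_rank i).

(** * The hemisphere and its spin model *)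

Section hemisphere.
Context (R : realType) (n : nat).

Definition dot m (u v : m.-tuple R) : R := \sum_(k < m) tnth u k * tnth v k.

(* z = u^0 and x = u^1; the latter is junk (= 0) when n = 0. *)
Definition zc (u : n.+1.-tuple R) : R := u`_0.
Definition xc (u : n.+1.-tuple R) : R := u`_1.

Definition sqdist (u v : n.+1.-tuple R) : R :=
  \sum_(k < n.+1) (tnth u k - tnth v k) ^+ 2.

Definition hemisphere : set (n.+1.-tuple R) := [set u | dot u u = 1 /\ 0 < zc u].

Definition unit_ball : set (n.-tuple R) := [set y | dot y y < 1].

Definition chart (y : n.-tuple R) : n.+1.-tuple R :=
  [the n.+1.-tuple R of Num.sqrt (1 - dot y y) :: y].

Lemma chart_hemisphere : chart @` unit_ball = hemisphere.
Proof.
have dot1 (u : n.+1.-tuple R) : dot u u =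
    zc u ^+ 2 + dot [tuple of behead u] [tuple of behead u].
  rewrite /dot big_ord_recl expr2 /zc; congr (_ * _ + _).
  - by rewrite (tnth_nth 0).
  - by rewrite (tnth_nth 0).
  - apply: eq_bigr => k _.
    by rewrite !(tnth_nth 0)/= nth_behead.
apply/seteqP; split => [u [y y1 <-]|u [u1 z0]].
  have behead_chart : [tuple of behead (chart y)] = y by exact/val_inj.
  split; last by rewrite /zc/= sqrtr_gt0 subr_gt0.
  rewrite dot1 behead_chart /zc/= sqr_sqrtr ?subrK// subr_ge0.
  exact: ltW.
have e : 1 - dot [tuple of behead u] [tuple of behead u] = zc u ^+ 2.
  by rewrite -u1 dot1 addrK.
exists [tuple of behead u].
  by rewrite /unit_ball/= -subr_gt0 e exprn_gt0.
apply/val_inj => /=; rewrite e sqrtr_sqr gtr0_norm//.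
by case: u {u1 z0 e} => -[].
Qed.

End hemisphere.

Section spin_model.
Context (R : realType) (V : finType) (beta : V -> V -> R) (n : nat).

Definition energy (u : V -> n.+1.-tuple R) : R :=
  4^-1 * \sum_(i : V) \sum_(j : V) beta i j * sqdist (u i) (u j).

(* Coordinates on (S^n_+)^V: one point of the unit ball of R^n per vertex. *)
Definition coords := #|V|.-tuple (n.-tuple (measurableTypeR R)).

Definition coords_volume : {sigma_finite_measure set coords -> \bar R} :=
  tuple_measure (tuple_measure (@lebesgue_measure R) n) #|V|.

Definition coords_domain : set coords :=
  [set U | forall i, unit_ball (family_of U i)].

Definition spins (U : coords) : V -> n.+1.-tuple R :=
  fun i => chart (family_of U i).

(* e^{-H} times the density of \prod_i du_i, where du = du^1 ... du^n / z(u). *)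
Definition spin_weight (U : coords) : R :=
  expR (- energy (spins U)) * \prod_(i : V) (zc (spins U i))^-1.

Definition spin_bracket (F : (V -> n.+1.-tuple R) -> \bar R) : \bar R :=
  (\int[coords_volume]_(U in coords_domain)
     (F (spins U) * (spin_weight U)%:E))%E.

Definition spin_integrable (F : (V -> n.+1.-tuple R) -> \bar R) : Prop :=
  coords_volume.-integrable coords_domain
    (fun U => F (spins U) * (spin_weight U)%:E)%E.

End spin_model.

(** * The vertex-diminished jump process *)

Section vdjp.
Context (R : realType) (V : finType) (beta : V -> V -> R).

Definition half_open_cube : set (V -> R) :=
  [set ell | forall j, 0 < ell j <= 1].

(* L_t^j along a single trajectory x, with L_0 = ell. *)
Definition remaining (ell : V -> R) (x : R -> V) (t : R) : V -> R :=
  fun j => ell j - \int[lebesgue_measure]_(s in `[0, t]) (x s == j)%:R.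

Definition lifetime (ell : V -> R) (x : R -> V) : R :=
  inf [set s | 0 <= s /\ exists j, remaining ell x s j <= 0].

Context d (Omega : measurableType d).

Definition history (X : R -> Omega -> V) (t : R) : set (set Omega) :=
  <<s [set A | exists (s : R) i, [/\ 0 <= s, s <= t & A = X s @^-1` [set i]]] >>.

Definition alive (ell : V -> R) (X : R -> Omega -> V) (t : R) : set Omega :=
  [set w | t < lifetime ell (X ^~ w)].

(* [vdjp_rates] is the infinitesimal jump law
     P[X_{t+dt} = j | (X_s)_{s <= t}, X_t = i] = beta_ij L_t^j dt   (t < zeta),
   tested against an arbitrary event A of the history up to time t.  These
   right derivatives at each t cannot see a jump prescribed at a deterministic
   time, which [vdjp_no_fixed_jump] excludes. *)
Record is_vdjp (v : V) (ell : V -> R) (P : probability Omega R)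
    (X : R -> Omega -> V) : Prop := {
  vdjp_measurable : forall (t : R) i, 0 <= t -> measurable (X t @^-1` [set i]) ;
  vdjp_right_continuous : forall w (t : R), 0 <= t ->
    \forall s \near t^'+, X s w = X t w ;
  vdjp_left_limit : forall w (t : R), 0 < t ->
    exists i, \forall s \near t^'-, X s w = i ;
  vdjp_no_fixed_jump : forall t : R, 0 < t ->
    P [set w | X s w != X t w] @[s --> t^'-] --> 0%E ;
  vdjp_start : {ae P, forall w, X 0 w = v} ;
  vdjp_rates : forall (t : R) i j A, 0 <= t -> i != j -> history X t A ->
    let B := A `&` alive ell X t `&` X t @^-1` [set i] in
    ((h^-1)%:E * P (B `&` X (t + h)%R @^-1` [set j]))%E @[h --> 0^'+] -->
    (\int[P]_(w in B) (beta i j * remaining ell (X ^~ w) t j)%:E)%E ;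
  vdjp_stopped : {ae P, forall w, forall t : R, lifetime ell (X ^~ w) <= t ->
    X t w = X (lifetime ell (X ^~ w)) w}
}.

End vdjp.

(** * Observables on (0,1]^V *)

Section observables.
Context (R : realType) (V : finType).

(* The Borel sigma-algebra of R^V is the product one, here on #|V|.-tuples. *)
Definition borel_observable (g : (V -> R) -> R) : Prop :=
  measurable_fun [set: #|V|.-tuple R] (fun s => g (family_of s)).

(* [g] is total: outside (0,1]^V it is the extension by zero. *)
Definition cube_compact_support (g : (V -> R) -> R) : Prop :=
  exists K : set {ptws V -> R}, [/\ compact K, K `<=` @half_open_cube R V
    & forall ell, ~ K ell -> g ell = 0].

End observables.

(* Main.v *)
(* For F : V -> R^V -> R let (D F)(i, l) = dF(i, l)/dl_i and
   (B F)(i, l) = sum_j beta_ij l_j (F(j, l) - F(i, l)).  Integrating by parts along the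
   rotations that mix z_j and x_j gives, for f Lipschitz and vanishing near the
   boundary of (0,1]^V,
     [z_a f(a, z)] = sum_j [x_a x_j (D f - B f)(j, z)],
   and Dynkin's formula for the VDJP gives
     f(v, l) = int_0^oo E_{v,l} (D f - B f)(X_t, L_t) dt.
   If S F is the primitive of F with D (S F) = F, then f = S F shows that the
   difference Q(F) of the two sides
     sum_j [x_a x_j F(j, z)]   and   [z_a int_0^oo E_{a,z} F(X_t, L_t) dt]
   satisfies Q(F) = Q(B S F).  Since B S is a contraction for a weighted supremum norm,
   iterating gives Q(F) = 0.  The choice F(i, l) = 1_{i = b} h(l) is the theorem for
   Lipschitz h, and ramp functions, the pi-lambda theorem and the splitting of x_a x_b
   and of g into positive and negative parts extend it to Borel g. *)

Require Import Defs.
From mathcomp Require Import all_boot all_order all_algebra.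
From mathcomp Require Import all_classical all_reals all_analysis.
From mathcomp Require Import measurable_realfun ring lra.

Set Implicit Arguments.
Unset Strict Implicit.
Unset Printing Implicit Defensive.

Import Order.TTheory GRing.Theory Num.Theory.
Import numFieldNormedType.Exports.

Local Open Scope classical_set_scope.
Local Open Scope ring_scope.

(** * Integration on tuples *)

(** The obstacle is that little is known about the process. The laws [P v ell] and the paths
    [X v ell] are given separately for each starting point, so nothing says that the time integral
    is measurable in [ell], and the jump rates are only right derivatives tested on events. The
    rates therefore give Dynkin's formula through a right derivative of the mean, completed by
    continuity of the mean. Measurability in [ell] comes from the Picard iteration itself: for good
    F the time integral is the sum over k of (S (B S)^k F)(v, l), an explicit function of l. For
    Borel functions, measurability and the identity are extended together. The margin [eps] given by
    the compact support is kept throughout, since S and B preserve the functions that vanish as soon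
    as one coordinate is at most [eps]. Where such functions do not vanish, the density 1/z is
    bounded; integration by parts has no boundary term, and a dead path contributes nothing. The
    observable may be unbounded. Integrability of the left side controls the positive and negative
    parts, and the time integral may still be infinite on a null set. *)

Section tuple_integration.
Context d (T : measurableType d) (R : realType).
Variable mu : {sigma_finite_measure set T -> \bar R}.

Definition upd_tnth k (s : k.-tuple T) (j : 'I_k) (y : T) : k.-tuple T :=
  [tuple if i == j then y else tnth s i | i < k].

Lemma tnth_upd k (s : k.-tuple T) (j : 'I_k) y i :
  tnth (upd_tnth s j y) i = if i == j then y else tnth s i.
Proof. by rewrite tnth_mktuple. Qed.

Lemma measurable_upd_tnth k (s : k.-tuple T) (j : 'I_k) :
  measurable_fun setT (upd_tnth s j).
Proof.
apply/measurable_fun_tnthP => i; rewrite [X in measurable_fun _ X](_ : _ =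
    fun y => if i == j then y else tnth s i); last first.
  by apply/funext => y /=; rewrite tnth_upd.
by case: (i == j).
Qed.

Lemma upd_tnth_cons0 k (x y : T) (s : k.-tuple T) :
  upd_tnth [the k.+1.-tuple T of x :: s] ord0 y = [the k.+1.-tuple T of y :: s].
Proof.
apply: eq_from_tnth => i; rewrite tnth_upd.
case: (unliftP ord0 i) => [i' ->|->]; last by rewrite eqxx.
by rewrite (_ : (_ == _) = false) // !tnthS.
Qed.

Lemma upd_tnth_consS k (x y : T) (s : k.-tuple T) (j : 'I_k) :
  upd_tnth [the k.+1.-tuple T of x :: s] (lift ord0 j) y =
  [the k.+1.-tuple T of x :: upd_tnth s j y].
Proof.
apply: eq_from_tnth => i; rewrite tnth_upd.
case: (unliftP ord0 i) => [i' ->|->]; last by rewrite !tnth0.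
by rewrite !tnthS tnth_upd (inj_eq lift_inj).
Qed.

Lemma integral_tuple_measureS k (F : k.+1.-tuple T -> \bar R) :
  measurable_fun [set: k.+1.-tuple T] F -> (forall s, 0 <= F s)%E ->
  (\int[tuple_measure mu k.+1]_s F s =
   \int[(mu \x tuple_measure mu k)%E]_p F (cons_tuple_of p))%E.
Proof.
move=> mF F0.
rewrite [LHS](@ge0_integral_pushforward _ _ _ _ R (@cons_tuple_of _ T k)
  (@measurable_cons_tuple_of _ T k) _ setT)//.
Qed.

(** By Tonelli the integration over any chosen coordinate can be made innermost, so agreement along
    all lines parallel to that coordinate is enough. Nonnegativity avoids any integrability
    condition on the lines; signed functions are treated through their positive and negative
    parts. *)
Lemma eq_integral_tuple_measure k (j : 'I_k) (F G : k.-tuple T -> \bar R) :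
  measurable_fun [set: k.-tuple T] F -> measurable_fun [set: k.-tuple T] G ->
  (forall s, 0 <= F s)%E -> (forall s, 0 <= G s)%E ->
  (forall s, \int[mu]_y F (upd_tnth s j y) = \int[mu]_y G (upd_tnth s j y))%E ->
  (\int[tuple_measure mu k]_s F s = \int[tuple_measure mu k]_s G s)%E.
Proof.
elim: k j F G => [[]//|k IH] j F G mF mG F0 G0 FG.
rewrite !integral_tuple_measureS//.
have mc := @measurable_cons_tuple_of _ T k.
have mFc : measurable_fun setT (F \o @cons_tuple_of _ T k) by exact: measurableT_comp.
have mGc : measurable_fun setT (G \o @cons_tuple_of _ T k) by exact: measurableT_comp.
case: (unliftP ord0 j) => [j' jE|jE].
  rewrite !fubini_tonelli1//; apply: eq_integral => x _.
  apply: (IH j') => //.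
  - exact: (measurableT_comp mFc (measurable_pair1 x)).
  - exact: (measurableT_comp mGc (measurable_pair1 x)).
  have consE s y : cons_tuple_of (x, upd_tnth s j' y) =
      upd_tnth (cons_tuple_of (x, s)) j y by rewrite jE upd_tnth_consS.
  by move=> s; under eq_integral do rewrite /= consE; rewrite FG;
    apply: eq_integral => y _ /=; rewrite consE.
rewrite !fubini_tonelli2//; apply: eq_integral => s _.
(* Writing y :: s as an update needs some value to be overwritten; over an empty [T] the two
   integrals agree trivially. *)
have [[x _]|noT] := pselect (exists x : T, True); last first.
  by apply: eq_integral => x _; exfalso; apply: noT; exists x.
have consE y : cons_tuple_of (y, s) = upd_tnth (cons_tuple_of (x, s)) j y.
  by rewrite jE upd_tnth_cons0.
rewrite /fubini_G; under eq_integral do rewrite /= consE.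
by rewrite FG; apply: eq_integral => y _ /=; rewrite -consE.
Qed.

Lemma tuple_measure_power_fin k (A : set T) : measurable A -> (mu A < +oo)%E ->
  measurable [set s : k.-tuple T | forall i, A (tnth s i)] /\
  (tuple_measure mu k [set s : k.-tuple T | forall i, A (tnth s i)] < +oo)%E.
Proof.
move=> mA muA.
have mP m : measurable [set s : m.-tuple T | forall i, A (tnth s i)].
  rewrite [X in measurable X](_ : _ = \bigcap_(i in [set: 'I_m])
      ((fun s : m.-tuple T => tnth s i) @^-1` A)).
    apply: fin_bigcap_measurable => // i _; rewrite -[X in measurable X]setTI.
    exact: measurable_tnth.
  by apply/seteqP; split => [s h i _|s h i]; exact: h.
split; first exact: mP.
elim: k => [|k IH]; first by rewrite /= diracE ltry.
rewrite /= /cons_measure /pushforward.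
have -> : @cons_tuple_of _ T k @^-1` [set s | forall i, A (tnth s i)] =
    A `*` [set s : k.-tuple T | forall i, A (tnth s i)].
  apply/seteqP; split => [[x s] h|[x s] [/= Ax As] i].
    by split => [|i] /=; [have := h ord0|have := h (lift ord0 i); rewrite tnthS].
  by case: (unliftP ord0 i) => [i' ->|->]; rewrite ?tnthS.
rewrite product_measure1E//; last exact: mP.
by apply: lte_mul_pinfty => //; rewrite ge0_fin_numE.
Qed.

End tuple_integration.

(** * The Picard operators on Lipschitz functions *)

Section picard.
Context (R : realType) (V : finType) (beta : V -> V -> R).
Implicit Types (l : V -> R) (F : V -> (V -> R) -> R).

Definition upd l (i : V) (r : R) : V -> R := fun j => if j == i then r else l j.

Definition l1dist l l' : R := \sum_j `|l j - l' j|.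

(* Truncating the rates makes [jump_part] preserve the Lipschitz functions on all of
   R^V, and changes nothing on (0,1]^V. *)
Definition clamp (x : R) : R := Order.max 0 (Order.min 2 x).

Lemma clamp_ge0 x : 0 <= clamp x. Proof. by rewrite le_max lexx. Qed.

Lemma clamp_le2 x : clamp x <= 2. Proof. by rewrite ge_max ler0n ge_min lexx. Qed.

Lemma clamp_id x : 0 <= x <= 2 -> clamp x = x.
Proof.
by move=> /andP[x0 x2]; rewrite /clamp (min_idPr _)// (max_idPr _).
Qed.

Lemma clamp_lip x y : `|clamp x - clamp y| <= `|x - y|.
Proof.
wlog xy : x y / x <= y.
  by move=> h; case: (leP x y) => [/h//|/ltW /h]; rewrite distrC [X in _ <= X]distrC.
rewrite [X in _ <= X]distrC [X in X <= _]distrC.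
rewrite [X in _ <= X]ger0_norm ?subr_ge0//.
rewrite /clamp !maxEle !minEle.
by repeat case: ifPn => /=; rewrite -?ltNge => *; rewrite ler_norml; apply/andP; split; lra.
Qed.

Lemma l1dist_ge0 l l' : 0 <= l1dist l l'.
Proof. by apply: sumr_ge0 => j _; exact: normr_ge0. Qed.

Lemma le_coord_l1dist l l' j : `|l j - l' j| <= l1dist l l'.
Proof. by rewrite /l1dist (bigD1 j)//= lerDl sumr_ge0. Qed.

Lemma l1dist_upd l i r r' : l1dist (upd l i r) (upd l i r') = `|r - r'|.
Proof.
rewrite /l1dist (bigD1 i)//= /upd eqxx big1 ?addr0// => j /negbTE ->.
by rewrite subrr normr0.
Qed.

Lemma l1dist_upd2 l l' i r : l1dist (upd l i r) (upd l' i r) <= l1dist l l'.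
Proof.
apply: ler_sum => j _; rewrite /upd; case: ifP => // _.
by rewrite subrr normr0 normr_ge0.
Qed.

Lemma upd_id l i : upd l i (l i) = l.
Proof. by apply/funext => j; rewrite /upd; case: eqVneq => // ->. Qed.

Lemma upd_upd l i r r' : upd (upd l i r) i r' = upd l i r'.
Proof. by apply/funext => j; rewrite /upd; case: ifP => // ->. Qed.

(** Only small coordinates are excluded, because clocks and spins never exceed 1. The constants are
    existential: each operator enlarges them, while [eps] is unchanged. *)
Record good (eps : R) (F : V -> (V -> R) -> R) : Prop := {
  good_bounded : exists2 K, 0 <= K & forall i l, `|F i l| <= K ;
  good_lipschitz : exists2 K, 0 <= K &
    forall i l l', `|F i l - F i l'| <= K * l1dist l l' ;
  good_vanish : forall i l j, l j <= eps -> F i l = 0 }.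

Definition jump_part F : V -> (V -> R) -> R :=
  fun i l => \sum_j beta i j * clamp (l j) * (F j l - F i l).

(* [primitive F i] integrates the clock of the occupied vertex [i] only, so that
   [own_derivative (primitive F) F]. *)
Definition primitive F : V -> (V -> R) -> R :=
  fun i l => \int[lebesgue_measure]_(r in `[0, clamp (l i)]) F i (upd l i r).

Lemma good_sub eps F G : good eps F -> good eps G ->
  good eps (fun i l => F i l - G i l).
Proof.
move=> [[K K0 FK] [L L0 FL] Fv] [[K' K'0 GK] [L' L'0 GL] Gv]; split.
- exists (K + K'); rewrite ?addr_ge0// => i l.
  by apply: le_trans (ler_normB _ _) _; rewrite lerD.
- exists (L + L'); rewrite ?addr_ge0// => i l l'.
  rewrite (_ : _ - _ = (F i l - F i l') - (G i l - G i l')); last by ring.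
  by apply: le_trans (ler_normB _ _) _; rewrite [leRHS]mulrDl lerD.
- by move=> i l j lj; rewrite (Fv _ _ _ lj) (Gv _ _ _ lj) subrr.
Qed.

Lemma good_jump_part eps F : good eps F -> good eps (jump_part F).
Proof.
move=> [[K K0 FK] [L L0 FL] Fv]; pose C := \sum_i \sum_j `|beta i j|.
have C0 : 0 <= C by rewrite sumr_ge0// => i _; rewrite sumr_ge0.
have bC i : \sum_j `|beta i j| <= C.
  by rewrite /C [leRHS](bigD1 i)//= lerDl sumr_ge0// => k _; rewrite sumr_ge0.
have c2 x : `|clamp x| <= 2 by rewrite ger0_norm ?clamp_ge0 ?clamp_le2.
split.
- exists (C * (2 * (K + K))); first by rewrite !(mulr_ge0, addr_ge0).
  move=> i l; apply: le_trans (ler_norm_sum _ _ _) _.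
  apply: (@le_trans _ _ (\sum_j `|beta i j| * (2 * (K + K)))); last first.
    by rewrite -mulr_suml ler_wpM2r// !(mulr_ge0, addr_ge0).
  apply: ler_sum => j _; rewrite !normrM -mulrA ler_wpM2l// ler_pM//.
  by apply: le_trans (ler_normB _ _) _; rewrite lerD.
- exists (C * (2 * (L + L) + (K + K))); first by rewrite !(mulr_ge0, addr_ge0).
  move=> i l l'; rewrite /jump_part -sumrB.
  apply: le_trans (ler_norm_sum _ _ _) _; rewrite -mulrA.
  set E := (X in C * X).
  have E0 : 0 <= E by rewrite /E mulr_ge0 ?l1dist_ge0// !(mulr_ge0, addr_ge0).
  apply: (@le_trans _ _ (\sum_j `|beta i j| * E)); last first.
    by rewrite -mulr_suml ler_wpM2r.
  apply: ler_sum => j _.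
  rewrite (_ : _ - _ = beta i j * (clamp (l j) * ((F j l - F j l') - (F i l - F i l'))
    + (clamp (l j) - clamp (l' j)) * (F j l' - F i l'))); last by ring.
  rewrite normrM ler_wpM2l//; apply: le_trans (ler_normD _ _) _.
  rewrite /E [leRHS]mulrDl lerD//.
    rewrite normrM -mulrA ler_pM//.
    by apply: le_trans (ler_normB _ _) _; rewrite [leRHS]mulrDl lerD.
  rewrite normrM mulrC ler_pM//.
    by apply: le_trans (ler_normB _ _) _; rewrite lerD.
  by apply: le_trans (clamp_lip _ _) _; exact: le_coord_l1dist.
- move=> i l j lj; rewrite /jump_part big1// => k _.
  by rewrite !(Fv _ _ _ lj) subrr mulr0.
Qed.

Lemma good_continuous eps F i l : good eps F ->
  continuous (fun r => F i (upd l i r)).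
Proof.
move=> [_ [L L0 FL] _] x; apply/cvgrPdist_le => /= e e0.
have LE : 0 < L + 1 by rewrite ltr_wpDl.
have /cvgrPdist_le/(_ _ (divr_gt0 e0 LE)) nearL := @cvg_id _ (nbhs (x : R)).
near=> y; apply: le_trans (FL _ _ _) _; rewrite l1dist_upd.
apply: (@le_trans _ _ ((L + 1) * `|x - y|)); first by rewrite ler_wpM2r// lerDl.
by rewrite mulrC -ler_pdivlMr//; near: y; exact: nearL.
Unshelve. all: by end_near. Qed.

Lemma good_integrable eps F i l a b : good eps F ->
  lebesgue_measure.-integrable `[a, b] (EFin \o (fun r => F i (upd l i r))).
Proof.
move=> gF; apply: continuous_compact_integrable; first exact: segment_compact.
by apply: continuous_subspaceT; exact: good_continuous gF.
Qed.

Lemma norm_Rintegral_itv_le (f : R -> R) (a b K : R) : a <= b ->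
  lebesgue_measure.-integrable `[a, b] (EFin \o f) ->
  (forall x, `|f x| <= K) ->
  `|\int[lebesgue_measure]_(x in `[a, b]) f x| <= K * (b - a).
Proof.
move=> ab fi fK; apply: le_trans (le_normr_Rintegral _ _) _ => //.
apply: le_trans (@le_Rintegral _ _ _ _ _ _ (fun _ => K) _ _ _ _) _ => //.
- exact: integrable_norm.
- by apply: continuous_compact_integrable; [exact: segment_compact|
    apply: continuous_subspaceT => x; exact: cvg_cst].
- rewrite Rintegral_cst//=. rewrite [X in fine X](lebesgue_measure_itv `[a, b])/= lte_fin.
  by move: ab; rewrite le_eqVlt => /predU1P[->|->/=]; rewrite ?ltxx ?subrr ?mulr0.
Qed.

(** The Lipschitz constant L * 2 + K has two sources: the integrand moves by at most L times the
    distance over an interval of length at most 2 ([G1]), and the endpoint moves where the integrand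
    is at most K ([G2]). *)
Lemma good_primitive eps F : 0 <= eps -> good eps F -> good eps (primitive F).
Proof.
move=> eps0 gF; have [[K K0 FK] [L L0 FL] Fv] := gF.
have cge a : 0 <= clamp a by exact: clamp_ge0.
split.
- exists (K * 2); first by rewrite mulr_ge0.
  move=> i l; apply: le_trans (@norm_Rintegral_itv_le _ _ _ K _ _ _) _ => //.
    exact: good_integrable gF.
  by rewrite ler_wpM2l// subr0 clamp_le2.
- exists (L * 2 + K); first by rewrite addr_ge0// mulr_ge0.
  move=> i l l'.
  pose G l c := \int[lebesgue_measure]_(r in `[0, c]) F i (upd l i r).
  have G1 (c : R) : 0 <= c <= 2 -> `|G l c - G l' c| <= L * 2 * l1dist l l'.
    move=> /andP[c0 c2]; rewrite /G -RintegralB//; last 2 first.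
    - exact: good_integrable gF.
    - exact: good_integrable gF.
    apply: le_trans (@norm_Rintegral_itv_le _ _ _ (L * l1dist l l') _ _ _) _ => //.
    - rewrite (_ : _ \o _ = (EFin \o (fun r => F i (upd l i r))) \-
        (EFin \o (fun r => F i (upd l' i r))))%E//.
      by apply: integrableB => //; exact: good_integrable gF.
    - move=> x; apply: le_trans (FL _ _ _) _; rewrite ler_wpM2l//.
      exact: l1dist_upd2.
    - by rewrite subr0 mulrAC ler_wpM2r ?l1dist_ge0// ler_wpM2l.
  have G2 (c c' : R) : 0 <= c <= c' -> `|G l' c - G l' c'| <= K * `|c - c'|.
    move=> /andP[c0 cc']; rewrite distrC [X in _ <= _ * X]distrC.
    rewrite /G Rintegral_itvB//=; last exact: good_integrable gF.
    rewrite Rintegral_itv_obnd_cbnd; last first.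
      by apply: integrableS (good_integrable i l' c c' gF) => //; exact: subset_itv_oc_cc.
    rewrite [X in _ <= _ * X]ger0_norm ?subr_ge0//.
    by apply: norm_Rintegral_itv_le => //; exact: good_integrable gF.
  have -> : primitive F i l - primitive F i l' =
      (G l (clamp (l i)) - G l' (clamp (l i))) +
      (G l' (clamp (l i)) - G l' (clamp (l' i))).
    by rewrite addrA subrK.
  rewrite mulrDl; apply: le_trans (ler_normD _ _) _.
  apply: lerD; first by rewrite G1// clamp_ge0 clamp_le2.
  apply: (@le_trans _ _ (K * `|clamp (l i) - clamp (l' i)|)); last first.
    by rewrite ler_wpM2l// (le_trans (clamp_lip _ _))// le_coord_l1dist.
  case: (leP (clamp (l i)) (clamp (l' i))) => [h|/ltW h].
    by rewrite G2// clamp_ge0.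
  by rewrite distrC [X in _ <= _ * X]distrC G2// clamp_ge0.
- move=> i l j lj; rewrite /primitive.
  rewrite (@eq_Rintegral _ _ _ _ _ (fun _ => 0)) ?Rintegral_cst ?mul0r//.
  move=> r /[!inE]/=; rewrite in_itv/= => /andP[r0 rl].
  have [ji|ji] := eqVneq j i; last by rewrite (Fv _ _ j)// /upd (negbTE ji).
  rewrite (Fv _ _ i)// /upd eqxx; apply: le_trans rl _; rewrite -ji.
  by rewrite /clamp ge_max eps0 ge_min lj orbT.
Qed.

(** The range 0 < l i < 2 is where [clamp] is locally the identity. It contains (0,1] in its
    interior, so the derivative is two-sided even at 1. *)
Definition own_derivative f Df := forall i l, 0 < l i < 2 ->
  is_derive (l i) 1 (fun r : R => f i (upd l i r) : R) (Df i l : R).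

Lemma own_derivative_primitive eps F : good eps F -> own_derivative (primitive F) F.
Proof.
move=> gF i l /andP[l0 l2].
pose G r := \int[lebesgue_measure]_(x in `[0, r]) F i (upd l i x).
have [dG GE] := @continuous_FTC1_closed R (fun r => F i (upd l i r)) 0 (l i) 2
  l2 (good_integrable i l 0 2 gF) l0 (@good_continuous eps F i l gF (l i)).
have nearE : \forall r \near l i, G r = primitive F i (upd l i r).
  near=> r; rewrite /primitive /G /upd eqxx clamp_id.
    by apply: eq_Rintegral => x _; congr (F i _); apply/funext => j; case: ifP.
  by apply/andP; split; apply/ltW; near: r; [exact: lt_nbhsr|exact: lt_nbhsl].
have idG : is_derive (l i) 1 G (F i l).
  by apply: DeriveDef => //; rewrite -derive1E GE upd_id.
exact: near_eq_is_derive idG.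
Unshelve. all: by end_near. Qed.

(* In the norm with weight exp (- lam * sum_j clamp (l j)), [primitive] has norm at most
   1 / lam while the norm of [jump_part] does not depend on [lam]. *)
Definition expdom (lam A : R) F :=
  forall i l, `|F i l| <= A * expR (lam * \sum_j clamp (l j)).

(** Both terms of each difference are taken at the same [l], so the weight factors out. The 4 is the
    bound 2 on [clamp] times the two terms. *)
Lemma expdom_jump_part (lam A C : R) F : 0 <= A ->
  (forall i, \sum_j `|beta i j| <= C) ->
  expdom lam A F -> expdom lam (4 * C * A) (jump_part F).
Proof.
move=> A0 bC FA i l; apply: le_trans (ler_norm_sum _ _ _) _.
set e := expR _; have e0 : 0 <= e := expR_ge0 _.
apply: (@le_trans _ _ (\sum_j `|beta i j| * (4 * A * e))); last first.
  by rewrite -mulr_suml [4 * C]mulrC -!mulrA ler_wpM2r// !mulr_ge0.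
apply: ler_sum => j _; rewrite !normrM -mulrA ler_wpM2l//.
rewrite (_ : 4 * A * e = 2 * (A * e + A * e)); last by ring.
rewrite ler_pM//; first by rewrite ger0_norm ?clamp_ge0 ?clamp_le2.
by apply: le_trans (ler_normB _ _) _; rewrite lerD ?FA.
Qed.

Lemma integral_expR_itv (lam c : R) : 0 < lam -> 0 <= c ->
  \int[lebesgue_measure]_(r in `[0, c]) expR (lam * r) = lam^-1 * (expR (lam * c) - 1).
Proof.
move=> lam0; rewrite le_eqVlt => /predU1P[<-|c0].
  by rewrite mulr0 expR0 subrr mulr0 set_itv1 Rintegral_set1.
rewrite /Rintegral (@continuous_FTC2 _ _ (fun r => lam^-1 * expR (lam * r)))//.
- by rewrite mulr0 expR0 -EFinB /= mulrBr.
- apply: continuous_subspaceT => x.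
  by apply: continuous_comp; [exact: mulrl_continuous|exact: continuous_expR].
- have cE x : {for x, continuous (fun r => lam^-1 * expR (lam * r))}.
    apply: (@continuousM _ _ (cst lam^-1)); first exact: cvg_cst.
    by apply: continuous_comp; [exact: mulrl_continuous|exact: continuous_expR].
  split.
  + by move=> x _; exact: ex_derive.
  + by apply: cvg_at_right_filter; exact: cE.
  + by apply: cvg_at_left_filter; exact: cE.
- move=> x _; rewrite derive1E derive_val /GRing.scale/= mulr1.
  by rewrite mulrCA mulVf ?mulr1 // gt_eqF.
Qed.

(** Only the i-th coordinate varies under the integral, so the weight of the others comes out, and
    the integral of exp (lam r) over [0, c] is at most exp (lam c) / lam. *)
Lemma expdom_primitive eps (lam A : R) F : 0 < lam -> 0 <= A -> good eps F ->
  expdom lam A F -> expdom lam (A / lam) (primitive F).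
Proof.
move=> lam0 A0 gF FA i l; rewrite /primitive.
set c := clamp (l i); pose s := \sum_(j | j != i) clamp (l j).
have c0 : 0 <= c := clamp_ge0 _.
have iE : lebesgue_measure.-integrable `[0, c] (EFin \o (fun r => expR (lam * r))).
  apply: continuous_compact_integrable; first exact: segment_compact.
  apply: continuous_subspaceT => x.
  by apply: continuous_comp; [exact: mulrl_continuous|exact: continuous_expR].
have sE : \sum_j clamp (l j) = s + c by rewrite (bigD1 i)//= addrC.
apply: le_trans (le_normr_Rintegral _ _) _ => //; first exact: good_integrable gF.
apply: (@le_trans _ _ (\int[lebesgue_measure]_(r in `[0, c])
    (A * expR (lam * s) * expR (lam * r)))).
  apply: le_Rintegral => //.
  - by apply: integrable_norm; exact: good_integrable gF.
  - rewrite (_ : _ \o _ = fun r => ((A * expR (lam * s))%:E * (expR (lam * r))%:E)%E)//.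
    exact: integrableZl.
  move=> r /=; rewrite in_itv/= => /andP[r0 rc].
  apply: le_trans (FA _ _) _; rewrite -mulrA -expRD -mulrDr.
  rewrite ler_wpM2l// ler_expR ler_wpM2l ?(ltW lam0)//.
  rewrite (bigD1 i)//= addrC lerD//; last first.
    by rewrite /upd eqxx clamp_id// r0 (le_trans rc)// clamp_le2.
  by apply: ler_sum => j /negbTE ji; rewrite /upd ji.
rewrite sE [lam * (s + c)]mulrDr expRD RintegralZl// integral_expR_itv//.
rewrite (_ : A * expR (lam * s) * _ =
  A / lam * (expR (lam * s) * expR (lam * c)) - A / lam * expR (lam * s)); last by ring.
by rewrite lerBlDr lerDl mulr_ge0 ?expR_ge0// divr_ge0// ltW.
Qed.

End picard.

(** * Integrability of real-valued functions *)

Section real_integrable.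
Context d (T : measurableType d) (R : realType) (mu : {measure set T -> \bar R}).
Variables (D : set T) (mD : measurable D).
Implicit Types f g : T -> R.

Lemma integrableDr f g : mu.-integrable D (EFin \o f) -> mu.-integrable D (EFin \o g) ->
  mu.-integrable D (EFin \o (fun x => f x + g x)).
Proof. by move=> fi gi; exact: (integrableD mD fi gi). Qed.

Lemma integrableBr f g : mu.-integrable D (EFin \o f) -> mu.-integrable D (EFin \o g) ->
  mu.-integrable D (EFin \o (fun x => f x - g x)).
Proof. by move=> fi gi; exact: (integrableB mD fi gi). Qed.

Lemma integrableZlr k f : mu.-integrable D (EFin \o f) ->
  mu.-integrable D (EFin \o (fun x => k * f x)).
Proof. by move=> fi; exact: (integrableZl mD k fi). Qed.

Lemma integrable_bounded_mul f g (C : R) : mu.-integrable D (EFin \o f) ->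
  measurable_fun D g -> (forall x, `|g x| <= C) ->
  mu.-integrable D (EFin \o (fun x => g x * f x)).
Proof.
move=> fi mg gC; rewrite (_ : _ \o _ = ((EFin \o g) \* (EFin \o f))%E)//.
apply: integrableMr => //; exists C; split; first exact: num_real.
by move=> y Cy x _ /=; exact: le_trans (gC x) (ltW Cy).
Qed.

End real_integrable.

Lemma Rintegral_sum d (T : measurableType d) (R : realType)
    (mu : {measure set T -> \bar R}) (D : set T) (I : Type) (s : seq I)
    (f : I -> T -> R) : measurable D ->
  (forall i, mu.-integrable D (EFin \o f i)) ->
  \int[mu]_(x in D) (\sum_(i <- s) f i x) = \sum_(i <- s) \int[mu]_(x in D) f i x.
Proof.
move=> mD fi; elim: s => [|i s IH].
  rewrite big_nil (@eq_Rintegral _ _ _ _ _ (fun _ => 0)) ?Rintegral_cst ?mul0r//.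
  by move=> x _; rewrite big_nil.
rewrite big_cons -IH -RintegralD//.
  by apply: eq_Rintegral => x _; rewrite big_cons.
rewrite (_ : _ \o _ = fun x => (\sum_(i <- s) (f i x)%:E)%E).
  by apply: (@integrable_sum _ _ _ _ _ mD _ s predT (fun i => EFin \o f i)) => j _; exact: fi.
by apply/funext => x /=; rewrite sumEFin.
Qed.

Lemma bounded_integrable d (T : measurableType d) (R : realType)
    (mu : {measure set T -> \bar R}) (D : set T) (f : T -> R) (K : R) :
  measurable D -> (mu D < +oo)%E -> measurable_fun D f ->
  (forall x, D x -> `|f x| <= K) -> mu.-integrable D (EFin \o f).
Proof.
move=> mD Doo mf fK; apply: measurable_bounded_integrable => //.
exists K; split; first exact: num_real.
by move=> y Ky x /= Dx; rewrite (le_trans (fK _ Dx))// ltW.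
Qed.

Lemma lebesgue_measure_itvcc_fin (R : realType) (a b : R) :
  (@lebesgue_measure R `[a, b] < +oo)%E.
Proof.
by rewrite [X in (X < _)%E](lebesgue_measure_itv `[a, b])/=; case: ifP => // _; rewrite ltry.
Qed.

Section grid.
Context (R : realType).

(** Truncation plus one puts the grid point strictly to the right of [s], the side on which the
    paths are continuous. *)
Definition grid (n : nat) (s : R) : R := (Num.truncn (s * n.+1%:R)).+1%:R / n.+1%:R.

Lemma grid_itv n (s : R) : 0 <= s -> s < grid n s <= s + n.+1%:R^-1.
Proof.
move=> s0; have /truncn_itv/andP[h1 h2] : 0 <= s * n.+1%:R by rewrite mulr_ge0.
rewrite /grid ltr_pdivlMr ?ltr0n// h2/= ler_pdivrMr ?ltr0n// mulrDl mulVf ?pnatr_eq0//.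
by rewrite -natr1 lerD2r.
Qed.

End grid.

(** * Measurability of the process *)

Section jointly_measurable.
Context (R : realType) (V : finType) d (Omega : measurableType d).
Variable Y : R -> Omega -> V.
Hypothesis mY : forall (t : R) i, 0 <= t -> measurable (Y t @^-1` [set i]).
Hypothesis rcY : forall w (t : R), 0 <= t -> \forall s \near t^'+, Y s w = Y t w.

Lemma grid_eventually w (t : R) : 0 <= t ->
  \forall n \near \oo, Y (grid n t) w = Y t w.
Proof.
move=> t0; have [e /= e0 He] := rcY w t0; near=> n.
have /andP[h1 h2] := grid_itv n t0.
apply: He => //=; rewrite distrC ger0_norm ?subr_ge0 ?(ltW h1)//.
rewrite ltrBlDr (le_lt_trans h2)// addrC ltrD2r.
by near: n; exact: near_infty_natSinv_lt (PosNum e0).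
Unshelve. all: by end_near. Qed.

(* By right continuity the process is the limit of its values on finer and finer grids. *)
Lemma measurable_process i :
  measurable [set p : measurableTypeR R * Omega | 0 <= p.1 /\ Y p.1 p.2 = i].
Proof.
pose A n := \bigcup_k ([set` `[k%:R / n.+1%:R, k.+1%:R / n.+1%:R[] `*`
  (Y (k.+1%:R / n.+1%:R) @^-1` [set i])) : set (measurableTypeR R * Omega).
have mA n : measurable (A n).
  apply: bigcupT_measurable => k; apply: measurableX; first exact: measurable_itv.
  by apply: mY; rewrite divr_ge0.
have AE n p : 0 <= p.1 -> A n p <-> Y (grid n p.1) p.2 = i.
  move=> p0; have n0 : (0 : R) < n.+1%:R by rewrite ltr0n.
  have p0' : 0 <= p.1 * n.+1%:R by rewrite mulr_ge0.
  split=> [[k _ [/= ]]|h].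
    rewrite in_itv/= ler_pdivrMr// ltr_pdivlMr// => kp <-.
    by congr (Y _ _); rewrite /grid (truncn_def kp).
  exists (Num.truncn (p.1 * n.+1%:R)) => //; split => //=.
  by rewrite in_itv/= ler_pdivrMr// ltr_pdivlMr// truncn_itv.
rewrite (_ : mkset _ = ([set` `[0, +oo[] `*` setT) `&`
    \bigcup_N \bigcap_(n in [set n | (N <= n)%N]) A n).
  apply: measurableI.
    by apply: measurableX => //; exact: measurable_itv.
  by apply: bigcupT_measurable => N; apply: bigcap_measurable => //; exists N => /=.
apply/seteqP; split=> [p /= [p0 Yp]|p [/= [/[!in_itv]/= /andP[p0 _] _] [N _ HN]]].
  split; first by rewrite in_itv/= p0.
  have [N _ HN] := grid_eventually p.2 p0.
  by exists N => // n /= Nn; apply/AE => //; rewrite HN.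
split=> //; have [N' _ HN'] := grid_eventually p.2 p0.
rewrite -(HN' (maxn N N')) /= ?leq_maxr//.
by apply/AE => //; apply: HN => /=; rewrite leq_maxl.
Qed.

Lemma measurable_path w i : measurable [set s : measurableTypeR R | 0 <= s /\ Y s w = i].
Proof.
have := measurable_ysection w (measurable_process i).
congr measurable; apply/seteqP; split => s; rewrite /ysection/= ?inE//.
Qed.

End jointly_measurable.

Section paths.
Context (R : realType) (V : finType) (ell : V -> R) (x : R -> V).
Hypothesis mx : forall i, measurable [set s : measurableTypeR R | 0 <= s /\ x s = i].
Local Notation mu := (@lebesgue_measure R).
Local Notation L := (remaining ell x).

Lemma path_indicE i a b : 0 <= a ->
  {in `[a, b], (fun s => (x s == i)%:R) =1 \1_[set s | 0 <= s /\ x s = i] :> (R -> R)}.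
Proof.
move=> a0 s; rewrite in_itv/= => /andP[sa _]; rewrite indicE; congr (nat_of_bool _)%:R.
apply/eqP/idP => [xi|]; first by rewrite inE/=; split => //; exact: le_trans sa.
by rewrite inE => -[].
Qed.

Lemma integrable_path i a b : 0 <= a ->
  mu.-integrable `[a, b] (EFin \o (fun s => (x s == i)%:R)).
Proof.
move=> a0; pose A := [set s : measurableTypeR R | 0 <= s /\ x s = i].
have iA : mu.-integrable `[a, b] (EFin \o (\1_A : measurableTypeR R -> R)).
  apply: (@bounded_integrable _ _ _ _ _ _ 1) => //.
  - exact: lebesgue_measure_itvcc_fin.
  - by apply: measurable_funTS; apply: measurable_indic; exact: mx.
  - by move=> s _; rewrite indicE; case: (_ \in _); rewrite ?normr1 ?normr0.
by apply: eq_integrable iA => // s; rewrite inE/= => sab; rewrite -(path_indicE i a0 sab).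
Qed.

Lemma remaining_incr s t j : 0 <= s <= t ->
  L s j - L t j = \int[mu]_(u in `]s, t]) (x u == j)%:R.
Proof.
move=> /andP[s0 st]; rewrite /remaining -(@Rintegral_itvB _ _ (BLeft 0) (BRight t) s)//.
  by ring.
exact: integrable_path.
Qed.

Lemma remaining0 j : L 0 j = ell j.
Proof. by rewrite /remaining set_itv1 Rintegral_set1 subr0. Qed.

Lemma remaining_lip s t j : 0 <= s <= t -> 0 <= L s j - L t j <= t - s.
Proof.
move=> st; rewrite remaining_incr//; move: st => /andP[s0 st].
rewrite Rintegral_ge0//= Rintegral_itv_obnd_cbnd; last first.
  by apply: integrableS (integrable_path j t s0) => //; exact: subset_itv_oc_cc.
rewrite -[t - s]mul1r; apply: le_trans (ler_norm _) _.
apply: norm_Rintegral_itv_le => // [|u]; first exact: integrable_path.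
by case: (_ == _); rewrite ?normr1 ?normr0.
Qed.

Lemma remaining_const s t i : 0 <= s <= t -> (forall u, s < u <= t -> x u = i) ->
  L t = upd (L s) i (L s i - (t - s)).
Proof.
move=> st xi; apply/funext => j.
have := remaining_incr j st; rewrite (@eq_Rintegral _ _ _ _ _ (fun _ => (i == j)%:R)); last first.
  by move=> u /[!inE]/=; rewrite in_itv/= => /xi ->.
move: st => /andP[s0 st].
rewrite Rintegral_cst// [X in fine X](lebesgue_measure_itv `]s, t])/= lte_fin => E.
have {E} : L s j - L t j = (i == j)%:R * (t - s).
  by rewrite E; move: st; rewrite le_eqVlt => /predU1P[->|->//]; rewrite ltxx subrr.
rewrite /upd eq_sym; case: eqVneq => [->|ij]; rewrite ?mul1r ?mul0r => E.
  by rewrite -E; ring.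
by apply/eqP; rewrite eq_sym -subr_eq0 E.
Qed.

Lemma remaining_sum t : 0 <= t -> \sum_j L t j = \sum_j ell j - t.
Proof.
move=> t0; rewrite /remaining sumrB; congr (_ - _).
rewrite -Rintegral_sum//; last by move=> j; exact: integrable_path.
rewrite (@eq_Rintegral _ _ _ _ _ (fun _ => 1)); last first.
  move=> s _; rewrite (bigD1 (x s))//= eqxx big1 ?addr0//.
  by move=> j /negbTE; rewrite eq_sym => ->.
rewrite Rintegral_cst// mul1r [X in fine X](lebesgue_measure_itv `[0, t])/= lte_fin.
by move: t0; rewrite le_eqVlt => /predU1P[<-|->/=]; rewrite ?ltxx ?subr0.
Qed.

(** The infimum defining the lifetime runs over a nonempty set (on an empty one it would default to
    0): [v] witnesses that there is a clock, and the sum of the clocks decreases at unit speed.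
    Conversely, clocks that are all positive at t stay positive for a while, since each runs at
    speed at most 1. *)
Lemma lt_lifetimeP (v : V) t : 0 <= t ->
  t < lifetime ell x <-> forall j, 0 < L t j.
Proof.
move=> t0; rewrite /lifetime; set Z := [set s | _].
have Zlb : lbound Z 0 by move=> s [].
have Z0 : Z !=set0.
  pose T := \sum_j `|ell j|; have T0 : 0 <= T by apply: sumr_ge0.
  exists T; split => //; apply: contrapT => /forallNP h.
  have : 0 < \sum_j L T j.
    rewrite (bigD1 v)//= ltr_pwDl//; first by rewrite ltNge; exact/negP.
    by apply: sumr_ge0 => j _; rewrite leNgt; apply/negP => /ltW; exact: h.
  rewrite remaining_sum// subr_gt0 ltNge => /negP; apply.
  by apply: ler_sum => j _; exact: ler_norm.
split=> [tZ j|Lt].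
  rewrite ltNge; apply/negP => Lj; move: tZ; rewrite ltNge => /negP; apply.
  by apply: ge_inf; [exists 0|split => //; exists j].
(* No clock can reach 0 before time t + m; the 1 is the starting value of the minimum. *)
pose m := \big[Order.min/1]_j L t j.
have m0 : 0 < m by rewrite /m; elim/big_ind : _ => // a b a0 b0; rewrite lt_min a0.
apply: (@lt_le_trans _ _ (t + m)); first by rewrite ltrDl.
apply: lb_le_inf => // s [s0 [j Lj]]; rewrite leNgt; apply/negP => stm.
have mLj : m <= L t j by exact: bigmin_le_cond.
have [st|ts] := leP s t.
  have := remaining_lip j (introT andP (conj s0 st)); have := Lt j; lra.
have tst : 0 <= t <= s by rewrite t0 ltW.
have := remaining_lip j tst; lra.
Qed.

End paths.

Section state_measurability.
Context (R : realType) (V : finType).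

Lemma measurable_countable_comp d (T : measurableType d) (C : countType)
    (k : T -> C) (h : C -> R) :
  (forall c, measurable (k @^-1` [set c])) -> measurable_fun setT (h \o k).
Proof.
move=> mk _ B mB; rewrite setTI.
rewrite (_ : _ @^-1` _ = \bigcup_n (if unpickle n is Some c then
    (if `[< B (h c) >] then k @^-1` [set c] else set0) else set0)).
  apply: bigcupT_measurable => n; case: unpickle => [c|]; last exact: measurable0.
  by case: ifP.
apply/seteqP; split => [x Bx|x [n _]].
  by exists (pickle (k x)) => //; rewrite pickleK asboolT.
by case: unpickle => // c; case: ifPn => // /asboolP Bc /= kx; rewrite /preimage/= kx.
Qed.

(** [V -> R] carries no sigma-algebra here, so the argument is rounded to the grid of mesh 1/(n+1).
    The rounded state takes countably many values, hence composes measurably with anything, and the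
    Lipschitz bound makes the rounding error vanish in the limit. *)
Lemma measurable_good_comp d (T : measurableType d) eps (F : V -> (V -> R) -> R) i
    (L : T -> V -> R) : good eps F ->
  (forall j, measurable_fun setT (L ^~ j)) ->
  measurable_fun setT (fun w => F i (L w)).
Proof.
move=> [_ [K K0 FK] _] mL.
pose k n w : {ffun V -> int} := [ffun j => Num.floor (L w j * n.+1%:R)].
pose q n (z : {ffun V -> int}) : V -> R := fun j => (z j)%:~R / n.+1%:R.
apply: (@measurable_fun_cvg _ _ _ _ (fun n w => F i (q n (k n w)))).
  move=> n; apply: (@measurable_countable_comp _ _ _ (k n) (F i \o q n)) => z.
  rewrite (_ : _ @^-1` _ = \bigcap_(j in [set: V])
    ((fun w => L w j * n.+1%:R) @^-1` [set` `[(z j)%:~R, (z j + 1)%:~R[])).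
    apply: fin_bigcap_measurable => // j _; rewrite -[X in measurable X]setTI.
    exact: (measurable_funM (mL j) (measurable_cst _)).
  apply/seteqP; split => [w <- j _ /=|w h].
    by rewrite in_itv/= ffunE floor_itv.
  by apply/ffunP => j; rewrite ffunE; apply/floor_def; have := h j Logic.I; rewrite /= in_itv.
move=> w _; apply/cvgrPdist_le => e e0.
have E0 : 0 < e / (K * #|V|%:R + 1) by rewrite divr_gt0// ltr_wpDl// mulr_ge0.
near=> n; apply: le_trans (FK _ _ _) _.
have h j : `|L w j - q n (k n w) j| <= n.+1%:R^-1.
  have n0 : (0 : R) < n.+1%:R by rewrite ltr0n.
  rewrite /q /k ffunE; have /andP[h1 h2] := floor_itv (L w j * n.+1%:R).
  rewrite ler_norml; apply/andP; split.
    rewrite (@le_trans _ _ 0)// ?oppr_le0 ?invr_ge0 ?(ltW n0)//.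
    by rewrite subr_ge0 ler_pdivrMr.
  rewrite lerBlDl -[X in _ + X]mul1r -mulrDl ler_pdivlMr// ltW//.
  by move: h2; rewrite intrD.
apply: (@le_trans _ _ (K * (#|V|%:R * n.+1%:R^-1))).
  rewrite ler_wpM2l//; apply: le_trans (ler_sum _ (fun j _ => h j)) _.
  by rewrite sumr_const mulr_natl.
have hn : n.+1%:R^-1 <= e / (K * #|V|%:R + 1).
  by rewrite ltW//; near: n; exact: near_infty_natSinv_lt (PosNum E0).
rewrite mulrA; apply: le_trans (ler_wpM2l _ hn) _; first by rewrite mulr_ge0.
rewrite mulrCA ger_pMr// ler_pdivrMr ?mul1r ?lerDl//.
by rewrite ltr_wpDl// mulr_ge0.
Unshelve. all: by end_near. Qed.

Section process.
Context d (Omega : measurableType d) (Y : R -> Omega -> V) (ell : V -> R).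
Hypothesis mY : forall (t : R) i, 0 <= t -> measurable (Y t @^-1` [set i]).
Hypothesis rcY : forall w (t : R), 0 <= t -> \forall s \near t^'+, Y s w = Y t w.

(** The time spent at j is the Lebesgue measure of the section at w of a jointly measurable set, so
    Tonelli applies. *)
Lemma measurable_remaining t j : 0 <= t ->
  measurable_fun setT (fun w => remaining ell (Y ^~ w) t j).
Proof.
move=> t0; apply: measurable_funB; first exact: measurable_cst.
pose A := (([set` `[0, t]] : set (measurableTypeR R)) `*` setT) `&`
  [set p : measurableTypeR R * Omega | 0 <= p.1 /\ Y p.1 p.2 = j].
have mA : measurable A.
  apply: measurableI; last exact: measurable_process.
  by apply: measurableX => //; exact: measurable_itv.
rewrite (_ : (fun w => _) = fine \o (@lebesgue_measure R \o ysection A)).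
  by apply: measurableT_comp => //; exact: measurable_fun_ysection.
apply/funext => w /=; rewrite /Rintegral; congr fine.
have mB := measurable_path mY rcY w j.
transitivity (\int[lebesgue_measure]_(s in `[0%R, t])
    (\1_([set s : measurableTypeR R | 0 <= s /\ Y s w = j]) s)%:E)%E.
  apply: eq_integral => s; rewrite inE/= => st.
  by rewrite -(path_indicE (Y ^~ w) j (lexx 0) st).
rewrite integral_indic//; congr (lebesgue_measure _).
apply/seteqP; split => s; rewrite /ysection /= inE /A/=.
  by move=> [[s0 Ys] st].
by move=> [[st _] [s0 Ys]].
Qed.

(** Position and clocks may be taken at different times because the increment in Dynkin's formula is
    split at the mixed state (X_{t+h}, L_t). *)
Lemma measurable_state eps (F : V -> (V -> R) -> R) s t : good eps F ->
  0 <= s -> 0 <= t ->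
  measurable_fun setT (fun w => F (Y s w) (remaining ell (Y ^~ w) t)).
Proof.
move=> gF s0 t0; rewrite (_ : (fun w => _) = (fun w => \sum_i
    \1_(Y s @^-1` [set i]) w * F i (remaining ell (Y ^~ w) t))).
  apply: measurable_sum => i; apply: measurable_funM.
    by apply: measurable_indic; exact: mY.
  by apply: measurable_good_comp gF _ => j; exact: measurable_remaining.
apply/funext => w; rewrite (bigD1 (Y s w))//= indicE mem_set//= mul1r.
rewrite big1 ?addr0// => i /negP iY; rewrite indicE memNset ?mul0r//.
by move=> /= h; apply: iY; rewrite h.
Qed.

End process.

(** The path is frozen after t: s |-> X_{min(s,t)} is a right-continuous process on [Omega] equipped
    with the sigma-algebra [history X t], and it has the same clocks at time t. The measurability of
    clocks already proved then applies to it. *)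
Lemma history_good d (Omega : measurableType d) (X : R -> Omega -> V) ell
    eps (F : V -> (V -> R) -> R) i t (B : set R) :
  (forall w (t : R), 0 <= t -> \forall s \near t^'+, X s w = X t w) ->
  good eps F -> 0 <= t -> measurable B ->
  history X t [set w | B (F i (remaining ell (X ^~ w) t))].
Proof.
move=> rcX gF t0 mB; pose G := [set A | exists (s : R) i,
  [/\ 0 <= s, s <= t & A = X s @^-1` [set i]]].
pose Y s (w : g_sigma_algebraType G) := X (Num.min s t) w.
have mY s j : 0 <= s -> measurable (Y s @^-1` [set j]).
  move=> s0; apply: sub_sigma_algebra; exists (Num.min s t), j; split => //.
    by rewrite le_min s0.
  by rewrite ge_min lexx orbT.
have rcY w s : 0 <= s -> \forall u \near s^'+, Y u w = Y s w.
  move=> s0; have [st|ts] := ltP s t.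
    have h := rcX w s s0; near=> u; rewrite /Y !min_l ?(ltW st)//.
      by near: u.
    by near: u; exact: nbhs_right_le.
  near=> u; have su : s < u by near: u; exact: nbhs_right_gt.
  by rewrite /Y !min_r// (le_trans ts)// ltW.
have := @measurable_good_comp _ _ eps F i (fun w => remaining ell (Y ^~ w) t) gF
  (fun j => measurable_remaining ell mY rcY j t0) measurableT B mB.
rewrite setTI /history -/G; congr (<<s G >> _).
apply/seteqP; split => w /=; congr (B (F i _)); apply/funext => j;
  rewrite /remaining; congr (_ - _); apply: eq_Rintegral => s;
  by rewrite inE/= in_itv/= /Y => /andP[_ st]; rewrite min_l.
Unshelve. all: by end_near. Qed.

End state_measurability.

Lemma Rintegral_probability_cst d (T : measurableType d) (R : realType)
    (P : probability T R) (c : R) : \int[P]_w c = c.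
Proof.
by rewrite Rintegral_cst// [X in fine X](_ : _ = 1%E) ?mulr1//; exact: probability_setT.
Qed.

Lemma probability_bounded_integrable d (T : measurableType d) (R : realType)
    (P : probability T R) (f : T -> R) (K : R) :
  measurable_fun setT f -> (forall x, `|f x| <= K) -> P.-integrable setT (EFin \o f).
Proof.
move=> mf fK; apply: (@bounded_integrable _ _ _ _ _ _ K) => //.
exact: le_lt_trans (probability_le1 P measurableT) (ltry 1).
Qed.

(** * Right derivatives and limits of integrals *)

Section right_limits.
Context (R : realType).

(** Mean value argument: let c be the infimum of the times s at which |W s - W 0| <= e' s fails. By
    left continuity the bound still holds at c, and the right derivative propagates it to some [c, c
    + d), which contradicts the choice of c. *)
Lemma right_derive0_cst (W : R -> R) : continuous W ->
  (forall t, 0 <= t -> h^-1 * (W (t + h) - W t) @[h --> 0^'+] --> 0) ->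
  forall t, 0 <= t -> W t = W 0.
Proof.
move=> cW dW t t0; apply/eqP; rewrite -subr_eq0 -normr_le0; apply/ler_addgt0Pr => e e0.
rewrite add0r; pose e' := e / (t + 1).
have t1 : 0 < t + 1 by rewrite ltr_wpDl.
have e'0 : 0 < e' by rewrite divr_gt0.
suff H : `|W t - W 0| <= e' * t.
  by rewrite (le_trans H)// /e' mulrAC ler_pdivrMr// ler_wpM2l ?ltW// ltrDl.
rewrite leNgt; apply/negP => bad.
pose B := [set s | 0 <= s /\ e' * s < `|W s - W 0|].
have B0 : has_inf B by split; [exists t|exists 0 => s []].
pose c := inf B.
have c0 : 0 <= c by apply: lb_le_inf; [case: B0|move=> s []].
have ltc s : 0 <= s -> s < c -> `|W s - W 0| <= e' * s.
  move=> s0 sc; rewrite leNgt; apply/negP => Bs; move: sc; rewrite ltNge => /negP; apply.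
  by apply: ge_inf; [case: B0|split].
have goodc : `|W c - W 0| <= e' * c.
  have [<-|cn0] := eqVneq 0 c; first by rewrite subrr normr0 mulr0.
  have cp : 0 < c by rewrite lt_neqAle cn0.
  have cl : `|W s - W 0| @[s --> c^'-] --> `|W c - W 0|.
    by apply: cvg_at_left_filter; apply: cvg_norm; apply: cvgB; [exact: cW|exact: cvg_cst].
  have cr : e' * s @[s --> c^'-] --> e' * c.
    by apply: cvg_at_left_filter; exact: mulrl_continuous.
  apply: ler_cvg_to cl cr _; near=> s; apply: ltc; last by near: s; exact: nbhs_left_lt.
  by near: s; exact: nbhs_left_ge.
have /cvgrPdist_le/(_ e' e'0)[d /= d0 Hd] := dW c c0.
suff : c + d <= c by rewrite gerDl leNgt d0.
apply: lb_le_inf; first by case: B0.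
move=> s Bs; have cs : c <= s by apply: ge_inf => //; case: B0.
have {Bs}[s0 Bs] := Bs; rewrite leNgt; apply/negP => scd.
move: Bs; rewrite ltNge => /negP; apply.
move: cs; rewrite le_eqVlt => /predU1P[<-//|cs].
have sc0 : 0 < s - c by rewrite subr_gt0.
have := Hd (s - c); rewrite /= sub0r normrN gtr0_norm// => /(_ _ sc0).
rewrite ltrBlDl scd sub0r normrN [c + _]addrC subrK normrM normfV => /(_ isT).
rewrite (gtr0_norm sc0) mulrC ler_pdivrMr// => H.
rewrite (_ : W s - W 0 = (W s - W c) + (W c - W 0)); last by ring.
apply: le_trans (ler_normD _ _) _; apply: le_trans (lerD H goodc) _.
by rewrite -mulrDr subrK.
Unshelve. all: by end_near. Qed.

Lemma cvg_right_quotient (g : R -> R) (a dg : R) : is_derive a 1 g dg ->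
  h^-1 * (g (a + h) - g a) @[h --> 0^'+] --> dg.
Proof.
move=> [g1 <-]; have /cvg_dnbhs_at_right : h^-1 *: (g (h *: 1 + a) - g a) @[h --> 0^'] --> 'D_1 g a.
  exact: g1.
by under eq_fun do rewrite /GRing.scale/= mulr1 [_ + a]addrC.
Qed.

Lemma cvg_right_Rintegral d (T : measurableType d) (P : probability T R)
    (Z : R -> T -> R) (Z0 : T -> R) (K : R) :
  (forall h, 0 < h -> measurable_fun setT (Z h)) -> measurable_fun setT Z0 ->
  (forall h w, 0 < h -> `|Z h w| <= K) ->
  (forall w, Z h w @[h --> 0^'+] --> Z0 w) ->
  \int[P]_w Z h w @[h --> 0^'+] --> \int[P]_w Z0 w.
Proof.
move=> mZ mZ0 ZK Zcvg; apply/cvg_at_rightP => u [u0 ucvg].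
have [|||||iZ0 _ H] := @dominated_convergence _ _ _ P setT measurableT
  (fun n w => (Z (u n) w)%:E) (EFin \o Z0) (cst K%:E).
- by move=> n; apply/measurable_EFinP; exact: mZ.
- exact/measurable_EFinP.
- apply: aeW => w _; apply: cvg_EFin; first by near=> n.
  exact: (cvg_at_rightP _ 0 (Z0 w)).1 (Zcvg w) u (conj u0 ucvg).
- exact: finite_measure_integrable_cst.
- by apply: aeW => w n _; rewrite lee_fin; exact: ZK.
by apply: fine_cvg; rewrite fineK// integrable_fin_num.
Unshelve. all: by end_near. Qed.

Lemma cvg_sum_seq (F : set_system R) {FF : Filter F} (I : Type) (s : seq I)
    (f : I -> R -> R) (l : I -> R) :
  (forall i, f i x @[x --> F] --> l i) ->
  \sum_(i <- s) f i x @[x --> F] --> \sum_(i <- s) l i.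
Proof.
move=> fl; elim: s => [|i s IH].
  by under eq_fun do rewrite big_nil; rewrite big_nil; exact: cvg_cst.
by under eq_fun do rewrite big_cons; rewrite big_cons; apply: cvgD.
Qed.

(** Convergence is known only against events of [S]. A bounded [G] whose level sets lie in [S] is a
    uniform limit of step functions on such events. The functions [m h] need not be bounded, but
    their integrals converge, so the approximation error is uniform in small h. *)
Lemma weak_cvg_bounded d (T : measurableType d) (P : probability T R)
    (S : set (set T)) (m : R -> T -> R) (c G : T -> R) (K : R) :
  (forall h, 0 < h -> P.-integrable setT (EFin \o m h)) ->
  (forall h w, 0 < h -> 0 <= m h w) ->
  P.-integrable setT (EFin \o c) -> (forall w, 0 <= c w) ->
  (forall A, S A -> measurable A) ->
  (forall B, measurable B -> S (G @^-1` B)) ->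
  (forall A, S A -> \int[P]_w (\1_A w * m h w) @[h --> 0^'+] -->
     \int[P]_w (\1_A w * c w)) ->
  (forall w, `|G w| <= K) ->
  \int[P]_w (G w * m h w) @[h --> 0^'+] --> \int[P]_w (G w * c w).
Proof.
move=> im m0 ic c0 mS SG Sm GK.
have mG : measurable_fun setT G by move=> _ B mB; rewrite setTI; apply: mS; exact: SG.
have ST : S setT by rewrite -(preimage_setT G); exact: SG.
pose N1 (N : nat) : R := N.+1%:R.
have N10 N : 0 < N1 N by rewrite ltr0n.
pose A N k := G @^-1` [set` `[k%:R / N1 N - K, k.+1%:R / N1 N - K[].
have SA N k : S (A N k) by apply: SG; exact: measurable_itv.
(* G + K takes values in [0, 2 K], so these levels cover its whole range, top value included. *)
pose M N := (Num.truncn (2 * K * N1 N)).+1.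
pose GN N w := \sum_(k <- iota 0 (M N)) (k%:R / N1 N - K) * \1_(A N k) w.
have GNE N w : GN N w = (Num.truncn ((G w + K) * N1 N))%:R / N1 N - K.
  have /andP[g1 g2] : - K <= G w <= K by rewrite -ler_norml.
  have gp : 0 <= (G w + K) * N1 N by rewrite mulr_ge0 ?(ltW (N10 _))//; lra.
  have AE k : (w \in A N k) = (k == Num.truncn ((G w + K) * N1 N)).
    have -> : (w \in A N k) = (k%:R <= (G w + K) * N1 N < k.+1%:R).
      rewrite -ler_pdivrMr// -ltr_pdivlMr// -lerBlDr -ltrBrDr.
      by apply/idP/idP => [/set_mem|h]; [|apply/mem_set]; rewrite /A/= in_itv.
    by rewrite -[RHS]eq_sym; apply/idP/eqP; [exact: truncn_def|move=> <-; rewrite truncn_itv].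
  rewrite /GN (bigD1_seq (Num.truncn ((G w + K) * N1 N))) ?iota_uniq//=; last first.
    rewrite -[_ :: _]/(iota 0 (M N)) mem_iota add0n leq0n/= ltnS; apply: le_truncn.
    by rewrite ler_wpM2r ?(ltW (N10 _))//; lra.
  rewrite indicE AE eqxx mulr1 big1 ?addr0// => k /negbTE kn.
  by rewrite indicE AE kn mulr0.
have GNd N w : `|G w - GN N w| <= (N1 N)^-1.
  rewrite GNE; set x := (G w + K) * N1 N; have N0 := N10 N.
  have /andP[g1 g2] : - K <= G w <= K by rewrite -ler_norml.
  have /truncn_itv/andP[h1 h2] : 0 <= x.
    by rewrite /x; apply: mulr_ge0; [lra|exact: ltW].
  rewrite (_ : G w = x / N1 N - K); last first.
    by rewrite /x mulfK ?addrK// gt_eqF.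
  rewrite (_ : _ - _ = (x - (Num.truncn x)%:R) / N1 N); last by ring.
  rewrite normrM normfV (gtr0_norm N0) ler_pdivrMr// mulVf ?gt_eqF//.
  by rewrite ger0_norm ?subr_ge0// lerBlDl ltW// natr1.
have mGN N : measurable_fun setT (GN N).
  apply: measurable_sum => k; apply: measurable_funM; first exact: measurable_cst.
  by apply: measurable_indic; apply: mS.
have ind1 (B : set T) w : `|\1_B w| <= 1 :> R.
  by rewrite indicE; case: (_ \in _); rewrite ?normr1 ?normr0.
have intGN N f : P.-integrable setT (EFin \o f) ->
    \int[P]_w (GN N w * f w) = \sum_(k <- iota 0 (M N))
      (k%:R / N1 N - K) * \int[P]_w (\1_(A N k) w * f w).
  move=> fi; have ik k : P.-integrable setT (EFin \o (fun w => \1_(A N k) w * f w)).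
    by apply: (@integrable_bounded_mul _ _ _ _ _ _ _ _ 1) => //; apply: measurable_indic; exact: mS.
  transitivity (\int[P]_w \sum_(k <- iota 0 (M N))
      ((k%:R / N1 N - K) * (\1_(A N k) w * f w))).
    apply: eq_Rintegral => w _; rewrite /GN mulr_suml.
    by apply: eq_bigr => k _; rewrite mulrA.
  rewrite Rintegral_sum//; last first.
    move=> k; rewrite (_ : _ \o _ = fun w => ((k%:R / N1 N - K)%:E *
      (\1_(A N k) w * f w)%:E)%E)//.
    exact: (integrableZl measurableT _ (ik k)).
  by apply: eq_bigr => k _; rewrite RintegralZl.
have cvgGN N : \int[P]_w (GN N w * m h w) @[h --> 0^'+] --> \int[P]_w (GN N w * c w).
  rewrite intGN//; apply: (@cvg_trans _ ((fun h => \sum_(k <- iota 0 (M N))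
      (k%:R / N1 N - K) * \int[P]_w (\1_(A N k) w * m h w)) @ 0^'+)).
    apply: near_eq_cvg; near=> h; rewrite intGN//; apply: im.
    by near: h; exact: nbhs_right_gt.
  by apply: cvg_sum_seq => k; apply: cvgMr; apply: Sm.
have dif N f : P.-integrable setT (EFin \o f) -> (forall w, 0 <= f w) ->
    `|\int[P]_w (G w * f w) - \int[P]_w (GN N w * f w)| <= (N1 N)^-1 * \int[P]_w f w.
  move=> fi f0; have iG : P.-integrable setT (EFin \o (fun w => G w * f w)).
    exact: (@integrable_bounded_mul _ _ _ _ _ _ _ _ K).
  have GNb w : `|GN N w| <= K + (N1 N)^-1.
    rewrite (_ : GN N w = G w - (G w - GN N w)); last by ring.
    by apply: le_trans (ler_normB _ _) _; rewrite lerD.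
  have iGN : P.-integrable setT (EFin \o (fun w => GN N w * f w)).
    exact: (@integrable_bounded_mul _ _ _ _ _ _ _ _ (K + (N1 N)^-1)).
  rewrite -RintegralB//.
  apply: le_trans (le_normr_Rintegral _ _) _ => //; first exact: integrableBr.
  rewrite -RintegralZl//; apply: le_Rintegral => //.
  - by apply: integrable_norm; exact: integrableBr.
  - exact: integrableZlr.
  - by move=> w _; rewrite -mulrBl normrM (ger0_norm (f0 w)) ler_wpM2r.
have c1 : 0 <= \int[P]_w c w by apply: Rintegral_ge0.
apply/cvgrPdist_le => e e0.
(* Replacing [G] by [GN N] costs (N1 N)^-1 times the mass of [c] on one side and that of [m h] on
   the other; the latter is at most the mass of [c] plus 1 for small h. *)
pose C := 2 * (\int[P]_w c w) + 1; have C0 : 0 < C by rewrite /C; lra.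
have eC : 0 < e / 2 / C by rewrite !divr_gt0.
have [N _ /(_ N (leqnn N)) hN] : \forall n \near \oo, n.+1%:R^-1 < e / 2 / C.
  exact: near_infty_natSinv_lt (PosNum eC).
have cm : \int[P]_w m h w @[h --> 0^'+] --> \int[P]_w c w.
  have := Sm _ ST; rewrite indicT.
  by under eq_fun do under eq_Rintegral do rewrite mul1r;
     under eq_Rintegral do rewrite mul1r.
near=> h; have h0 : 0 < h by near: h; exact: nbhs_right_gt.
have mh : \int[P]_w m h w <= \int[P]_w c w + 1.
  have : `|\int[P]_w c w - \int[P]_w m h w| <= 1.
    by near: h; move/cvgrPdist_le : cm; exact.
  by rewrite ler_norml => /andP[]; lra.
have d1 := dif N _ ic c0; have d2 := dif N _ (im _ h0) (fun w => m0 h w h0).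
have d3 : `|\int[P]_w (GN N w * c w) - \int[P]_w (GN N w * m h w)| <= e / 2.
  by near: h; move/cvgrPdist_le : (cvgGN N); apply; rewrite divr_gt0.
rewrite (_ : _ - _ = (\int[P]_w (G w * c w) - \int[P]_w (GN N w * c w)) +
  (\int[P]_w (GN N w * c w) - \int[P]_w (GN N w * m h w)) -
  (\int[P]_w (G w * m h w) - \int[P]_w (GN N w * m h w))); last by ring.
apply: le_trans (ler_normB _ _) _.
apply: le_trans (lerD (le_trans (ler_normD _ _) (lerD d1 d3)) d2) _.
have H : (N1 N)^-1 * C <= e / 2 by rewrite -ler_pdivlMr// ltW.
have H' : (N1 N)^-1 * (\int[P]_w m h w) <= (N1 N)^-1 * (\int[P]_w c w + 1).
  by rewrite ler_wpM2l// invr_ge0 ltW.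
move: H H'; rewrite /C; set u := (N1 N)^-1; set a := \int[P]_w c w.
set b := \int[P]_w m h w; rewrite !mulrDr !mulr1 mulrCA.
by move: (u * a) (u * b) => ua ub; lra.
Unshelve. all: by end_near. Qed.

End right_limits.

(** * Dynkin's formula *)

Section vdjp_dynkin.
Context (R : realType) (V : finType) (beta : V -> V -> R).
Hypothesis beta_ge0 : forall i j, 0 <= beta i j.
Context d (Omega : measurableType d) (P : probability Omega R).
Context (X : R -> Omega -> V) (v : V) (ell : V -> R).
Hypothesis ell_cube : half_open_cube ell.
Hypothesis HX : is_vdjp beta v ell P X.

Local Notation L t w := (remaining ell (X ^~ w) t).
Local Notation mX := (vdjp_measurable HX).
Local Notation rcX := (vdjp_right_continuous HX).

Let mpath w i := measurable_path mX rcX w i.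

Definition state_mean (F : V -> (V -> R) -> R) (t : R) : R :=
  \int[P]_w F (X t w) (L t w).

Lemma remaining_le1 t w j : 0 <= t -> L t w j <= 1.
Proof.
move=> t0; have t00 : 0 <= (0 : R) <= t by rewrite lexx.
have /andP[] := remaining_lip ell (mpath w) j t00.
by rewrite remaining0; have /andP[_] := ell_cube j; lra.
Qed.

Lemma l1dist_remaining s t w : 0 <= s -> 0 <= t ->
  l1dist (L s w) (L t w) <= #|V|%:R * `|s - t|.
Proof.
move=> s0 t0; rewrite -[#|V|%:R]/(#|[pred _ : V | true]|%:R) mulr_natl -sumr_const.
apply: ler_sum => j _; have [st|/ltW ts] := leP s t.
  have sst : 0 <= s <= t by rewrite s0.
  have /andP[h1 h2] := remaining_lip ell (mpath w) j sst.
  by rewrite ger0_norm// distrC ger0_norm// subr_ge0.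
have sst : 0 <= t <= s by rewrite t0.
have /andP[h1 h2] := remaining_lip ell (mpath w) j sst.
by rewrite distrC ger0_norm// ger0_norm// subr_ge0.
Qed.

Lemma aliveP t w : 0 <= t -> alive ell X t w <-> forall j, 0 < L t w j.
Proof. by move=> t0; exact: (lt_lifetimeP ell (mpath w) v t0). Qed.

Lemma dead_vanish eps F i t s w : 0 <= eps -> good eps F -> 0 <= t <= s ->
  ~ alive ell X t w -> F i (L s w) = 0.
Proof.
move=> e0 [_ _ Fv] /andP[t0 ts] /(aliveP _ t0)/existsNP[j /negP]; rewrite -leNgt => Lj.
apply: (Fv _ _ j); apply: le_trans e0; apply: le_trans Lj.
have tts : 0 <= t <= s by rewrite t0.
by have /andP[] := remaining_lip ell (mpath w) j tts; lra.
Qed.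

Lemma measurable_alive t : 0 <= t -> measurable (alive ell X t).
Proof.
move=> t0; rewrite (_ : alive ell X t = \bigcap_(j in [set: V])
    ((fun w => L t w j) @^-1` [set` `]0, +oo[])).
  apply: fin_bigcap_measurable => // j _; rewrite -[X in measurable X]setTI.
  exact: (measurable_remaining ell mX rcX).
apply/seteqP; split => w; first by move=> /(aliveP _ t0) h j _ /=; rewrite in_itv/= h.
by move=> h; apply/(aliveP _ t0) => j; have := h j Logic.I; rewrite /= in_itv/= andbT.
Qed.

Lemma integrable_state eps F s t : good eps F -> 0 <= s -> 0 <= t ->
  P.-integrable setT (EFin \o (fun w => F (X s w) (L t w))).
Proof.
move=> gF s0 t0; have [[K K0 FK] _ _] := gF.
apply: (@probability_bounded_integrable _ _ _ _ _ K) => //.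
exact: (measurable_state ell mX rcX gF).
Qed.

Let B t i := alive ell X t `&` X t @^-1` [set i].

Let mB t i : 0 <= t -> measurable (B t i).
Proof. by move=> t0; apply: measurableI; [exact: measurable_alive|exact: mX]. Qed.

Let out_rate t i j w := \1_(B t i) w * (beta i j * L t w j).

Let jumped t i j h w := h^-1 * \1_(B t i `&` X (t + h) @^-1` [set j]) w.

Let mC t i j h : 0 <= t -> 0 < h -> measurable (B t i `&` X (t + h) @^-1` [set j]).
Proof. by move=> t0 h0; apply: measurableI; [exact: mB|apply: mX; rewrite addr_ge0// ltW]. Qed.

Let out_rate_ge0 t i j w : 0 <= t -> 0 <= out_rate t i j w.
Proof.
move=> t0; rewrite /out_rate indicE; case: (boolP (w \in _)) => [|_]; last by rewrite mul0r.
by move=> /set_mem[/(aliveP _ t0) h _]; rewrite mul1r mulr_ge0// ltW.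
Qed.

Let measurable_out_rate t i j : 0 <= t -> measurable_fun setT (out_rate t i j).
Proof.
move=> t0; apply: measurable_funM; first by apply: measurable_indic; exact: mB.
apply: measurable_funM; first exact: measurable_cst.
exact: (measurable_remaining ell mX rcX).
Qed.

Let integrable_out_rate t i j : 0 <= t -> P.-integrable setT (EFin \o out_rate t i j).
Proof.
move=> t0; apply: (@probability_bounded_integrable _ _ _ _ _ (beta i j)) => //.
  exact: measurable_out_rate.
move=> w; rewrite ger0_norm ?out_rate_ge0// /out_rate indicE.
case: (boolP (w \in _)) => _; last by rewrite mul0r.
by rewrite mul1r ler_piMr// remaining_le1.
Qed.

Let history_measurable t A : 0 <= t -> history X t A -> measurable A.
Proof.
move=> t0 hA; apply: (@smallest_sub _ _ _ _ _ _ A hA).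
  exact: sigma_algebra_measurable.
by move=> _ [s [i [s0 _ ->]]]; exact: mX.
Qed.

(** The rate condition in real-valued form, with the alive-at-i event absorbed into both integrands
    so that only the history event [A] remains as test. *)
Lemma cvg_jump_rate t i j A : 0 <= t -> i != j -> history X t A ->
  \int[P]_w (\1_A w * jumped t i j h w) @[h --> 0^'+] -->
  \int[P]_w (\1_A w * out_rate t i j w).
Proof.
move=> t0 ij hA; have mA := history_measurable t0 hA.
have := vdjp_rates HX t0 ij hA => /=.
have -> : A `&` alive ell X t `&` X t @^-1` [set i] = A `&` B t i by rewrite setIA.
have mAB : measurable (A `&` B t i) by apply: measurableI => //; exact: mB.
have -> : (\int[P]_(w in A `&` B t i) (beta i j * L t w j)%:E)%E =
    (\int[P]_w (\1_A w * out_rate t i j w)%:E)%E.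
  rewrite integral_mkcond; apply: eq_integral => w _.
  rewrite /patch in_setI /out_rate !indicE; case: (w \in A); case: (w \in B t i);
    by rewrite ?mul1r ?mul0r.
have iR : P.-integrable setT (EFin \o (fun w => \1_A w * out_rate t i j w)).
  apply: (le_integrable measurableT _ _ (integrable_out_rate i j t0)).
    apply/measurable_EFinP; apply: measurable_funM; last exact: measurable_out_rate.
    exact: measurable_indic.
  move=> w _; rewrite /= lee_fin normrM indicE.
  by case: (w \in A); rewrite ?normr1 ?mul1r// normr0 mul0r.
rewrite -[(\int[P]_w _)%E]fineK ?integrable_fin_num// => /fine_cvg.
apply: cvg_trans; apply: near_eq_cvg; near=> h.
have h0 : 0 < h by near: h; exact: nbhs_right_gt.
have mABC : measurable (A `&` B t i `&` X (t + h) @^-1` [set j]).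
  by rewrite -setIA; apply: measurableI => //; exact: mC.
transitivity (\int[P]_w (h^-1 * \1_(A `&` B t i `&` X (t + h) @^-1` [set j]) w)).
  rewrite RintegralZl//; last exact: integrable_indic.
  rewrite /Rintegral integral_indic// setIT /= fineM//.
  exact: fin_num_measure.
apply: eq_Rintegral => w _; rewrite /jumped !indicE !in_setI.
by case: (w \in A); rewrite ?mul1r ?mul0r ?mulr0.
Unshelve. all: by end_near. Qed.

(** Only the pair (X_t, X_{t+h}) contributes, and on dead paths every value of [F] is 0. The
    expansion writes the increment as coefficients depending on the clocks at t, hence on the
    history, times indicators of jumps, whose limits the rates give. *)
Lemma jump_sumE eps F t h w : 0 <= eps -> good eps F -> 0 <= t ->
  h^-1 * (F (X (t + h) w) (L t w) - F (X t w) (L t w)) =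
  \sum_(p : V * V) (F p.2 (L t w) - F p.1 (L t w)) * jumped t p.1 p.2 h w.
Proof.
move=> e0 gF t0; have tt : 0 <= t <= t by rewrite t0 lexx.
case: (pselect (alive ell X t w)) => [aw|dw]; last first.
  have F0 i : F i (L t w) = 0 by exact: dead_vanish gF tt dw.
  by rewrite !F0 subrr mulr0 big1// => p _; rewrite !F0 subrr mul0r.
rewrite (bigD1 (X t w, X (t + h) w))//= big1 ?addr0.
  by rewrite /jumped indicE mem_set ?mulr1 1?mulrC.
move=> [i j] /= /eqP ij; rewrite /jumped indicE memNset ?mulr0//.
by move=> [[_ /= Xi] Xj]; apply: ij; rewrite Xi Xj.
Qed.

Lemma rate_sumE eps F t w : 0 <= eps -> good eps F -> 0 <= t ->
  jump_part beta F (X t w) (L t w) =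
  \sum_(p : V * V) (F p.2 (L t w) - F p.1 (L t w)) * out_rate t p.1 p.2 w.
Proof.
move=> e0 gF t0; have tt : 0 <= t <= t by rewrite t0 lexx.
case: (pselect (alive ell X t w)) => [aw|dw]; last first.
  have F0 i : F i (L t w) = 0 by exact: dead_vanish gF tt dw.
  rewrite /jump_part big1; last by move=> j _; rewrite !F0 subrr mulr0.
  by rewrite big1// => p _; rewrite !F0 subrr mul0r.
rewrite -(pair_big xpredT xpredT (fun i j =>
  (F j (L t w) - F i (L t w)) * out_rate t i j w))/= (bigD1 (X t w))//=.
rewrite [X in _ = _ + X]big1 ?addr0; last first.
  move=> i /eqP iX; rewrite big1// => j _; rewrite /out_rate indicE memNset ?mul0r ?mulr0//.
  by move=> [_ /= Xi]; apply: iX.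
apply: eq_bigr => j _; rewrite /out_rate indicE mem_set//= mul1r.
rewrite clamp_id; first by rewrite mulrC.
have /(aliveP _ t0) h := aw; rewrite (ltW (h j)) (le_trans (remaining_le1 w j t0))//.
by rewrite ler1n.
Qed.

Lemma cvg_jump_term eps F t : 0 <= eps -> good eps F -> 0 <= t ->
  \int[P]_w (h^-1 * (F (X (t + h) w) (L t w) - F (X t w) (L t w)))
    @[h --> 0^'+] --> state_mean (jump_part beta F) t.
Proof.
move=> e0 gF t0; have [[K K0 FK] _ _] := gF.
have ij h i j : 0 < h -> P.-integrable setT (EFin \o jumped t i j h).
  move=> h0; apply: integrableZlr => //.
  by apply: integrable_indic; exact: mC.
have G2K i j w : `|F j (L t w) - F i (L t w)| <= K + K.
  by apply: le_trans (ler_normB _ _) _; rewrite lerD.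
have mG i j : measurable_fun setT (fun w => F j (L t w) - F i (L t w)).
  by apply: measurable_funB; apply: (measurable_good_comp _ gF) => k;
    exact: (measurable_remaining ell mX rcX).
have iG i j f : P.-integrable setT (EFin \o f) ->
    P.-integrable setT (EFin \o (fun w => (F j (L t w) - F i (L t w)) * f w)).
  by move=> fi; apply: (@integrable_bounded_mul _ _ _ _ _ _ _ _ (K + K)).
rewrite /state_mean; under eq_Rintegral => w _ do rewrite (rate_sumE w e0 gF t0).
rewrite Rintegral_sum//; last by move=> p; apply: iG; exact: integrable_out_rate.
apply: (@cvg_trans _ ((fun h => \sum_(p <- index_enum _)
    \int[P]_w ((F p.2 (L t w) - F p.1 (L t w)) * jumped t p.1 p.2 h w)) @ 0^'+)).
  apply: near_eq_cvg; near=> h; have h0 : 0 < h by near: h; exact: nbhs_right_gt.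
  rewrite -Rintegral_sum//; last by move=> p; apply: iG; exact: ij.
  by apply: eq_Rintegral => w _; rewrite (jump_sumE h w e0 gF t0).
(* The rates concern distinct vertices only; on the diagonal the coefficient is 0. *)
apply: cvg_sum_seq => -[i j] /=; have [->|nij] := eqVneq i j.
  under eq_fun do under eq_Rintegral do rewrite subrr mul0r.
  under eq_Rintegral do rewrite subrr mul0r.
  exact: cvg_cst.
apply: (@weak_cvg_bounded _ _ _ P (history X t) _ _ _ (K + K)) => //.
- by move=> h h0; exact: ij.
- move=> h w h0; rewrite /jumped indicE mulr_ge0// invr_ge0 ltW//.
- exact: integrable_out_rate.
- by move=> w; exact: out_rate_ge0.
- by move=> A; exact: history_measurable.
- move=> C mC'; have := @history_good _ _ _ _ X ell eps (fun _ l => F j l - F i l) i t C rcX.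
  by apply => //; case: gF => [[K1 K10 FK1] [L1 L10 FL1] Fv]; split;
    [exists (K + K); rewrite ?addr_ge0// => _ l; apply: le_trans (ler_normB _ _) _; rewrite lerD
    |exists (L1 + L1); rewrite ?addr_ge0// => _ l l';
     rewrite (_ : _ - _ = (F j l - F j l') - (F i l - F i l'));
       [apply: le_trans (ler_normB _ _) _; rewrite mulrDl lerD//|ring]
    |move=> _ l k lk; rewrite !(Fv _ _ k lk) subrr].
- by move=> A; exact: cvg_jump_rate.
Unshelve. all: by end_near. Qed.

Lemma remaining_eventually t w : 0 <= t -> exists2 e, 0 < e & forall h, 0 < h < e ->
  X (t + h) w = X t w /\ L (t + h) w = upd (L t w) (X t w) (L t w (X t w) - h).
Proof.
move=> t0; have [e /= e0 He] := rcX w t0; exists e => // h /andP[h0 he].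
have Xe u : t < u <= t + h -> X u w = X t w.
  move=> /andP[tu uth]; apply: He => //=.
  by rewrite distrC gtr0_norm ?subr_gt0//; lra.
split; first by apply: Xe; rewrite ltrDl h0 lexx.
have tth : 0 <= t <= t + h by rewrite t0 lerDl ltW.
by rewrite (remaining_const ell (mpath w) tth Xe) [t + h]addrC addrK.
Qed.

(** For small h the path stays at i = X_t and only the clock of i runs, from l_i to l_i - h, so the
    quotient tends pathwise to - Df(i, l). The Lipschitz bound and the unit speed of the clocks
    dominate the quotients; dead paths contribute 0. *)
Lemma cvg_drift_term eps f Df t : 0 <= eps -> good eps f -> good eps Df ->
  own_derivative f Df -> 0 <= t ->
  \int[P]_w (h^-1 * (f (X (t + h) w) (L (t + h) w) - f (X (t + h) w) (L t w)))
    @[h --> 0^'+] --> - state_mean Df t.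
Proof.
move=> e0 gf gDf fD t0; have [_ [K K0 fK] _] := gf.
have -> : - state_mean Df t = \int[P]_w (- 1 * Df (X t w) (L t w)).
  by rewrite RintegralZl ?mulN1r//; exact: (integrable_state gDf t0 t0).
apply: (@cvg_right_Rintegral _ _ _ _ _ _ (K * #|V|%:R)).
- move=> h h0; apply: measurable_funM; first exact: measurable_cst.
  have th : 0 <= t + h by rewrite addr_ge0// ltW.
  by apply: measurable_funB; exact: (measurable_state ell mX rcX gf).
- apply: measurable_funM; first exact: measurable_cst.
  exact: (measurable_state ell mX rcX gDf).
- move=> h w h0; have th : 0 <= t + h by rewrite addr_ge0// ltW.
  rewrite normrM normfV (gtr0_norm h0) mulrC ler_pdivrMr//.
  apply: le_trans (fK _ _ _) _; rewrite -mulrA ler_wpM2l//.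
  apply: le_trans (l1dist_remaining w th t0) _.
  by rewrite addrC addKr gtr0_norm.
move=> w; have [e e_gt0 He] := remaining_eventually w t0.
have neare : \forall h \near 0^'+, 0 < h < e.
  by near=> h; apply/andP; split; near: h; [exact: nbhs_right_gt|exact: nbhs_right_lt].
case: (pselect (alive ell X t w)) => [aw|dw]; last first.
  have tt : 0 <= t <= t by rewrite t0 lexx.
  rewrite (dead_vanish _ e0 gDf tt dw) mulr0.
  apply: cvg_near_cst; near=> h.
  have tth : 0 <= t <= t + h by rewrite t0 lerDl ltW//; near: h; exact: nbhs_right_gt.
  by rewrite (dead_vanish _ e0 gf tt dw) (dead_vanish _ e0 gf tth dw) subrr mulr0.
have /(aliveP _ t0) Lp := aw.
set i := X t w; set l := L t w; pose g r := f i (upd l i (l i - r)).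
have dg : is_derive (0 : R) (1 : R) g (- 1 * Df i l).
  have l2 : 0 < l i < 2.
    by rewrite Lp (le_lt_trans (remaining_le1 w i t0))// ltr1n.
  have lE : l i = l i - 0 by rewrite subr0.
  have := fD i l l2; rewrite {1}lE => dfi.
  have dsub : is_derive (0 : R) (1 : R) (fun r : R => l i - r) (- 1).
    by apply: is_derive_eq; rewrite add0r mul1r.
  rewrite mulN1r -mulrN1.
  exact: (@is_derive1_comp R (fun r => f i (upd l i r)) (fun r => l i - r) 0 _ _ dfi dsub).
have := cvg_right_quotient dg; rewrite mulN1r.
apply: cvg_trans; apply: near_eq_cvg; near=> h.
have /He[-> ->] : 0 < h < e by near: h.
by rewrite add0r /g subr0 upd_id.
Unshelve. all: by end_near. Qed.

(** The increment is split at the mixed state (X_{t+h}, L_t): jumping with frozen clocks yields B f,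
    running the clocks at a fixed position yields - D f. *)
Lemma cvg_state_mean_quotient eps f Df t : 0 <= eps -> good eps f -> good eps Df ->
  own_derivative f Df -> 0 <= t ->
  h^-1 * (state_mean f (t + h) - state_mean f t) @[h --> 0^'+] -->
  state_mean (jump_part beta f) t - state_mean Df t.
Proof.
move=> e0 gf gDf fD t0.
apply: (@cvg_trans _ ((fun h =>
    \int[P]_w (h^-1 * (f (X (t + h) w) (L t w) - f (X t w) (L t w))) +
    \int[P]_w (h^-1 * (f (X (t + h) w) (L (t + h) w) - f (X (t + h) w) (L t w))))
    @ 0^'+)); last first.
  exact: cvgD (cvg_jump_term e0 gf t0) (cvg_drift_term e0 gf gDf fD t0).
apply: near_eq_cvg; near=> h; have h0 : 0 < h by near: h; exact: nbhs_right_gt.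
have th : 0 <= t + h by rewrite addr_ge0// ltW.
have i1 := integrable_state gf th t0; have i2 := integrable_state gf t0 t0.
have i3 := integrable_state gf th th.
have i4 := integrableBr measurableT i1 i2; have i5 := integrableBr measurableT i3 i1.
rewrite -RintegralD//; [|exact: integrableZlr..].
rewrite /state_mean -RintegralB// -RintegralZl//; last exact: integrableBr.
by apply: eq_Rintegral => w _; rewrite -mulrDr; congr (_ * _); ring.
Unshelve. all: by end_near. Qed.

Lemma measurable_neq_state s t : 0 <= s -> 0 <= t ->
  measurable [set w | X s w != X t w].
Proof.
move=> s0 t0; rewrite (_ : mkset _ = ~` \bigcup_(i in [set: V])
    (X s @^-1` [set i] `&` X t @^-1` [set i])).
  apply: measurableC; apply: fin_bigcup_measurable => // i _.
  by apply: measurableI; exact: mX.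
apply/seteqP; split => w /=.
  by move=> /eqP h [i _ [/= si ti]]; apply: h; rewrite si ti.
by move=> h; apply/eqP => st; apply: h; exists (X t w).
Qed.

Lemma measurable_neq_state_fun s t : 0 <= s -> 0 <= t ->
  measurable_fun setT (fun w => (X s w != X t w)%:R : R).
Proof.
move=> s0 t0; rewrite (_ : (fun _ => _) = \1_[set w | X s w != X t w]).
  by apply: measurable_indic; exact: measurable_neq_state.
by apply/funext => w; rewrite indicE; congr (nat_of_bool _)%:R; apply/idP/idP;
  rewrite inE.
Qed.

(** On the right, right-continuous paths and dominated convergence suffice. On the left, a path may
    jump exactly at t, and the probability of this is what the absence of fixed jumps controls. *)
Lemma cvg_jump_probability t : 0 <= t ->
  \int[P]_w (X s w != X t w)%:R @[s --> t^'+] --> 0 /\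
  (0 < t -> \int[P]_w (X s w != X t w)%:R @[s --> t^'-] --> 0).
Proof.
move=> t0; split=> [|tp].
  have h : \int[P]_w (X (t + h) w != X t w)%:R @[h --> 0^'+] --> \int[P]_w (0 : R).
    apply: (@cvg_right_Rintegral _ _ _ _ _ _ 1).
    - by move=> h h0; apply: measurable_neq_state_fun => //; rewrite addr_ge0// ltW.
    - exact: measurable_cst.
    - by move=> h w _; case: (_ != _); rewrite ?normr1 ?normr0.
    - move=> w; have [e e_gt0 He] := remaining_eventually w t0.
      apply: cvg_near_cst; near=> h; have /He[-> _] : 0 < h < e.
        by apply/andP; split; near: h; [exact: nbhs_right_gt|exact: nbhs_right_lt].
      by rewrite eqxx.
  rewrite Rintegral_cst// mul0r in h.
  apply/cvg_at_rightP => u [ut ucvg].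
  rewrite (_ : (fun n => \int[P]_w (X (u n) w != X t w)%:R) =
    (fun n => \int[P]_w (X (t + (u n - t)) w != X t w)%:R)); last first.
    by apply/funext => n; rewrite subrKC.
  apply: ((cvg_at_rightP _ 0 0).1 h (fun n => u n - t)).
  split=> [n|]; first by rewrite subr_gt0.
  have ut0 : u n - t @[n --> \oo] --> t - t by apply: cvgB => //; exact: cvg_cst.
  by rewrite subrr in ut0.
have := vdjp_no_fixed_jump HX tp => /fine_cvg; apply: cvg_trans; apply: near_eq_cvg.
near=> s; have s0 : 0 <= s by apply: ltW; near: s; exact: nbhs_left_gt.
rewrite /Rintegral /= -[P _]/(P ([set w | X s w != X t w])).
rewrite -[in LHS](setIT [set w | X s w != X t w]) -integral_indic//; last first.
  exact: measurable_neq_state.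
congr fine; apply: eq_integral => w _; rewrite indicE; congr (nat_of_bool _)%:R%:E.
by apply/idP/idP; rewrite inE.
Unshelve. all: by end_near. Qed.

Lemma state_mean_modulus eps F : good eps F -> exists C, forall s t, 0 <= s -> 0 <= t ->
  `|state_mean F s - state_mean F t| <=
  C * (`|s - t| + \int[P]_w (X s w != X t w)%:R).
Proof.
move=> gF; have [[K K0 FK] [M M0 FM] _] := gF; exists (M * #|V|%:R + (K + K)) => s t s0 t0.
have is0 := integrable_state gF s0 s0; have it0 := integrable_state gF t0 t0.
have in0 : P.-integrable setT (EFin \o (fun w => (X s w != X t w)%:R : R)).
  apply: (@probability_bounded_integrable _ _ _ _ _ 1).
    exact: measurable_neq_state_fun.
  by move=> w; case: (_ != _); rewrite ?normr1 ?normr0.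
have ic0 : P.-integrable setT (EFin \o (fun w : Omega => `|s - t|)).
  by apply: (@probability_bounded_integrable _ _ _ _ _ `|s - t|) => // w; rewrite normr_id.
have ic1 := integrableDr measurableT ic0 in0.
rewrite /state_mean -RintegralB//.
apply: le_trans (le_normr_Rintegral _ _) _ => //; first exact: integrableBr.
have -> : `|s - t| + \int[P]_w (X s w != X t w)%:R =
    \int[P]_w (`|s - t| + (X s w != X t w)%:R).
  by rewrite RintegralD// Rintegral_probability_cst.
rewrite -RintegralZl//; apply: le_Rintegral => //.
- by apply: integrable_norm; exact: integrableBr.
- exact: integrableZlr.
move=> w _; have VM : 0 <= M * #|V|%:R by rewrite mulr_ge0.
apply: (@le_trans _ _ (M * #|V|%:R * `|s - t| + (K + K) * (X s w != X t w)%:R)); last first.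
  rewrite [leRHS]mulrDl; apply: lerD; first by rewrite ler_wpM2l// lerDl.
  by rewrite ler_wpM2l ?lerDr// addr_ge0.
rewrite (_ : _ - _ = (F (X s w) (L s w) - F (X s w) (L t w)) +
  (F (X s w) (L t w) - F (X t w) (L t w))); last by ring.
apply: le_trans (ler_normD _ _) _; apply: lerD.
  by apply: le_trans (FM _ _ _) _; rewrite -mulrA ler_wpM2l// l1dist_remaining.
case: eqP => [->|_]; first by rewrite subrr normr0 mulr0.
by rewrite mulr1; apply: le_trans (ler_normB _ _) _; rewrite lerD.
Qed.

(* Left continuity is where [vdjp_no_fixed_jump] is needed: the right derivatives alone
   do not determine [state_mean]. *)
Lemma continuous_state_mean eps F : good eps F ->
  continuous (fun t : R => state_mean F (Num.max t 0)).
Proof.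
move=> gF; have [C HC] := state_mean_modulus gF.
have key (G : set_system R) (FG : Filter G) (t : R) : 0 <= t ->
    (\forall s \near G, 0 <= s) -> s @[s --> G] --> t ->
    \int[P]_w (X s w != X t w)%:R @[s --> G] --> 0 ->
    state_mean F (Num.max s 0) @[s --> G] --> state_mean F t.
  move=> t0 G0 Gt GX; apply/cvgrPdist_le => e e0.
  pose b s := C * (`|s - t| + \int[P]_w (X s w != X t w)%:R).
  have b0 : b s @[s --> G] --> 0.
    rewrite -(mulr0 C); apply: cvgMr; rewrite -[X in _ --> X](addr0 0); apply: cvgD => //.
    by rewrite -(normr0 R) -(subrr t); apply: cvg_norm; apply: cvgB => //; exact: cvg_cst.
  near=> s; have s0 : 0 <= s by near: s.
  rewrite max_l// distrC; apply: le_trans (HC s t s0 t0) _.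
  apply: le_trans (ler_norm _) _; rewrite -[X in `|X|]opprK normrN -sub0r.
  by near: s; move/cvgrPdist_le : b0; exact.
move=> t; have [t0|t0] := leP 0 t; last first.
  apply: cvg_near_cst; near=> s; rewrite !max_r// ltW//; near: s; exact: lt_nbhsl.
have [cr cl] := cvg_jump_probability t0.
apply/left_right_continuousP; rewrite max_l//; split.
  have [tp|] := ltP 0 t; last first.
    move=> t0'; have -> : t = 0 by apply/eqP; rewrite eq_le t0' t0.
    apply: cvg_near_cst; near=> s; rewrite max_r//; near: s; exact: nbhs_left_le.
  apply: key => //; last exact: cl.
    by near=> s; apply: ltW; near: s; exact: nbhs_left_gt.
  by apply: cvg_at_left_filter; exact: cvg_id.
apply: key => //.
  near=> s; apply: le_trans t0 _; near: s; exact: nbhs_right_ge.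
by apply: cvg_at_right_filter; exact: cvg_id.
Unshelve. all: by end_near. Qed.

Lemma remaining_le0 t w : #|V|%:R <= t -> exists j, L t w j <= 0.
Proof.
move=> Vt; apply: contrapT => /forallNP h.
have t0 : 0 <= t by rewrite (le_trans _ Vt).
have : 0 < \sum_j L t w j.
  rewrite (bigD1 v)//= ltr_pwDl//; first by rewrite ltNge; exact/negP.
  by apply: sumr_ge0 => j _; rewrite leNgt; apply/negP => /ltW; exact: h.
rewrite (remaining_sum ell (mpath w) t0) subr_gt0 ltNge => /negP; apply.
apply: le_trans Vt; rewrite -[#|V|%:R]/(#|[pred _ : V | true]|%:R) -sumr_const.
by apply: ler_sum => j _; have /andP[] := ell_cube j.
Qed.

Lemma state_mean_eq0 eps F t : 0 <= eps -> good eps F -> #|V|%:R <= t -> state_mean F t = 0.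
Proof.
move=> e0 [_ _ Fv] Vt; rewrite /state_mean (@eq_Rintegral _ _ _ _ _ (fun _ => 0)).
  by rewrite Rintegral_probability_cst.
move=> w _; have [j Lj] := remaining_le0 w Vt.
by rewrite (Fv _ _ j)// (le_trans Lj).
Qed.

Lemma state_mean0 eps F : good eps F -> state_mean F 0 = F v ell.
Proof.
move=> gF; rewrite /state_mean -[RHS](Rintegral_probability_cst P) /Rintegral; congr fine.
apply: ae_eq_integral => //.
- by apply/measurable_EFinP; exact: (measurable_state ell mX rcX gF).
- have := vdjp_start HX; apply: filterS => w Xv _; rewrite Xv; congr (F v _)%:E.
  by apply/funext => j; rewrite remaining0.
Qed.

(** The mean of f plus a primitive of the mean of D f - B f is continuous with zero right
    derivative, hence constant. At time 0 the mean of f is f(v, l); at time #|V| it is 0, since some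
    clock has run out on every path. *)
Lemma dynkin_formula eps f Df : 0 <= eps -> good eps f -> good eps Df ->
  own_derivative f Df ->
  f v ell = \int[lebesgue_measure]_(t in `[0, #|V|%:R])
    state_mean (fun i l => Df i l - jump_part beta f i l) t.
Proof.
move=> e0 gf gDf fD; pose F i l := Df i l - jump_part beta f i l; rewrite -/F.
have gF : good eps F by apply: good_sub => //; exact: good_jump_part.
pose psi (t : R) := state_mean F (Num.max t 0).
have cpsi : continuous psi := continuous_state_mean gF.
(* Starting at -1 makes 0 an interior point, so [I] has a two-sided derivative there; the part over
   [-1, 0] cancels in I #|V| - I 0. *)
pose I (t : R) := \int[lebesgue_measure]_(s in `[- 1, t]) psi s.
have ipsi a b : lebesgue_measure.-integrable `[a, b] (EFin \o psi).
  apply: continuous_compact_integrable; first exact: segment_compact.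
  exact: continuous_subspaceT.
have dI (t : R) : 0 <= t -> is_derive t (1 : R) I (psi t).
  move=> t0; have tt : t < t + 1 by rewrite ltrDl.
  have t1 : -1 < t by rewrite (lt_le_trans _ t0)// oppr_lt0.
  have [dG GE] := @continuous_FTC1_closed R psi (- 1) t (t + 1) tt (ipsi _ _) t1 (cpsi t).
  by apply: DeriveDef; [exact: dG|rewrite -derive1E; exact: GE].
pose W (t : R) := state_mean f (Num.max t 0) + I (Num.max t 0).
have cmax : continuous (fun t : R => Num.max t 0).
  by move=> t; apply: continuous_max; [exact: cvg_id|exact: cvg_cst].
have cW : continuous W.
  move=> t; apply: cvgD; first exact: (continuous_state_mean gf).
  have cI : {for Num.max t 0, continuous I}.
    apply: differentiable_continuous; apply/derivable1_diffP.
    by have [] : is_derive (Num.max t 0) (1 : R) I (psi (Num.max t 0));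
      [apply: dI; rewrite le_max lexx orbT|].
  exact: cvg_comp (@cmax t) cI.
have dW (t : R) : 0 <= t -> h^-1 * (W (t + h) - W t) @[h --> 0^'+] --> 0.
  move=> t0.
  have it F' : good eps F' -> P.-integrable setT (EFin \o (fun w => F' (X t w) (L t w))).
    by move=> gF'; exact: (integrable_state gF' t0 t0).
  have psiE : psi t = state_mean Df t - state_mean (jump_part beta f) t.
    rewrite /psi max_l// /state_mean RintegralB//; first exact: it.
    by apply: it; exact: good_jump_part.
  apply: (@cvg_trans _ ((fun h => h^-1 * (state_mean f (t + h) - state_mean f t) +
      h^-1 * (I (t + h) - I t)) @ 0^'+)); last first.
    have sum0 : (state_mean (jump_part beta f) t - state_mean Df t) + psi t = 0.
      by rewrite psiE; ring.
    rewrite -[X in _ `=>` nbhs X]sum0.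
    exact: cvgD (cvg_state_mean_quotient e0 gf gDf fD t0) (cvg_right_quotient (dI t t0)).
  apply: near_eq_cvg; near=> h.
  have h0 : 0 < h by near: h; exact: nbhs_right_gt.
  have th : 0 <= t + h by rewrite addr_ge0// ltW.
  rewrite /W (max_l th) (max_l t0).
  by move: (state_mean f (t + h)) (state_mean f t) (I (t + h)) (I t) => x y z u; ring.
have V0 : (0 : R) <= #|V|%:R by [].
have := right_derive0_cst cW dW V0.
rewrite /W max_l// max_l// (state_mean_eq0 e0 gf)// add0r (state_mean0 gf) => IE.
have -> : f v ell = I #|V|%:R - I 0 by rewrite IE addrK.
rewrite /I (Rintegral_itvB (ipsi (- 1) #|V|%:R)); last 2 first.
- by rewrite bnd_simp oppr_le0.
- by rewrite bnd_simp.
rewrite Rintegral_itv_obnd_cbnd; last first.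
  by apply: integrableS (ipsi 0 #|V|%:R) => //; exact: subset_itv_oc_cc.
by apply: eq_Rintegral => t /[!inE]/=; rewrite in_itv/= => /andP[t0 _]; rewrite /psi max_l.
Unshelve. all: by end_near. Qed.

End vdjp_dynkin.

(** * Derivatives and continuity of finite sums *)

Section derivative_sums.
Context (R : realType).

Lemma is_derive_sum_seq (I : Type) (s : seq I) (h : I -> R -> R) (dh : I -> R) (x : R) :
  (forall i, is_derive x 1 (h i) (dh i)) ->
  is_derive x 1 (fun y => \sum_(i <- s) h i y) (\sum_(i <- s) dh i).
Proof.
move=> hd; elim: s => [|i s IH].
  rewrite big_nil (_ : (fun y => _) = cst 0); first exact: is_derive_cst.
  by apply/funext => y; rewrite big_nil.
rewrite big_cons (_ : (fun y => _) = h i + (fun y => \sum_(i <- s) h i y)).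
  exact: is_deriveD.
by apply/funext => y; rewrite big_cons.
Qed.

Lemma continuous_sum_seq (I : Type) (s : seq I) (h : I -> R -> R) (x : R) :
  (forall i, {for x, continuous (h i)}) ->
  {for x, continuous (fun y => \sum_(i <- s) h i y)}.
Proof.
move=> hc; elim: s => [|i s IH].
  rewrite (_ : (fun y => _) = cst 0); first exact: cst_continuous.
  by apply/funext => y; rewrite big_nil.
rewrite (_ : (fun y => _) = h i + (fun y => \sum_(i <- s) h i y)).
  by apply: continuousD => //; exact: hc.
by apply/funext => y; rewrite big_cons.
Qed.

Lemma is_derive_continuous (f : R -> R) (x df : R) :
  is_derive x 1 f df -> {for x, continuous f}.
Proof. by move=> [fd _]; exact/differentiable_continuous/derivable1_diffP. Qed.

End derivative_sums.

(** * Integration by parts on the hemisphere *)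

Section rotation.
Context (R : realType) (V : finType) (beta : V -> V -> R).
Hypothesis beta_sym : forall i j, beta i j = beta j i.
Variables (eps r : R) (a j : V) (xv zv : V -> R) (C : V -> V -> R).
Hypotheses (eps_gt0 : 0 < eps) (r_le1 : r <= 1).
Variables (f Df : V -> (V -> R) -> R).
Hypotheses (gf : good eps f) (gDf : good eps Df) (fD : own_derivative f Df).

(** These describe one line in coordinate space: all coordinates are fixed except x = x_j. The
    parameter [r] stands for 1 minus the squares of the other coordinates of spin j, so z_j = sqrt
    (r - x^2), and moving x rotates the plane of z_j and x_j. In [rot_energy], [C i k] stands for
    the constant part of the squared distances. *)
Definition rot_x x i := if i == j then x else xv i.

Definition rot_z (x : R) i := if i == j then Num.sqrt (r - x ^+ 2) else zv i.

Definition rot_energy x := 4^-1 * \sum_i \sum_k beta i k *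
  (C i k + (rot_x x i - rot_x x k) ^+ 2 + (rot_z x i - rot_z x k) ^+ 2).

(** The rotation generator is z_j d/dx and the density of du_j is 1/z_j. The two factors cancel, so
    integrating the rotated quantity against du_j amounts to integrating the plain derivative of
    [rot_field] in x. *)
Definition rot_field x := rot_x x a * f j (rot_z x) * expR (- rot_energy x).

Definition rot_field' x := expR (- rot_energy x) *
  ((a == j)%:R * f j (rot_z x) - rot_x x a * Df j (rot_z x) * (x / Num.sqrt (r - x ^+ 2)) +
   rot_x x a * f j (rot_z x) *
   \sum_i beta i j * (rot_x x i - rot_z x i * (x / Num.sqrt (r - x ^+ 2)))).

Let z (x : R) := Num.sqrt (r - x ^+ 2).
Let D x := - (x / z x).

Let z_gt0 x : x ^+ 2 < r -> 0 < z x. Proof. by move=> xr; rewrite sqrtr_gt0 subr_gt0. Qed.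

Let is_derive_z (x : R) : x ^+ 2 < r -> is_derive x 1 z (D x).
Proof.
move=> xr; have r0 : 0 < r - x ^+ 2 by rewrite subr_gt0.
have d1 : is_derive x 1 (fun y : R => r - y ^+ 2) (- (2 * x)).
  apply: is_derive_eq; rewrite /GRing.scale/=; ring.
have := @is_derive1_comp R Num.sqrt (fun y : R => r - y ^+ 2) x _ _ (is_derive1_sqrt r0) d1.
rewrite (_ : _ * _ = D x)// /D /z; have := z_gt0 xr; rewrite /z => zp.
by field; rewrite gt_eqF.
Qed.

Let is_derive_rot_x (x : R) i : is_derive x (1 : R) (rot_x ^~ i) (i == j)%:R.
Proof.
rewrite /rot_x; case: eqP => _; first exact: is_derive_id.
exact: is_derive_cst.
Qed.

Let is_derive_rot_z (x : R) i : x ^+ 2 < r -> is_derive x (1 : R) (rot_z ^~ i) ((i == j)%:R * D x).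
Proof.
move=> xr; rewrite /rot_z; case: eqP => _; first by rewrite mul1r; exact: is_derive_z.
by rewrite mul0r; exact: is_derive_cst.
Qed.

Let dH x := - \sum_i beta i j * (rot_x x i - rot_z x i * (x / z x)).

Let is_derive_rot_energy (x : R) : x ^+ 2 < r -> is_derive x (1 : R) rot_energy (dH x).
Proof.
move=> xr; have zp := z_gt0 xr.
pose q i k := (rot_x x i - rot_x x k) + (rot_z x i - rot_z x k) * D x.
have dsq i k : is_derive x 1 (fun y => beta i k * (C i k +
    (rot_x y i - rot_x y k) ^+ 2 + (rot_z y i - rot_z y k) ^+ 2))
    (beta i k * (2 * (((i == j)%:R - (k == j)%:R) * q i k))).
  have dx1 := is_derive_rot_x x i; have dx2 := is_derive_rot_x x k.
  have dz1 := is_derive_rot_z i xr; have dz2 := is_derive_rot_z k xr.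
  apply: is_derive_eq; rewrite /GRing.scale/= /q.
  by ring.
have := @is_derive_sum_seq R V (index_enum V) _ _ x (fun i =>
  @is_derive_sum_seq R V (index_enum V) _ _ x (dsq i)).
move=> /(is_deriveZ 4^-1) H; apply: is_derive_eq H _.
rewrite /GRing.scale/=.
have sumj (A : V -> R) : \sum_i (i == j)%:R * A i = A j.
  rewrite (bigD1 j)//= eqxx mul1r big1 ?addr0// => i /negbTE ->.
  by rewrite mul0r.
(* One factor 2 comes from the square, the other from merging row j and column j by symmetry of
   [beta]; together they cancel the 4^-1 of the energy. *)
have S1 : \sum_i \sum_k beta i k * (2 * (((i == j)%:R - (k == j)%:R) * q i k)) =
    4 * \sum_i beta i j * q j i.
  transitivity (\sum_i ((i == j)%:R * (2 * \sum_k beta i k * q i k) -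
      2 * \sum_k (k == j)%:R * (beta i k * q i k))).
    apply: eq_bigr => i _; rewrite !mulr_sumr -sumrB.
    by apply: eq_bigr => k _; ring.
  rewrite sumrB (sumj (fun i => 2 * \sum_k beta i k * q i k)).
  rewrite [X in _ - X](eq_bigr (fun i => 2 * (beta i j * q i j))); last first.
    by move=> i _; rewrite (sumj (fun k => beta i k * q i k)).
  rewrite -mulr_sumr [X in _ - 2 * X](_ : _ = - \sum_k beta j k * q j k).
    rewrite [in RHS](eq_bigr (fun i => beta j i * q j i)); last first.
      by move=> i _; rewrite beta_sym.
    by ring.
  by rewrite -sumrN; apply: eq_bigr => i _; rewrite beta_sym /q; ring.
rewrite S1 mulKf ?pnatr_eq0// /dH -sumrN; apply: eq_bigr => i _.
rewrite /q /rot_x /rot_z /D eqxx -/(z x).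
by field; rewrite gt_eqF.
Qed.

Let rot_zE x : rot_z x = upd zv j (z x).
Proof. by apply/funext => i; rewrite /rot_z /upd /z. Qed.

Let is_derive_f (x : R) : x ^+ 2 < r ->
  is_derive x 1 (fun y => f j (rot_z y)) (Df j (rot_z x) * D x).
Proof.
move=> xr; have zp := z_gt0 xr.
have z2 : z x < 2.
  rewrite /z (@le_lt_trans _ _ 1) ?ltr1n// -sqrtr1 ler_wsqrtr//.
  by rewrite lerBlDr (le_trans r_le1)// lerDl sqr_ge0.
have updj : upd zv j (z x) j = z x by rewrite /upd eqxx.
have := @fD j (upd zv j (z x)); rewrite updj zp z2 => /(_ isT) dfz.
have {}dfz : is_derive (z x) (1 : R) (fun y : R => f j (upd zv j y)) (Df j (upd zv j (z x))).
  by move: dfz; congr is_derive; apply/funext => y; rewrite upd_upd.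
have := @is_derive1_comp R _ z x _ _ dfz (is_derive_z xr).
by rewrite rot_zE; congr is_derive; apply/funext => y; rewrite rot_zE.
Qed.

Lemma is_derive_rot_field (x : R) : x ^+ 2 < r -> is_derive x 1 rot_field (rot_field' x).
Proof.
move=> xr; have d1 := is_derive_f xr; have d2 := is_derive_rot_energy xr.
have d3 := is_derive_rot_x x a.
have d4 : is_derive x 1 (fun y => expR (- rot_energy y)) (expR (- rot_energy x) * - dH x).
  have d5 : is_derive x 1 (fun y => - rot_energy y) (- dH x) by exact: is_deriveN.
  exact: (@is_derive1_comp R expR _ x _ _ (is_derive_expR _) d5).
rewrite /rot_field; apply: is_derive_eq.
rewrite /GRing.scale/= /rot_field' /dH /D -/(z x); ring.
Qed.

Lemma continuous_rot_field' (x : R) : x ^+ 2 < r -> {for x, continuous rot_field'}.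
Proof.
move=> xr; have zp := z_gt0 xr.
have cz : {for x, continuous z} := is_derive_continuous (is_derive_z xr).
have cxz : {for x, continuous (fun y : R => y / z y)}.
  by apply: continuousM; [exact: cvg_id|apply: continuousV => //; rewrite gt_eqF].
have cx i : {for x, continuous (rot_x ^~ i)} := is_derive_continuous (is_derive_rot_x x i).
have cZ i : {for x, continuous (rot_z ^~ i)} := is_derive_continuous (is_derive_rot_z i xr).
have cE : {for x, continuous (fun y => expR (- rot_energy y))}.
  apply: continuous_comp; last exact: continuous_expR.
  by apply: continuousN; exact: (is_derive_continuous (is_derive_rot_energy xr)).
have cf : {for x, continuous (fun y => f j (rot_z y))} := is_derive_continuous (is_derive_f xr).
have cDf : {for x, continuous (fun y => Df j (rot_z y))}.
  rewrite (_ : (fun y => _) = (fun s => Df j (upd zv j s)) \o z); last first.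
    by apply/funext => y; rewrite rot_zE.
  by apply: continuous_comp => //; exact: (@good_continuous _ _ _ _ j zv gDf (z x)).
rewrite /rot_field'; apply: continuousM => //.
apply: continuousD.
  apply: continuousB; first by apply: continuousM => //; exact: cvg_cst.
  by apply: continuousM => //; apply: continuousM.
apply: continuousM; first exact: continuousM.
apply: continuous_sum_seq => i; apply: continuousM; first exact: cvg_cst.
by apply: continuousB => //; exact: continuousM.
Qed.

Lemma rot_field_vanish x : Num.sqrt (r - x ^+ 2) <= eps ->
  f j (rot_z x) = 0 /\ Df j (rot_z x) = 0.
Proof.
case: gf gDf => _ _ fv [_ _ Dfv] ze.
by split; [apply: (fv _ _ j)|apply: (Dfv _ _ j)]; rewrite /rot_z eqxx.
Qed.

Let G (x : measurableTypeR R) : R := if (x : R) ^+ 2 < r then rot_field' x else 0.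

(** Where z_j <= eps the field is 0, so the integral is carried by [-rho, rho], with [rho] the
    abscissa at which z_j = eps / 2. There z_j is bounded away from 0, the fundamental theorem
    applies, and [rot_field] vanishes at both ends. If r <= (eps / 2)^2 the whole line lies in the
    vanishing zone. *)
Let integrable_G : lebesgue_measure.-integrable setT (EFin \o G) /\
  (\int[lebesgue_measure]_x (EFin \o G) x = 0)%E.
Proof.
have GE (x : R) : G x = if x ^+ 2 < r then rot_field' x else 0 by [].
have e2 : 0 < eps / 2 by rewrite divr_gt0.
have van x : Num.sqrt (r - x ^+ 2) <= eps -> G x = 0.
  move=> /rot_field_vanish[f0 Df0]; rewrite GE; case: ifP => // _.
  by rewrite /rot_field' f0 Df0; ring.
have sle x : r - x ^+ 2 <= (eps / 2) ^+ 2 -> Num.sqrt (r - x ^+ 2) <= eps.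
  move=> h; apply: (@le_trans _ _ (eps / 2)); last by lra.
  by rewrite -[leRHS](ger0_norm (ltW e2)) -sqrtr_sqr ler_wsqrtr.
have [re|re] := leP r ((eps / 2) ^+ 2).
  have G0 x : G x = 0.
    by apply: van; apply: sle; rewrite lerBlDr (le_trans re)// lerDl sqr_ge0.
  have -> : EFin \o G = cst 0%E by apply/funext => x /=; rewrite G0.
  by split; [exact: integrable0|rewrite integral0].
pose rho := Num.sqrt (r - (eps / 2) ^+ 2).
have rho0 : 0 < rho by rewrite sqrtr_gt0 subr_gt0.
have rho2 : rho ^+ 2 = r - (eps / 2) ^+ 2 by rewrite sqr_sqrtr// subr_ge0 ltW.
have inside x : - rho <= x <= rho -> x ^+ 2 < r.
  rewrite -ler_norml => xr; rewrite -real_normK ?num_real//.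
  apply: (@le_lt_trans _ _ (rho ^+ 2)); first by rewrite lerXn2r ?nnegrE// ltW.
  by rewrite rho2 ltrBlDr ltrDl exprn_gt0.
have outside x : ~~ (- rho <= x <= rho) -> G x = 0.
  rewrite -ler_norml -ltNge => xr; apply: van; apply: sle.
  rewrite lerBlDr -lerBlDl -rho2 -[leRHS]real_normK ?num_real//.
  by rewrite lerXn2r ?nnegrE ?(ltW rho0)// ltW.
have GrE : {in `[- rho, rho], G =1 rot_field'}.
  by move=> x; rewrite in_itv/= => xr; rewrite GE inside.
have cG : {within `[- rho, rho], continuous rot_field'}.
  apply: continuous_in_subspaceT => x; rewrite inE/= in_itv/= => xr.
  exact: continuous_rot_field' (inside _ xr).
have iG : lebesgue_measure.-integrable `[- rho, rho] (EFin \o rot_field').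
  by apply: continuous_compact_integrable => //; exact: segment_compact.
have I0 : (\int[lebesgue_measure]_(x in `[(- rho)%R, rho]) (rot_field' x)%:E = 0)%E.
  have rr : - rho < rho by rewrite gtrN.
  rewrite (@continuous_FTC2 _ _ rot_field _ _ rr)//.
  - rewrite /rot_field.
    have end0 x : x ^+ 2 = rho ^+ 2 -> f j (rot_z x) = 0.
      by move=> xr; apply: (rot_field_vanish _).1; apply: sle; rewrite xr rho2; lra.
    by rewrite !end0 ?sqrrN// !mulr0 !mul0r subee.
  - split.
    + move=> x; rewrite in_itv/= => /andP[x1 x2].
      by have [] := is_derive_rot_field (inside x (introT andP (conj (ltW x1) (ltW x2)))).
    + apply: cvg_at_right_filter; apply: is_derive_continuous.
      by apply: is_derive_rot_field; apply: inside; rewrite lexx ltW.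
    + apply: cvg_at_left_filter; apply: is_derive_continuous.
      by apply: is_derive_rot_field; apply: inside; rewrite lexx ltW.
  - move=> x; rewrite in_itv/= => /andP[x1 x2]; rewrite derive1E.
    by have [] := is_derive_rot_field (inside x (introT andP (conj (ltW x1) (ltW x2)))).
have GE' : EFin \o G = (EFin \o rot_field') \_ `[- rho, rho].
  apply/funext => x; rewrite /patch /=; case: ifPn; first by rewrite inE/= => /GrE ->.
  by rewrite notin_setE/= => /negP; rewrite in_itv/= => /outside ->.
have iGT : lebesgue_measure.-integrable setT (EFin \o G).
  by rewrite GE'; apply/(integrable_mkcond _ _).1.
by split => //; rewrite GE' -integral_mkcond.
Qed.

(** A zero integral is stated as equality of positive and negative parts, the form in which
    [eq_integral_tuple_measure] carries it from lines to the full space. *)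
Lemma integral_rot_field' (c : R) (h : measurableTypeR R -> R) :
  (forall x : R, h x = if x ^+ 2 < r then c * rot_field' x else 0) ->
  (\int[lebesgue_measure]_x (EFin \o h)^\+ x =
   \int[lebesgue_measure]_x (EFin \o h)^\- x)%E.
Proof.
move=> hE; have [iG G0] := integrable_G.
have hE' : EFin \o h = (fun x => c%:E * (EFin \o G) x)%E.
  by apply/funext => x; rewrite /= hE /G; case: ifP => // _; rewrite mule0.
have ih : lebesgue_measure.-integrable setT (EFin \o h).
  by rewrite hE'; exact: integrableZl.
have : (\int[lebesgue_measure]_x (EFin \o h) x = 0)%E by rewrite hE' integralZl// G0 mule0.
rewrite integralE => /eqP; rewrite sube_eq ?add0e; last 2 first.
- exact: integrable_pos_fin_num.
- by rewrite fin_num_adde_defl// integrable_neg_fin_num.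
by move=> /eqP.
Qed.

End rotation.

(** * Spin coordinates on a product of unit balls *)

Section coordinates.
Context (R : realType) (V : finType) (n : nat).
Implicit Types (U : coords R V n.+1) (y : n.+1.-tuple R).

Definition spin_z U : V -> R := fun i => zc (spins U i).

Definition spin_x U : V -> R := fun i => xc (spins U i).

Lemma spin_xE U i : spin_x U i = tnth (family_of U i) ord0.
Proof. by rewrite /spin_x /xc (tnth_nth 0). Qed.

Lemma spin_zE U i : spin_z U i = Num.sqrt (1 - dot (family_of U i) (family_of U i)).
Proof. by []. Qed.

Lemma dot_ge0 m (y : m.-tuple R) : 0 <= dot y y.
Proof. by apply: sumr_ge0 => k _; rewrite -expr2 sqr_ge0. Qed.

Lemma spin_z_itv U i : 0 <= spin_z U i <= 1.
Proof.
rewrite spin_zE sqrtr_ge0/= -[leRHS]sqrtr1 ler_wsqrtr//.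
by rewrite lerBlDr lerDl dot_ge0.
Qed.

Lemma spin_z_gt0 U i : coords_domain U -> 0 < spin_z U i.
Proof. by move=> dU; rewrite spin_zE sqrtr_gt0 subr_gt0; exact: dU. Qed.

Lemma spin_x_le1 U i : coords_domain U -> `|spin_x U i| <= 1.
Proof.
move=> dU; rewrite spin_xE -(expr_le1 (n := 2))// real_normK ?num_real//.
apply: le_trans (ltW (dU i)); rewrite /dot (bigD1 ord0)//= -expr2 lerDl.
by apply: sumr_ge0 => k _; rewrite -expr2 sqr_ge0.
Qed.

Lemma spin_z_cube U : coords_domain U -> half_open_cube (spin_z U).
Proof. by move=> dU j; rewrite spin_z_gt0//=; have /andP[] := spin_z_itv U j. Qed.

Lemma measurable_family i :
  measurable_fun [set: coords R V n.+1] (fun U => family_of U i).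
Proof. exact: measurable_tnth. Qed.

Lemma measurable_coord i k :
  measurable_fun [set: coords R V n.+1] (fun U => tnth (family_of U i) k : R).
Proof.
apply: (@measurableT_comp _ _ _ _ _ _ (fun y : n.+1.-tuple (measurableTypeR R) =>
  tnth y k)); last exact: measurable_family.
exact: measurable_tnth.
Qed.

Lemma measurable_spin_dot i : measurable_fun [set: coords R V n.+1]
  (fun U => dot (family_of U i) (family_of U i) : R).
Proof. by apply: measurable_sum => k; apply: measurable_funM; exact: measurable_coord. Qed.

Lemma measurable_spin_x i :
  measurable_fun [set: coords R V n.+1] (fun U => spin_x U i : R).
Proof. by under eq_fun do rewrite spin_xE; exact: measurable_coord. Qed.

Lemma measurable_spin_z i :
  measurable_fun [set: coords R V n.+1] (fun U => spin_z U i : R).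
Proof.
apply: (@measurableT_comp _ _ _ _ _ _ (@Num.sqrt R)).
  by apply: continuous_measurable_fun; exact: sqrt_continuous.
by apply: measurable_funB; [exact: measurable_cst|exact: measurable_spin_dot].
Qed.

Lemma measurable_coords_domain : measurable (@coords_domain R V n.+1).
Proof.
rewrite (_ : @coords_domain R V n.+1 = \bigcap_(i in [set: V])
    ((fun U : coords R V n.+1 => dot (family_of U i) (family_of U i)) @^-1` [set` `]-oo, 1[])).
  apply: fin_bigcap_measurable => // i _; rewrite -[X in measurable X]setTI.
  by apply: measurable_spin_dot.
apply/seteqP; split => U h i; first by move=> _; have := h i; rewrite /= in_itv.
by have := h i Logic.I; rewrite /= in_itv.
Qed.

Lemma coords_domain_fin : (coords_volume R V n.+1 (@coords_domain R V n.+1) < +oo)%E.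
Proof.
pose I1 : set (measurableTypeR R) := [set` `[-1, 1]].
have mI1 : measurable I1 by exact: measurable_itv.
have [mB Bfin] := @tuple_measure_power_fin _ _ R (@lebesgue_measure R) n.+1 I1 mI1
  (lebesgue_measure_itvcc_fin _ _).
have [mC Cfin] := @tuple_measure_power_fin _ _ R _ #|V| _ mB Bfin.
apply: le_lt_trans Cfin; apply: le_measure; rewrite ?inE//.
  exact: measurable_coords_domain.
move=> U dU i k; rewrite /I1 /= in_itv/= -ler_norml.
rewrite -(expr_le1 (n := 2))// real_normK ?num_real//.
have := dU (enum_val i); rewrite /unit_ball /= /family_of enum_valK => /ltW.
apply: le_trans; rewrite /dot (bigD1 k)//= -expr2 lerDl.
by apply: sumr_ge0 => m _; rewrite -expr2 sqr_ge0.
Qed.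

Lemma sqdist_chart (y y' : n.+1.-tuple R) : sqdist (chart y) (chart y') =
  \sum_(m < n) (tnth y (lift ord0 m) - tnth y' (lift ord0 m)) ^+ 2 +
  (tnth y ord0 - tnth y' ord0) ^+ 2 + (zc (chart y) - zc (chart y')) ^+ 2.
Proof.
rewrite /sqdist big_ord_recl big_ord_recl addrC !tnthS !tnth0 [X in X + _]addrC.
by congr (_ + _ + _); apply: eq_bigr => m _; rewrite !tnthS.
Qed.

Lemma dot_upd y x : dot (upd_tnth y ord0 x) (upd_tnth y ord0 x) =
  x ^+ 2 + \sum_(m < n) tnth y (lift ord0 m) ^+ 2.
Proof.
rewrite /dot big_ord_recl tnth_upd eqxx -expr2; congr (_ + _).
by apply: eq_bigr => m _; rewrite tnth_upd -expr2.
Qed.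

Lemma family_upd U j (y : n.+1.-tuple R) i :
  family_of (upd_tnth U (enum_rank j) y) i = if i == j then y else family_of U i.
Proof. by rewrite /family_of tnth_upd (inj_eq enum_rank_inj). Qed.

End coordinates.

(** * The spin expectation and its integration by parts *)

Section integration_by_parts.
Context (R : realType) (V : finType) (beta : V -> V -> R) (n : nat).
Hypothesis beta_sym : forall i j, beta i j = beta j i.
Hypothesis beta_ge0 : forall i j, 0 <= beta i j.
Implicit Types (U : coords R V n.+1).

Lemma energy_ge0 U : 0 <= energy beta (spins U).
Proof.
rewrite mulr_ge0// sumr_ge0// => i _; rewrite sumr_ge0// => k _.
by rewrite mulr_ge0// sumr_ge0// => m _; rewrite sqr_ge0.
Qed.

Lemma measurable_energy : measurable_fun [set: coords R V n.+1]
  (fun U => energy beta (spins U) : R).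
Proof.
apply: measurable_funM; first exact: measurable_cst.
apply: measurable_sum => i; apply: measurable_sum => k.
apply: measurable_funM; first exact: measurable_cst.
under eq_fun do rewrite sqdist_chart.
apply: measurable_funD; last first.
  by apply: measurable_funX; apply: measurable_funB; exact: measurable_spin_z.
apply: measurable_funD; last first.
  by apply: measurable_funX; apply: measurable_funB; exact: measurable_coord.
by apply: measurable_sum => m; apply: measurable_funX; apply: measurable_funB;
  exact: measurable_coord.
Qed.

Lemma measurable_spin_weight : measurable_fun [set: coords R V n.+1]
  (fun U => spin_weight beta U : R).
Proof.
apply: measurable_funM.
  apply: measurableT_comp; first exact: measurable_expR.
  by apply: measurable_funN; exact: measurable_energy.
apply: measurable_prod => i _.
rewrite (_ : (fun U => _) = (fun U => powR (spin_z U i) (- 1))); last first.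
  by apply/funext => U; rewrite powR_inv1//; have /andP[] := spin_z_itv U i.
apply: (@measurableT_comp _ _ _ _ _ _ (fun x : R => powR x (- 1))).
  exact: measurable_powR.
exact: measurable_spin_z.
Qed.

Lemma spin_weight_bound eps U : 0 < eps -> (forall i, eps < spin_z U i) ->
  `|spin_weight beta U| <= eps^-1 ^+ #|V|.
Proof.
move=> e0 ez; have z0 i : 0 <= (zc (spins U i))^-1.
  by rewrite invr_ge0; have /andP[] := spin_z_itv U i.
rewrite /spin_weight normrM (ger0_norm (expR_ge0 _)) ger0_norm; last exact: prodr_ge0.
rewrite -[leRHS]mul1r ler_pM ?expR_ge0 ?prodr_ge0//.
  by rewrite -expR0 ler_expR oppr_le0 energy_ge0.
rewrite -[#|V|]/(#|[pred _ : V | true]|) -prodr_const; apply: ler_prod => i _.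
by rewrite z0 lef_pV2 ?posrE// ?ltW//; [exact: ez|exact: lt_trans (ez i)].
Qed.

(* Vanishing near z = 0 compensates the density [spin_weight], which blows up there. *)
Record localized (eps : R) (Psi : coords R V n.+1 -> R) : Prop := {
  localized_measurable : measurable_fun (@coords_domain R V n.+1) Psi ;
  localized_bounded : exists2 K, 0 <= K &
    forall U, coords_domain U -> `|Psi U| <= K ;
  localized_vanish : forall U i, coords_domain U -> spin_z U i <= eps -> Psi U = 0 }.

Lemma localizedD eps Psi Phi : localized eps Psi -> localized eps Phi ->
  localized eps (fun U => Psi U + Phi U).
Proof.
move=> [m1 [K1 K10 b1] v1] [m2 [K2 K20 b2] v2]; split.
- exact: measurable_funD.
- exists (K1 + K2); rewrite ?addr_ge0// => U dU.
  by apply: le_trans (ler_normD _ _) _; rewrite lerD ?b1 ?b2.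
- by move=> U i dU zi; rewrite (v1 _ i)// (v2 _ i)// addr0.
Qed.

Lemma localized_mul eps Psi (h : coords R V n.+1 -> R) (C : R) : localized eps Psi ->
  measurable_fun (@coords_domain R V n.+1) h -> 0 <= C ->
  (forall U, coords_domain U -> `|h U| <= C) ->
  localized eps (fun U => h U * Psi U).
Proof.
move=> [m1 [K1 K10 b1] v1] mh C0 hC; split.
- exact: measurable_funM.
- by exists (C * K1); rewrite ?mulr_ge0// => U dU; rewrite normrM ler_pM ?b1 ?hC.
- by move=> U i dU zi; rewrite (v1 _ i)// mulr0.
Qed.

Lemma localizedZ eps Psi k : localized eps Psi -> localized eps (fun U => k * Psi U).
Proof. by move=> h; apply: (@localized_mul _ _ _ `|k|). Qed.

Lemma localized_x eps Psi i : localized eps Psi -> localized eps (fun U => spin_x U i * Psi U).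
Proof.
move=> h; apply: (@localized_mul _ _ _ 1) => //.
  by apply: measurable_funTS; exact: measurable_spin_x.
by move=> U dU; exact: spin_x_le1.
Qed.

Lemma localized_z eps Psi i : localized eps Psi -> localized eps (fun U => spin_z U i * Psi U).
Proof.
move=> h; apply: (@localized_mul _ _ _ 1) => //.
  by apply: measurable_funTS; exact: measurable_spin_z.
by move=> U _; have /andP[z0 z1] := spin_z_itv U i; rewrite ger0_norm.
Qed.

Lemma localized_sum eps (I : Type) (s : seq I) (Psi : I -> coords R V n.+1 -> R) :
  (forall i, localized eps (Psi i)) -> localized eps (fun U => \sum_(i <- s) Psi i U).
Proof.
move=> h; elim: s => [|i s IH].
  rewrite (_ : (fun U => _) = cst 0); last by apply/funext => U; rewrite big_nil.
  by split => //; exists 0 => // U _; rewrite normr0.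
rewrite (_ : (fun U => _) = (fun U => Psi i U + \sum_(k <- s) Psi k U)).
  exact: localizedD.
by apply/funext => U; rewrite big_cons.
Qed.

Lemma localized_good eps F i : good eps F -> localized eps (fun U => F i (spin_z U)).
Proof.
move=> gF; split.
- apply: measurable_funTS; apply: (measurable_good_comp _ gF) => j.
  exact: measurable_spin_z.
- by have [[K K0 FK] _ _] := gF; exists K.
- by move=> U k _ zk; have [_ _ Fv] := gF; rewrite (Fv _ _ k).
Qed.

Let weight_bound eps K Psi : 0 < eps -> 0 <= K -> localized eps Psi ->
  (forall U, coords_domain U -> `|Psi U| <= K) ->
  forall U, coords_domain U -> `|Psi U * spin_weight beta U| <= K * eps^-1 ^+ #|V|.
Proof.
move=> eps0 K0 [_ _ Psi0] PsiK U dU.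
have eV : 0 <= eps^-1 ^+ #|V| by rewrite exprn_ge0// invr_ge0 ltW.
have [ez|/existsNP[i /negP]] := pselect (forall i, eps < spin_z U i).
  by rewrite normrM ler_pM// ?PsiK// spin_weight_bound.
by rewrite -leNgt => /Psi0 ->//; rewrite mul0r normr0 mulr_ge0.
Qed.

Lemma integrable_localized eps Psi : 0 < eps -> localized eps Psi ->
  (coords_volume R V n.+1).-integrable (@coords_domain R V n.+1)
  (EFin \o (fun U => Psi U * spin_weight beta U)).
Proof.
move=> eps0 lP; have [mPsi [K K0 PsiK] _] := lP.
apply: (@bounded_integrable _ _ _ _ _ _ (K * eps^-1 ^+ #|V|)) => //.
- exact: measurable_coords_domain.
- exact: coords_domain_fin.
- by apply: measurable_funM => //; apply: measurable_funTS; exact: measurable_spin_weight.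
- exact: weight_bound.
Qed.

Definition rbracket (Psi : coords R V n.+1 -> R) : R :=
  \int[coords_volume R V n.+1]_(U in @coords_domain R V n.+1) (Psi U * spin_weight beta U).

Lemma norm_rbracket_le eps K Psi : 0 < eps -> 0 <= K -> localized eps Psi ->
  (forall U, coords_domain U -> `|Psi U| <= K) ->
  `|rbracket Psi| <= K * eps^-1 ^+ #|V| * fine (coords_volume R V n.+1 (@coords_domain R V n.+1)).
Proof.
move=> eps0 K0 lP PsiK; have mD := @measurable_coords_domain R V n.
apply: le_trans (le_normr_Rintegral mD (integrable_localized eps0 lP)) _.
rewrite -Rintegral_cst//; apply: le_Rintegral => //.
- by apply: integrable_norm; exact: integrable_localized lP.
- apply: (@bounded_integrable _ _ _ _ _ _ (`|K * eps^-1 ^+ #|V| |)) => //.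
  exact: coords_domain_fin.
- exact: weight_bound.
Qed.

Lemma rbracketB eps Psi Phi : 0 < eps -> localized eps Psi -> localized eps Phi ->
  rbracket (fun U => Psi U - Phi U) = rbracket Psi - rbracket Phi.
Proof.
move=> eps0 l1 l2; rewrite /rbracket -RintegralB//.
- by apply: eq_Rintegral => U _; rewrite mulrBl.
- exact: measurable_coords_domain.
- exact: integrable_localized l1.
- exact: integrable_localized l2.
Qed.

Lemma rbracket_sum eps (I : Type) (s : seq I) (Psi : I -> coords R V n.+1 -> R) :
  0 < eps -> (forall i, localized eps (Psi i)) ->
  rbracket (fun U => \sum_(i <- s) Psi i U) = \sum_(i <- s) rbracket (Psi i).
Proof.
move=> eps0 lP; rewrite /rbracket -Rintegral_sum.
- by apply: eq_Rintegral => U _; rewrite mulr_suml.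
- exact: measurable_coords_domain.
- by move=> i; exact: integrable_localized (lP i).
Qed.

Lemma eq_rbracket Psi Phi : (forall U, coords_domain U -> Psi U = Phi U) ->
  rbracket Psi = rbracket Phi.
Proof. by move=> h; apply: eq_Rintegral => U /[!inE] dU; rewrite h. Qed.

Section ibp.
Variables (eps : R) (f Df : V -> (V -> R) -> R) (a j : V).
Hypotheses (eps0 : 0 < eps) (gf : good eps f) (gDf : good eps Df).
Hypothesis fD : own_derivative f Df.

(** This is z_j d/dx_j applied to x_a f(j, z) e^{-H}, divided by e^{-H}. *)
Definition ibp_form U : R :=
  (a == j)%:R * (spin_z U j * f j (spin_z U)) - spin_x U a * spin_x U j * Df j (spin_z U) +
  spin_x U a * f j (spin_z U) *
    \sum_i beta i j * (spin_x U i * spin_z U j - spin_z U i * spin_x U j).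

Let g U : R := if `[< coords_domain U >] then ibp_form U * spin_weight beta U else 0.

(** Along the line that varies the first coordinate of spin j, the factor z_j of [ibp_form] cancels
    the density of du_j, and [g] becomes a constant times the derivative of [rot_field], extended by
    0. *)
Lemma ibp_slice U (y : n.+1.-tuple R) :
  (\int[@lebesgue_measure R]_x
    (EFin \o g)^\+ (upd_tnth U (enum_rank j) (upd_tnth y ord0 x)) =
   \int[@lebesgue_measure R]_x
    (EFin \o g)^\- (upd_tnth U (enum_rank j) (upd_tnth y ord0 x)))%E.
Proof.
pose Ux x := upd_tnth U (enum_rank j) (upd_tnth y ord0 x) : coords R V n.+1.
pose r : R := 1 - \sum_(m < n) tnth y (lift ord0 m) ^+ 2.
have r1 : r <= 1 by rewrite lerBlDr lerDl sumr_ge0// => m _; rewrite sqr_ge0.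
pose Y i := if i == j then y else family_of U i.
pose xv i : R := tnth (family_of U i) ord0.
pose zv i : R := zc (chart (family_of U i)).
pose C i k := \sum_(m < n) (tnth (Y i) (lift ord0 m) - tnth (Y k) (lift ord0 m)) ^+ 2.
(* The line meets the domain only if all other spins lie in their balls; [c] then collects their
   densities, and it is 0 otherwise. *)
pose others := `[< forall i, i != j -> unit_ball (family_of U i) >].
pose c := others%:R * \prod_(i | i != j) (zv i)^-1.
have famE x i : family_of (Ux x) i = if i == j then upd_tnth y ord0 x else family_of U i.
  exact: family_upd.
have dotE x : 1 - dot (upd_tnth y ord0 x) (upd_tnth y ord0 x) = r - x ^+ 2.
  by rewrite dot_upd /r; ring.
have zE x i : spin_z (Ux x) i = rot_z r j zv x i.
  rewrite spin_zE famE /rot_z; case: eqP => // _; congr Num.sqrt.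
  exact: dotE.
have xE x i : spin_x (Ux x) i = rot_x j xv x i.
  by rewrite spin_xE famE /rot_x; case: eqP => // _; rewrite tnth_upd eqxx.
have domE x : `[< coords_domain (Ux x) >] = others && (x ^+ 2 < r).
  apply/asboolP/andP => [dU|[/asboolP oU xr] i].
    split.
      by apply/asboolP => i ij; have := dU i; rewrite famE (negbTE ij).
    by have := dU j; rewrite famE eqxx /unit_ball /= -subr_gt0 dotE subr_gt0.
  rewrite famE; case: eqVneq => [_|]; last exact: oU.
  by rewrite /unit_ball /= -subr_gt0 dotE subr_gt0.
have eE x : energy beta (spins (Ux x)) = rot_energy beta r j xv zv C x.
  congr (_ * _); apply: eq_bigr => i _; apply: eq_bigr => k _; congr (_ * _).
  rewrite [LHS]sqdist_chart -/(spin_z (Ux x) i) -/(spin_z (Ux x) k) !zE -!spin_xE !xE.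
  congr (_ + _ + _); apply: eq_bigr => m _.
  have tE i' : tnth (family_of (Ux x) i') (lift ord0 m) = tnth (Y i') (lift ord0 m).
    by rewrite famE /Y; case: eqP => // _; rewrite tnth_upd.
  by rewrite !tE.
suff gE (x : R) : g (Ux x) =
    if x ^+ 2 < r then c * rot_field' beta r a j xv zv C f Df x else 0.
  have h := @integral_rot_field' R V beta beta_sym eps r a j xv zv C eps0 r1 f Df gf gDf fD c
    (fun x => g (Ux x)) gE.
  transitivity (\int[@lebesgue_measure R]_x (EFin \o (fun x => g (Ux x)))^\+ x)%E.
    by apply: eq_integral => x _; rewrite !funeposE.
  by rewrite h; apply: eq_integral => x _; rewrite !funenegE.
rewrite /g domE; case: ifPn => [/andP[oU xr]|]; last first.
  rewrite negb_and => /orP[oU|/negbTE -> //].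
  by rewrite /c (negbTE oU) !mul0r; case: ifP.
rewrite xr /c oU mul1r.
have zp : 0 < Num.sqrt (r - x ^+ 2) by rewrite sqrtr_gt0 subr_gt0.
have zfE : spin_z (Ux x) = rot_z r j zv x by apply/funext => i; exact: zE.
have xfE : spin_x (Ux x) = rot_x j xv x by apply/funext => i; exact: xE.
have zjE : rot_z r j zv x j = Num.sqrt (r - x ^+ 2) by rewrite /rot_z eqxx.
have xjE : rot_x j xv x j = x by rewrite /rot_x eqxx.
rewrite /ibp_form /spin_weight eE zfE xfE /rot_field'.
rewrite [\prod_i (zc (spins (Ux x) i))^-1](bigD1 j)//= -/(spin_z (Ux x) j) zE.
rewrite !zjE xjE.
rewrite [\prod_(i | i != j) (zc (spins (Ux x) i))^-1](eq_bigr (fun i => (zv i)^-1)); last first.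
  by move=> i /negbTE ij; rewrite -/(spin_z (Ux x) i) zE /rot_z ij.
set S1 := \sum_i _; set S2 := \sum_i _; set Q := \prod_(i | _) _.
have -> : S1 = Num.sqrt (r - x ^+ 2) * S2.
  rewrite /S1 /S2 mulr_sumr; apply: eq_bigr => i _.
  by field; rewrite gt_eqF.
by field; rewrite gt_eqF.
Qed.

Lemma localized_ibp_form : localized eps ibp_form.
Proof.
have lf := localized_good j gf; have lDf := localized_good j gDf.
have -> : ibp_form = (fun U =>
    ((a == j)%:R * (spin_z U j * f j (spin_z U)) +
    (- 1) * (spin_x U a * (spin_x U j * Df j (spin_z U)))) +
    \sum_i beta i j * (spin_x U a * (spin_x U i * (spin_z U j * f j (spin_z U))) +
      (- 1) * (spin_x U a * (spin_x U j * (spin_z U i * f j (spin_z U)))))).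
  apply/funext => U; rewrite /ibp_form; congr (_ + _); first by ring.
  by rewrite mulr_sumr; apply: eq_bigr => i _; ring.
apply: localizedD.
  by apply: localizedD; apply: localizedZ;
    [exact: localized_z|apply: localized_x; exact: localized_x].
apply: localized_sum => i; apply: localizedZ; apply: localizedD.
  by do 2 apply: localized_x; exact: localized_z.
by apply: localizedZ; do 2 apply: localized_x; exact: localized_z.
Qed.

Lemma rbracket_ibp_form : rbracket ibp_form = 0.
Proof.
have mD := @measurable_coords_domain R V n.
have gE : EFin \o g = (EFin \o (fun U => ibp_form U * spin_weight beta U)) \_
    (@coords_domain R V n.+1).
  apply/funext => U; rewrite /patch /g /=; case: asboolP => dU.
    by rewrite mem_set.
  by rewrite memNset.
have ig : (coords_volume R V n.+1).-integrable setT (EFin \o g).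
  rewrite gE; apply/(integrable_mkcond _ mD).1.
  exact: integrable_localized eps0 localized_ibp_form.
have mg := measurable_int _ ig.
have mpos := measurable_funepos mg; have mneg := measurable_funeneg mg.
have slice : (\int[coords_volume R V n.+1]_U (EFin \o g)^\+ U =
    \int[coords_volume R V n.+1]_U (EFin \o g)^\- U)%E.
  (* The first application isolates the spin at j, the second its first ball coordinate, which is
     x_j. *)
  apply: (eq_integral_tuple_measure (j := enum_rank j)) => //.
  move=> U; apply: (eq_integral_tuple_measure (j := ord0)) => //.
  - exact: (measurableT_comp mpos (measurable_upd_tnth U (enum_rank j))).
  - exact: (measurableT_comp mneg (measurable_upd_tnth U (enum_rank j))).
  - by move=> y; exact: ibp_slice.
rewrite /rbracket /Rintegral integral_mkcond -/(EFin \o _) -gE integralE slice subee//.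
exact: integrable_neg_fin_num.
Qed.

End ibp.

(** The integrated forms are summed over j. The diagonal term gives z_a f(a, z); swapping the two
    summation indices in one half of the energy term, by symmetry of [beta], turns that term into
    the sum of x_a x_k (B f)(k, z). *)
Lemma hemisphere_identity eps f Df a : 0 < eps -> good eps f -> good eps Df ->
  own_derivative f Df ->
  rbracket (fun U => spin_z U a * f a (spin_z U)) =
  rbracket (fun U => \sum_j spin_x U a * (spin_x U j *
    (Df j (spin_z U) - jump_part beta f j (spin_z U)))).
Proof.
move=> eps0 gf gDf fD; apply/eqP; rewrite -subr_eq0.
have gh : good eps (fun i l => Df i l - jump_part beta f i l).
  by apply: good_sub => //; exact: good_jump_part.
rewrite -(@rbracketB eps)//; last 2 first.
- by apply: localized_z; exact: localized_good gf.
- apply: localized_sum => j; do 2 apply: localized_x.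
  exact: (localized_good j gh).
rewrite (_ : rbracket _ = rbracket (fun U => \sum_j ibp_form f Df a j U)).
  rewrite (@rbracket_sum eps)//; last by move=> j; exact: localized_ibp_form.
  by rewrite big1// => j _; exact: rbracket_ibp_form gf gDf fD.
apply: eq_rbracket => U dU; set z := spin_z U; set x := spin_x U.
have JE k : jump_part beta f k z = \sum_i beta k i * z i * (f i z - f k z).
  apply: eq_bigr => i _; rewrite clamp_id//.
  by have /andP[z0 z1] := spin_z_itv U i; rewrite z0 (le_trans z1)// ler1n.
have exchange : \sum_k x a * f k z * \sum_i beta i k * (x i * z k - z i * x k) =
    \sum_k x a * (x k * jump_part beta f k z).
  transitivity (\sum_k \sum_i x a * f k z * beta i k * x i * z k -
      \sum_k \sum_i x a * f k z * beta i k * z i * x k).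
    rewrite -sumrB; apply: eq_bigr => k _; rewrite mulr_sumr -sumrB.
    by apply: eq_bigr => i _; ring.
  rewrite exchange_big/= -sumrB; apply: eq_bigr => k _.
  rewrite JE !mulr_sumr -sumrB; apply: eq_bigr => i _.
  by rewrite (beta_sym i k); ring.
have delta : \sum_k (a == k)%:R * (z k * f k z) = z a * f a z.
  rewrite (bigD1 a)//= eqxx mul1r big1 ?addr0// => k /negbTE.
  by rewrite eq_sym => ->; rewrite mul0r.
rewrite /ibp_form big_split sumrB/= delta exchange -addrA; congr (_ + _).
by rewrite -!sumrN -big_split/=; apply: eq_bigr => k _; rewrite -/z -/x; ring.
Qed.

End integration_by_parts.

(** * The isomorphism for Lipschitz functions *)

Section picard_iteration.
Context (R : realType) (V : finType) (beta : V -> V -> R).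

Definition picard_step (F : V -> (V -> R) -> R) := jump_part beta (primitive F).

Lemma good_picard eps F k : 0 <= eps -> good eps F -> good eps (iter k picard_step F).
Proof.
move=> e0 gF; elim: k => // k IH; rewrite iterS.
by apply: good_jump_part; exact: good_primitive.
Qed.

(** The weighted norm shrinks by the factor 4 C / lam at each step. Each [clamp] lies in [0, 2], so
    the weight is bounded on both sides and the decay passes to the plain supremum norm. *)
Lemma picard_decay eps F : 0 <= eps -> good eps F -> exists2 K, 0 <= K &
  exists2 q, 0 <= q < 1 & forall k i l, `|iter k picard_step F i l| <= K * q ^+ k.
Proof.
move=> e0 gF; have [[K K0 FK] _ _] := gF.
pose C := \sum_i \sum_j `|beta i j|.
have C0 : 0 <= C by rewrite sumr_ge0// => i _; rewrite sumr_ge0.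
have bC i : \sum_j `|beta i j| <= C.
  by rewrite /C [leRHS](bigD1 i)//= lerDl sumr_ge0// => k _; rewrite sumr_ge0.
(* Any value above 4 C makes the ratio [q] less than 1. *)
pose lam := 4 * C + 1; have lam0 : 0 < lam by rewrite /lam ltr_wpDl// mulr_ge0.
pose q := 4 * C / lam.
have q0 : 0 <= q by rewrite /q divr_ge0 ?(ltW lam0)// mulr_ge0.
have q1 : q < 1 by rewrite /q ltr_pdivrMr// mul1r /lam ltrDl.
pose s (l : V -> R) : R := lam * \sum_j clamp (l j).
have s0 l : 0 <= s l.
  by rewrite mulr_ge0 ?(ltW lam0)// sumr_ge0// => j _; exact: clamp_ge0.
have s2 l : s l <= lam * (#|V|%:R * 2).
  rewrite ler_wpM2l ?(ltW lam0)//.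
  rewrite -[#|V|%:R]/(#|[pred _ : V | true]|%:R) mulr_natl -sumr_const.
  by apply: ler_sum => j _; exact: clamp_le2.
have step k : expdom lam (K * q ^+ k) (iter k picard_step F).
  elim: k => [i l|k IH].
    rewrite expr0 mulr1; apply: le_trans (FK i l) _.
    by rewrite ler_peMr// -expR0 ler_expR s0.
  have A0 : 0 <= K * q ^+ k by rewrite mulr_ge0// exprn_ge0.
  rewrite iterS (_ : K * q ^+ k.+1 = 4 * C * (K * q ^+ k / lam)); last first.
    by rewrite exprS /q; ring.
  apply: expdom_jump_part => //; first by rewrite divr_ge0// ltW.
  exact: (expdom_primitive lam0 A0 (good_picard k e0 gF)).
exists (K * expR (lam * (#|V|%:R * 2))); first by rewrite mulr_ge0 ?expR_ge0.
exists q; first by rewrite q0.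
move=> k i l; apply: le_trans (step k i l) _.
rewrite [leRHS]mulrAC ler_wpM2l ?mulr_ge0 ?exprn_ge0//.
by rewrite ler_expR; exact: s2.
Qed.

End picard_iteration.

Lemma le_geometric_eq0 (R : realType) (x K q : R) : 0 <= q < 1 ->
  (forall k, `|x| <= K * q ^+ k) -> x = 0.
Proof.
move=> /andP[q0 q1] h; apply/eqP; rewrite -normr_le0.
have c : K * q ^+ k @[k --> \oo] --> 0.
  rewrite -(mulr0 K); apply: cvgMr; apply: cvg_expr.
  by rewrite ger0_norm.
apply: (ler_cvg_to (cvg_cst _) c).
by near=> k; exact: h.
Unshelve. all: by end_near. Qed.

Section occupation.
Context (R : realType) (V : finType) (beta : V -> V -> R).
Hypothesis beta_ge0 : forall i j, 0 <= beta i j.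
Context d (Omega : measurableType d) (P : probability Omega R).
Context (X : R -> Omega -> V) (v : V) (ell : V -> R).
Hypothesis ell_cube : half_open_cube ell.
Hypothesis HX : is_vdjp beta v ell P X.

(* Since sum_j L_t^j decreases at unit speed while the process is alive, it is dead at
   time #|V|, and [0, #|V|] may replace [0, +oo[. *)
Definition occupation (F : V -> (V -> R) -> R) : R :=
  \int[lebesgue_measure]_(t in `[0, #|V|%:R]) state_mean P X ell F t.

Lemma integrable_state_mean eps F : good eps F ->
  lebesgue_measure.-integrable `[0, #|V|%:R] (EFin \o state_mean P X ell F).
Proof.
move=> gF; have i0 : lebesgue_measure.-integrable `[0, #|V|%:R]
    (EFin \o (fun t : R => state_mean P X ell F (Num.max t 0))).
  apply: continuous_compact_integrable; first exact: segment_compact.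
  by apply: continuous_subspaceT; exact: (continuous_state_mean HX gF).
apply: eq_integrable i0 => [|t]; first exact: measurable_itv.
by rewrite inE/= in_itv/= => /andP[t0 _]; rewrite max_l.
Qed.

Lemma norm_occupation_le eps F K : good eps F -> 0 <= K -> (forall i l, `|F i l| <= K) ->
  `|occupation F| <= K * #|V|%:R.
Proof.
move=> gF K0 FK; rewrite -[#|V|%:R](subr0) /occupation.
have -> : \int[lebesgue_measure]_(t in `[0, #|V|%:R]) state_mean P X ell F t =
    \int[lebesgue_measure]_(t in `[0, #|V|%:R]) state_mean P X ell F (Num.max t 0).
  by apply: eq_Rintegral => t /[!inE]/=; rewrite in_itv/= => /andP[t0 _]; rewrite max_l.
apply: norm_Rintegral_itv_le => //.
  apply: continuous_compact_integrable; first exact: segment_compact.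
  by apply: continuous_subspaceT; exact: (continuous_state_mean HX gF).
move=> t; have t0 : 0 <= Num.max t 0 by rewrite le_max lexx orbT.
have iF := integrable_state HX gF t0 t0.
apply: le_trans (le_normr_Rintegral _ iF) _ => //.
rewrite -[leRHS](Rintegral_probability_cst P); apply: le_Rintegral => //.
  exact: integrable_norm.
exact: (@probability_bounded_integrable _ _ _ _ _ `|K|).
Qed.

Lemma occupation_picard eps F : 0 <= eps -> good eps F ->
  occupation F = primitive F v ell + occupation (picard_step beta F).
Proof.
move=> e0 gF; have gS := good_primitive e0 gF.
have gJ : good eps (picard_step beta F) by exact: good_jump_part.
rewrite (dynkin_formula beta_ge0 ell_cube HX e0 gS gF (own_derivative_primitive gF)).
rewrite /occupation -RintegralD//; last 2 first.
- exact: (integrable_state_mean (good_sub gF gJ)).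
- exact: (integrable_state_mean gJ).
apply: eq_Rintegral => t /[!inE]/=; rewrite in_itv/= => /andP[t0 _].
rewrite /state_mean -RintegralD//; last 2 first.
- exact: (integrable_state HX (good_sub gF gJ)).
- exact: (integrable_state HX gJ).
by apply: eq_Rintegral => w _; rewrite subrK.
Qed.

(** The partial sums depend on [ell] alone and not on the realisation of the process. This is the
    source of measurability in the starting point, which the hypotheses on [P] and [X] do not
    supply. *)
Lemma occupation_series eps F : 0 <= eps -> good eps F ->
  \sum_(0 <= k < m) primitive (iter k (picard_step beta) F) v ell @[m --> \oo] --> occupation F.
Proof.
move=> e0 gF; have [K K0 [q /andP[q0 q1] FK]] := picard_decay beta e0 gF.
have E m : occupation F = \sum_(0 <= k < m) primitive (iter k (picard_step beta) F) v ell +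
    occupation (iter m (picard_step beta) F).
  elim: m => [|m IH]; first by rewrite big_geq// add0r.
  rewrite big_nat_recr; last exact: leq0n.
  rewrite [RHS]/= -addrA IH; congr (_ + _).
  exact: (occupation_picard e0 (good_picard beta m e0 gF)).
have c : K * q ^+ k * #|V|%:R @[k --> \oo] --> 0.
  rewrite -[X in _ --> X](mul0r (#|V|%:R : R)); apply: cvgMl.
  by rewrite -(mulr0 K); apply: cvgMr; apply: cvg_expr; rewrite ger0_norm.
apply/cvgrPdist_le => e e_gt0; near=> m.
rewrite {1}(E m) addrAC subrr add0r.
apply: le_trans (norm_occupation_le (good_picard beta m e0 gF) _ (FK m)) _.
  by rewrite mulr_ge0// exprn_ge0.
apply: le_trans (ler_norm _) _; rewrite -[X in `|X|]opprK normrN -sub0r.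
by near: m; move/cvgrPdist_le : c; exact.
Unshelve. all: by end_near. Qed.

Lemma occupation_vanish eps F i : good eps F -> ell i <= eps -> occupation F = 0.
Proof.
move=> gF li; rewrite /occupation (@eq_Rintegral _ _ _ _ _ (fun _ => 0)) ?Rintegral_cst ?mul0r//.
move=> t /[!inE]/=; rewrite in_itv/= => /andP[t0 _].
rewrite /state_mean (@eq_Rintegral _ _ _ _ _ (fun _ => 0)) ?Rintegral_probability_cst//.
move=> w _; have [_ _ Fv] := gF; rewrite (Fv _ _ i)//.
have t00 : 0 <= (0 : R) <= t by rewrite lexx.
have mp k := measurable_path (vdjp_measurable HX) (vdjp_right_continuous HX) w k.
have /andP[] := remaining_lip ell mp i t00.
by rewrite remaining0; lra.
Qed.

End occupation.

Section lipschitz_isomorphism.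
Context (R : realType) (V : finType) (beta : V -> V -> R) (n : nat).
Hypothesis beta_sym : forall i j, beta i j = beta j i.
Hypothesis beta_ge0 : forall i j, 0 <= beta i j.
Context d (Omega : measurableType d) (P : V -> (V -> R) -> probability Omega R)
  (X : V -> (V -> R) -> R -> Omega -> V).
Hypothesis X_vdjp : forall v ell, half_open_cube ell ->
  is_vdjp beta v ell (P v ell) (X v ell).
Variable a : V.

Definition spin_occupation F (U : coords R V n.+1) : R :=
  occupation (P a (spin_z U)) (X a (spin_z U)) (spin_z U) F.

Lemma localized_spin_occupation eps F : 0 <= eps -> good eps F ->
  localized eps (spin_occupation F).
Proof.
move=> e0 gF; split.
- apply: (@measurable_fun_cvg _ _ _ _ (fun m U =>
    \sum_(0 <= k < m) primitive (iter k (picard_step beta) F) a (spin_z U))).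
    move=> m; apply: measurable_sum => k.
    have gS := good_primitive e0 (good_picard beta k e0 gF).
    apply: measurable_funTS; apply: (measurable_good_comp _ gS) => j.
    exact: measurable_spin_z.
  move=> U dU; have cU := spin_z_cube dU.
  exact: (occupation_series beta_ge0 cU (X_vdjp a cU) e0 gF).
- have [[K K0 FK] _ _] := gF; exists (K * #|V|%:R); first by rewrite mulr_ge0.
  move=> U dU; have cU := spin_z_cube dU.
  exact: (norm_occupation_le (X_vdjp a cU) gF K0 FK).
- move=> U i dU zi; have cU := spin_z_cube dU.
  exact: (occupation_vanish (X_vdjp a cU) gF zi).
Qed.

Lemma lipschitz_isomorphism eps F : 0 < eps -> good eps F ->
  rbracket beta (fun U : coords R V n.+1 =>
    \sum_j spin_x U a * (spin_x U j * F j (spin_z U))) =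
  rbracket beta (fun U : coords R V n.+1 => spin_z U a * spin_occupation F U).
Proof.
move=> eps0 gF; have e0 := ltW eps0.
pose M G := rbracket beta (fun U : coords R V n.+1 =>
  \sum_j spin_x U a * (spin_x U j * G j (spin_z U))).
pose N G := rbracket beta (fun U : coords R V n.+1 => spin_z U a * spin_occupation G U).
rewrite -/(M F) -/(N F); apply/eqP; rewrite -subr_eq0; apply/eqP.
have lM G : good eps G -> localized eps (fun U : coords R V n.+1 =>
    \sum_j spin_x U a * (spin_x U j * G j (spin_z U))).
  by move=> gG; apply: localized_sum => j; do 2 apply: localized_x; exact: localized_good.
have lN G : good eps G -> localized eps (fun U : coords R V n.+1 =>
    spin_z U a * spin_occupation G U).
  by move=> gG; apply: localized_z; exact: localized_spin_occupation.
(* M and N both drop by the same term [z_a (S G)(a, z)], by integration by parts on one side and by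
   Dynkin's formula on the other. *)
have step G : good eps G -> M G - N G = M (picard_step beta G) - N (picard_step beta G).
  move=> gG; have gS := good_primitive e0 gG.
  have gT : good eps (picard_step beta G) by exact: good_jump_part.
  have lS : localized eps (fun U : coords R V n.+1 => spin_z U a * primitive G a (spin_z U)).
    by apply: localized_z; exact: localized_good gS.
  have HM := hemisphere_identity n beta_sym beta_ge0 a eps0 gS gG (own_derivative_primitive gG).
  have -> : M (picard_step beta G) = M G -
      rbracket beta (fun U : coords R V n.+1 => spin_z U a * primitive G a (spin_z U)).
    rewrite HM /M -(rbracketB beta_ge0 eps0 (lM _ gG)); last first.
      by apply: (lM (fun i l => G i l - picard_step beta G i l)); exact: good_sub.
    apply: eq_rbracket => U _; rewrite -sumrB; apply: eq_bigr => j _.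
    by rewrite /picard_step; ring.
  have -> : N (picard_step beta G) = N G -
      rbracket beta (fun U : coords R V n.+1 => spin_z U a * primitive G a (spin_z U)).
    rewrite /N -(rbracketB beta_ge0 eps0 (lN _ gG) lS).
    apply: eq_rbracket => U dU; rewrite -mulrBr; congr (_ * _).
    have cU := spin_z_cube dU; rewrite /spin_occupation.
    by rewrite (occupation_picard beta_ge0 cU (X_vdjp a cU) e0 gG) addrAC subrr add0r.
  by ring.
have [K K0 [q q01 FK]] := picard_decay beta e0 gF.
pose C := eps^-1 ^+ #|V| * fine (coords_volume R V n.+1 (@coords_domain R V n.+1)).
(* The 2 counts the two sides; #|V| is the number of terms of the sum on one side and the length of
   the time interval on the other. *)
apply: (@le_geometric_eq0 _ _ (2 * (#|V|%:R * K * C)) q q01) => k.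
have iter_eq (D : (V -> (V -> R) -> R) -> R) :
    (forall G, good eps G -> D G = D (picard_step beta G)) ->
    D F = D (iter k (picard_step beta) F).
  move=> DS; elim: k => [|k IH]; first by [].
  by rewrite iterS -DS//; exact: good_picard.
rewrite (iter_eq (fun G => M G - N G) step).
have gk := good_picard beta k e0 gF.
have Kq0 : 0 <= K * q ^+ k by case/andP: q01 => q0 _; rewrite mulr_ge0// exprn_ge0.
have VK0 : 0 <= #|V|%:R * (K * q ^+ k) by rewrite mulr_ge0.
apply: le_trans (ler_normB _ _) _.
rewrite (_ : 2 * _ * _ = #|V|%:R * (K * q ^+ k) * eps^-1 ^+ #|V| *
    fine (coords_volume R V n.+1 (@coords_domain R V n.+1)) +
  #|V|%:R * (K * q ^+ k) * eps^-1 ^+ #|V| *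
    fine (coords_volume R V n.+1 (@coords_domain R V n.+1))); last by rewrite /C; ring.
apply: lerD; apply: norm_rbracket_le => //; [exact: lM| |exact: lN|].
  move=> U dU; apply: le_trans (ler_norm_sum _ _ _) _.
  rewrite mulr_natl -[#|V|]/(#|[pred _ : V | true]|) -sumr_const.
  apply: ler_sum => j _; rewrite !normrM -[leRHS]mul1r ler_pM ?spin_x_le1 ?mulr_ge0//.
  by rewrite -[leRHS]mul1r ler_pM ?spin_x_le1//.
move=> U dU; have cU := spin_z_cube dU.
rewrite normrM -[leRHS]mul1r ler_pM//.
  by have /andP[z0 z1] := spin_z_itv U a; rewrite ger0_norm.
rewrite mulrC; exact: (norm_occupation_le (X_vdjp a cU) gk Kq0 (FK k)).
Qed.

End lipschitz_isomorphism.

(** * Extension to Borel functions *)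

Section positive_functionals.
Context d (T : measurableType d) (R : realType).
Local Open Scope ereal_scope.
Implicit Types (f g : T -> \bar R) (J : (T -> \bar R) -> \bar R).

Definition ge0_measurable f := measurable_fun setT f /\ (forall x, 0 <= f x).

Lemma ge0_measurable_cvg (f_ : nat -> T -> \bar R) f :
  (forall n, ge0_measurable (f_ n)) ->
  (forall x, f_ n x @[n --> \oo] --> f x) -> ge0_measurable f.
Proof.
move=> fm fcvg; split.
  by apply: (emeasurable_fun_cvg f_) => [n|x _]; [have [] := fm n|exact: fcvg].
move=> x; rewrite -(cvg_lim _ (fcvg x))//; apply: lime_ge.
  exact: (cvgP _ (fcvg x)).
by apply: nearW => n; have [_ /(_ x)] := fm n.
Qed.

Lemma ge0_measurableD f g : ge0_measurable f -> ge0_measurable g ->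
  ge0_measurable (fun x => f x + g x).
Proof.
move=> [mf f0] [mg g0]; split; first exact: emeasurable_funD.
by move=> x; rewrite adde_ge0.
Qed.

Lemma ge0_measurable_indic (A : set T) (c : R) : (0 <= c)%R -> measurable A ->
  ge0_measurable (fun x => (c * \1_A x)%:E).
Proof.
move=> c0 mA; split; last by move=> x; rewrite lee_fin mulr_ge0.
apply/measurable_EFinP; apply: measurable_funM; first exact: measurable_cst.
exact: measurable_indic.
Qed.

(** These are the properties that a monotone class argument uses. They hold both for evaluation at a
    point, as on the spin side, and for integration along paths. *)
Record positive_functional J : Prop := {
  pf_ge0 : forall f, ge0_measurable f -> 0 <= J f ;
  pf_le : forall f g, ge0_measurable f -> ge0_measurable g ->
    (forall x, f x <= g x) -> J f <= J g ;
  pf_add : forall f g, ge0_measurable f -> ge0_measurable g ->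
    J (fun x => f x + g x) = J f + J g ;
  pf_scale : forall (c : R) f, (0 <= c)%R -> ge0_measurable f ->
    J (fun x => c%:E * f x) = c%:E * J f ;
  pf_cvg : forall (f_ : nat -> T -> \bar R) f, (forall n, ge0_measurable (f_ n)) ->
    (forall x, {homo f_ ^~ x : m n / (m <= n)%N >-> m <= n}) ->
    (forall x, f_ n x @[n --> \oo] --> f x) -> J (f_ n) @[n --> \oo] --> J f }.

Lemma pf_eval x : positive_functional (fun f => f x).
Proof.
by split => // f [].
Qed.

Lemma pf_integral d' (S : measurableType d') (mu : {measure set S -> \bar R})
    (D : set S) (phi : S -> T) : measurable D -> measurable_fun D phi ->
  positive_functional (fun f => \int[mu]_(s in D) f (phi s)).
Proof.
move=> mD mphi.
have mc f : ge0_measurable f -> measurable_fun D (fun s => f (phi s)).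
  by move=> [mf _]; exact: (measurable_comp measurableT _ mf mphi).
split.
- by move=> f [_ f0]; apply: integral_ge0 => s _.
- move=> f g fm gm fg; have [[_ f0] [_ g0]] := (fm, gm).
  by apply: ge0_le_integral => //; exact: mc.
- move=> f g fm gm; have [[_ f0] [_ g0]] := (fm, gm).
  by rewrite ge0_integralD//; exact: mc.
- move=> c f c0 fm; have [_ f0] := fm.
  by rewrite ge0_integralZl_EFin//; exact: mc.
- move=> f_ f fm nd fcvg.
  have lE s : f (phi s) = limn (fun n => f_ n (phi s)) by apply/esym/cvg_lim.
  under [X in _ --> X]eq_integral do rewrite lE.
  apply: cvg_monotone_convergence => //.
  + by move=> n; exact: mc.
  + by move=> n s _; case: (fm n).
Qed.

Lemma pf_mulr (c : R) J : (0 <= c)%R -> positive_functional J ->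
  positive_functional (fun f => c%:E * J f).
Proof.
move=> c0 [J0 Jle Jadd Jscale Jcvg]; split.
- by move=> f fm; rewrite mule_ge0 ?lee_fin ?J0.
- by move=> f g fm gm fg; apply: lee_wpmul2l; [rewrite lee_fin|exact: Jle].
- by move=> f g fm gm; rewrite Jadd// ge0_muleDr ?J0.
- by move=> k f k0 fm; rewrite Jscale// muleCA.
- move=> f_ f fm nd fcvg; apply: cvgeZl => //; exact: Jcvg.
Qed.

Lemma pf_sum J1 J2 : positive_functional J1 -> positive_functional J2 ->
  positive_functional (fun f => J1 f + J2 f).
Proof.
move=> [J10 J1le J1add J1scale J1cvg] [J20 J2le J2add J2scale J2cvg]; split.
- by move=> f fm; rewrite adde_ge0 ?J10 ?J20.
- by move=> f g fm gm fg; rewrite leeD ?J1le ?J2le.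
- by move=> f g fm gm; rewrite J1add// J2add// addeACA.
- by move=> k f k0 fm; rewrite J1scale// J2scale// ge0_muleDr ?J10 ?J20.
- move=> f_ f fm nd fcvg; apply: cvgeD; [|exact: J1cvg|exact: J2cvg].
  have fmf : ge0_measurable f.
    exact: ge0_measurable_cvg fm fcvg.
  by rewrite ge0_adde_def// inE ?J10 ?J20.
Qed.

End positive_functionals.

Section matched_functionals.
Context d (S : measurableType d) d' (T : measurableType d') (R : realType).
Variable mu : {measure set S -> \bar R}.
Variables I1 I2 : S -> (T -> \bar R) -> \bar R.
Hypothesis pf1 : forall U, positive_functional (I1 U).
Hypothesis pf2 : forall U, positive_functional (I2 U).
Local Open Scope ereal_scope.

(* Measurability in the parameter and equality of the integrals have to be extended
   from a pi-system together, since neither is known beforehand for general [f]. *)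
Definition matched (f : T -> \bar R) := [/\ measurable_fun setT (I1 ^~ f),
  measurable_fun setT (I2 ^~ f) & \int[mu]_U I1 U f = \int[mu]_U I2 U f].

Lemma matched_cvg (f_ : nat -> T -> \bar R) f :
  (forall n, ge0_measurable (f_ n)) ->
  (forall x, {homo f_ ^~ x : m n / (m <= n)%N >-> m <= n}) ->
  (forall x, f_ n x @[n --> \oo] --> f x) ->
  (forall n, matched (f_ n)) -> matched f.
Proof.
move=> fm nd fcvg mtch.
have c1 U : I1 U (f_ n) @[n --> \oo] --> I1 U f by exact: pf_cvg (pf1 U) _ _ fm nd fcvg.
have c2 U : I2 U (f_ n) @[n --> \oo] --> I2 U f by exact: pf_cvg (pf2 U) _ _ fm nd fcvg.
have m1 n : measurable_fun setT (I1 ^~ (f_ n)) by have [] := mtch n.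
have m2 n : measurable_fun setT (I2 ^~ (f_ n)) by have [] := mtch n.
have l1 U : I1 U f = limn (fun n => I1 U (f_ n)) by apply/esym/cvg_lim.
have l2 U : I2 U f = limn (fun n => I2 U (f_ n)) by apply/esym/cvg_lim.
split.
- by apply: (emeasurable_fun_cvg (fun n => I1 ^~ (f_ n))) => // U _; exact: c1.
- by apply: (emeasurable_fun_cvg (fun n => I2 ^~ (f_ n))) => // U _; exact: c2.
have C1 : \int[mu]_U I1 U (f_ n) @[n --> \oo] --> \int[mu]_U I1 U f.
  under [X in _ --> X]eq_integral do rewrite l1.
  apply: cvg_monotone_convergence => //.
    by move=> n U _; exact: (pf_ge0 (pf1 U) (fm n)).
  by move=> U _ m n mn; apply: (pf_le (pf1 U) (fm m) (fm n)) => x; exact: nd.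
have C2 : \int[mu]_U I2 U (f_ n) @[n --> \oo] --> \int[mu]_U I2 U f.
  under [X in _ --> X]eq_integral do rewrite l2.
  apply: cvg_monotone_convergence => //.
    by move=> n U _; exact: (pf_ge0 (pf2 U) (fm n)).
  by move=> U _ m n mn; apply: (pf_le (pf2 U) (fm m) (fm n)) => x; exact: nd.
have e : (fun n => \int[mu]_U I1 U (f_ n)) = (fun n => \int[mu]_U I2 U (f_ n)).
  by apply/funext => n; have [] := mtch n.
by rewrite e in C1; exact: (cvg_unique _ C1 C2).
Qed.

Lemma matchedD f g : ge0_measurable f -> ge0_measurable g ->
  matched f -> matched g -> matched (fun x => f x + g x).
Proof.
move=> fm gm [f1 f2 fE] [g1 g2 gE].
have e1 : I1 ^~ (fun x => f x + g x) = (fun U => I1 U f + I1 U g).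
  by apply/funext => U; rewrite (pf_add (pf1 U)).
have e2 : I2 ^~ (fun x => f x + g x) = (fun U => I2 U f + I2 U g).
  by apply/funext => U; rewrite (pf_add (pf2 U)).
split; rewrite ?e1 ?e2; [exact: emeasurable_funD|exact: emeasurable_funD|].
have p1 := fun U => pf_ge0 (pf1 U); have p2 := fun U => pf_ge0 (pf2 U).
by rewrite !ge0_integralD ?fE ?gE// => U _; rewrite ?p1 ?p2.
Qed.

Lemma matchedZ (c : R) f : (0 <= c)%R -> ge0_measurable f ->
  matched f -> matched (fun x => c%:E * f x).
Proof.
move=> c0 fm [f1 f2 fE].
have e1 : I1 ^~ (fun x => c%:E * f x) = (fun U => c%:E * I1 U f).
  by apply/funext => U; rewrite (pf_scale (pf1 U)).
have e2 : I2 ^~ (fun x => c%:E * f x) = (fun U => c%:E * I2 U f).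
  by apply/funext => U; rewrite (pf_scale (pf2 U)).
have mc : measurable_fun setT (cst c%:E : S -> \bar R) by exact: measurable_cst.
split; rewrite ?e1 ?e2; [exact: emeasurable_funM|exact: emeasurable_funM|].
have p1 := fun U => pf_ge0 (pf1 U); have p2 := fun U => pf_ge0 (pf2 U).
by rewrite !ge0_integralZl_EFin ?fE// => U _; rewrite ?p1 ?p2.
Qed.

Hypothesis fin1 : forall U, I1 U (cst 1) < +oo.
Hypothesis fin2 : forall U, I2 U (cst 1) < +oo.
Hypothesis fin : \int[mu]_U I1 U (cst 1) < +oo.
Hypothesis matched1 : matched (cst 1).

Let indic (A : set T) : T -> \bar R := fun x => (\1_A x)%:E.

Let indic_ge0 A : measurable A -> ge0_measurable (indic A).
Proof.
move=> mA; split; last by move=> x; rewrite lee_fin.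
by apply/measurable_EFinP; exact: measurable_indic.
Qed.

Let indic_setC A : cst 1 = (fun x => indic A x + indic (~` A) x).
Proof.
apply/funext => x; rewrite /indic !indicE in_setC -EFinD.
by case: (x \in A); rewrite /= ?addr0 ?add0r.
Qed.

(** Complements are obtained by subtraction from the constant 1, which is why finiteness is required
    both for each parameter and after integration. *)
Let matched_setC A : measurable A -> matched (indic A) -> matched (indic (~` A)).
Proof.
move=> mA [m1 m2 AE]; have [c1 c2 cE] := matched1.
have mCA : measurable (~` A) by exact: measurableC.
have A0 := indic_ge0 mA; have CA0 := indic_ge0 mCA.
have s1 U : I1 U (cst 1) = I1 U (indic A) + I1 U (indic (~` A)).
  by rewrite (indic_setC A) (pf_add (pf1 U)).
have s2 U : I2 U (cst 1) = I2 U (indic A) + I2 U (indic (~` A)).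
  by rewrite (indic_setC A) (pf_add (pf2 U)).
have p1 := fun U => pf_ge0 (pf1 U); have p2 := fun U => pf_ge0 (pf2 U).
have f1 U : I1 U (indic A) \is a fin_num.
  rewrite ge0_fin_numE ?p1//; apply: le_lt_trans (fin1 U).
  by rewrite s1 leeDl// p1.
have f2 U : I2 U (indic A) \is a fin_num.
  rewrite ge0_fin_numE ?p2//; apply: le_lt_trans (fin2 U).
  by rewrite s2 leeDl// p2.
have e1 : I1 ^~ (indic (~` A)) = (fun U => I1 U (cst 1) - I1 U (indic A)).
  by apply/funext => U; rewrite s1 addeAC subee// add0e.
have e2 : I2 ^~ (indic (~` A)) = (fun U => I2 U (cst 1) - I2 U (indic A)).
  by apply/funext => U; rewrite s2 addeAC subee// add0e.
have m1' : measurable_fun setT (I1 ^~ (indic (~` A))) by rewrite e1; exact: emeasurable_funB.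
have m2' : measurable_fun setT (I2 ^~ (indic (~` A))) by rewrite e2; exact: emeasurable_funB.
split => //.
have d1 : \int[mu]_U I1 U (cst 1) = \int[mu]_U I1 U (indic A) + \int[mu]_U I1 U (indic (~` A)).
  by under eq_integral do rewrite s1; rewrite ge0_integralD// => U _; exact: p1.
have d2 : \int[mu]_U I2 U (cst 1) = \int[mu]_U I1 U (indic A) + \int[mu]_U I2 U (indic (~` A)).
  by under eq_integral do rewrite s2; rewrite AE ge0_integralD// => U _; exact: p2.
have Afin : \int[mu]_U I1 U (indic A) \is a fin_num.
  rewrite ge0_fin_numE; last by apply: integral_ge0 => U _; exact: p1.
  apply: le_lt_trans fin; rewrite d1 leeDl//.
  by apply: integral_ge0 => U _; exact: p1.
have cancel (x : \bar R) : x = \int[mu]_U I1 U (indic A) + x - \int[mu]_U I1 U (indic A).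
  by rewrite addeAC subee// add0e.
by rewrite [LHS]cancel [RHS]cancel -d1 -d2 cE.
Qed.

Let matched0 : matched (fun=> 0).
Proof.
have e1 : I1 ^~ (fun=> 0) = fun=> 0.
  apply/funext => U; transitivity (I1 U (fun x => 0%:E * cst 1 x)).
    by congr (I1 U); apply/funext => x; rewrite mul0e.
  by rewrite (pf_scale (pf1 U)) ?mul0e//; split => //; exact: measurable_cst.
have e2 : I2 ^~ (fun=> 0) = fun=> 0.
  apply/funext => U; transitivity (I2 U (fun x => 0%:E * cst 1 x)).
    by congr (I2 U); apply/funext => x; rewrite mul0e.
  by rewrite (pf_scale (pf2 U)) ?mul0e//; split => //; exact: measurable_cst.
by split; rewrite ?e1 ?e2//; exact: measurable_cst.
Qed.

Let matched_sum (F : nat -> T -> \bar R) n :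
  (forall k, ge0_measurable (F k)) -> (forall k, matched (F k)) ->
  ge0_measurable (fun x => \sum_(k < n) F k x) /\
  matched (fun x => \sum_(k < n) F k x).
Proof.
move=> Fm FM; elim: n => [|n [IHm IHM]].
  rewrite (_ : (fun x => _) = fun=> 0); last first.
    by apply/funext => x; rewrite big_ord0.
  by split => //; split => //; exact: measurable_cst.
rewrite (_ : (fun x => _) = fun x => \sum_(k < n) F k x + F n x); last first.
  by apply/funext => x; rewrite big_ord_recr.
by split; [exact: ge0_measurableD|exact: matchedD].
Qed.

Lemma matched_indic (G : set (set T)) : @measurable _ T = <<s G>> ->
  setI_closed G -> (forall A, G A -> matched (indic A)) ->
  forall A, measurable A -> matched (indic A).
Proof.
move=> GE GI MG; move=> A; rewrite GE.
apply: (@dynkin_induction _ _ _ (fun A => matched (indic A)) GE GI) => //.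
- by rewrite (_ : indic setT = cst 1)//; apply/funext => x; rewrite /indic indicT.
move=> F mF tF MF.
have Fm k : ge0_measurable (indic (F k)) by exact: indic_ge0.
apply: (@matched_cvg (fun n x => \sum_(k < n) indic (F k) x)).
- by move=> n; have [] := matched_sum n Fm MF.
- move=> x m n mn; rewrite -!(big_mkord xpredT (fun k => indic (F k) x)).
  by apply: lee_sum_nneg_natr => // k _ _; rewrite lee_fin.
- move=> x; rewrite /indic indic_bigcup//.
  rewrite [X in X @ _ --> _](_ : _ = (fun n => \sum_(0 <= k < n) (\1_(F k) x)%:E)).
    by apply: is_cvg_nneseries => k _ _; rewrite lee_fin.
  by apply/funext => n; rewrite big_mkord.
- by move=> n; have [] := matched_sum n Fm MF.
Qed.

Import HBNNSimple.

Lemma matched_ge0 (G : set (set T)) : @measurable _ T = <<s G>> ->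
  setI_closed G -> (forall A, G A -> matched (indic A)) ->
  forall f, ge0_measurable f -> matched f.
Proof.
move=> GE GI MG f [mf f0]; have MA := matched_indic GE GI MG.
pose h := nnsfun_approx measurableT mf.
have hm n : ge0_measurable (fun x => (h n x)%:E).
  by split; [exact/measurable_EFinP|move=> x; rewrite lee_fin].
apply: (@matched_cvg (fun n x => (h n x)%:E)) => //.
- by move=> x m n mn; rewrite lee_fin; move/lefP: (nd_nnsfun_approx measurableT mf mn); exact.
- by move=> x; apply: (cvg_nnsfun_approx measurableT mf (fun x _ => f0 x)).
move=> n; pose s := finmap.enum_fset (fset_set (range (h n))).
(* Indices beyond the size of [s] read the default 0, so the terms [F k] make sense for every
   natural k. *)
have s0 k : (0 <= s`_k)%R.
  have [ks|sk] := ltnP k (size s); last by rewrite nth_default.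
  have : s`_k \in s by exact: mem_nth.
  by rewrite in_fset_set// inE => -[y _ <-].
pose F k x : \bar R := (s`_k * \1_(h n @^-1` [set s`_k]) x)%:E.
rewrite (_ : (fun x => _) = fun x => \sum_(k < size s) F k x); last first.
  by apply/funext => x; rewrite fimfunEord -sumEFin.
have mA k : measurable (h n @^-1` [set s`_k]) by exact: measurable_sfunP.
have FE k : F k = fun x => (s`_k)%:E * indic (h n @^-1` [set s`_k]) x.
  by apply/funext => x; rewrite /F EFinM.
have Fm k : ge0_measurable (F k) by exact: ge0_measurable_indic.
have FM k : matched (F k).
  by rewrite FE; apply: matchedZ => //; [exact: indic_ge0|exact: MA].
by have [] := matched_sum (size s) Fm FM.
Qed.

End matched_functionals.

(** * Joint measurability of the clocks in time and path *)

Section path_measurability.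
Context (R : realType) (V : finType) d (Omega : measurableType d).
Context (Y : R -> Omega -> V) (ell : V -> R).
Hypothesis mY : forall (t : R) i, 0 <= t -> measurable (Y t @^-1` [set i]).
Hypothesis rcY : forall w (t : R), 0 <= t -> \forall s \near t^'+, Y s w = Y t w.

(** The section argument used for a fixed time, with the time horizon as one more variable, so that
    functions of the clocks can be integrated against Lebesgue measure times [P]. *)
Lemma measurable_remaining_path j : measurable_fun setT
  (fun p : measurableTypeR R * Omega => remaining ell (Y ^~ p.2) p.1 j).
Proof.
apply: measurable_funB; first exact: measurable_cst.
pose T2 := (measurableTypeR R * (measurableTypeR R * Omega))%type.
pose A := [set q : T2 | q.1 <= q.2.1] `&` [set q : T2 | 0 <= q.1 /\ Y q.1 q.2.2 = j].
have mA : measurable A.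
  apply: measurableI.
    rewrite [X in measurable X](_ : _ =
        setT `&` (fun q : T2 => q.2.1 - q.1) @^-1` [set` `[0, +oo[ ]); last first.
      by apply/seteqP; split => q /=; rewrite in_itv/= andbT subr_ge0 //; case.
    have mfs : measurable_fun setT (fun q : T2 => q.2.1).
      exact: (measurableT_comp measurable_fst measurable_snd).
    have mB : measurable_fun setT (fun q : T2 => (q.2.1 : R) - q.1).
      by apply: measurable_funB => //; exact: measurable_fst.
    exact: (mB measurableT _ (measurable_itv `[0, +oo[)).
  have m : measurable_fun setT (fun q : T2 => (q.1, q.2.2)).
    apply/measurable_fun_pairP; split; first exact: measurable_fst.
    exact: (measurableT_comp measurable_snd measurable_snd).
  have := m measurableT _ (measurable_process mY rcY j).
  by rewrite setTI.
rewrite [X in measurable_fun _ X](_ : _ = fine \o (@lebesgue_measure R \o ysection A)).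
  by apply: measurableT_comp => //; exact: measurable_fun_ysection.
apply/funext => -[t w] /=; rewrite /Rintegral; congr fine.
have mB := measurable_path mY rcY w j.
transitivity (\int[lebesgue_measure]_(s in `[0%R, t])
    (\1_([set s : measurableTypeR R | 0 <= s /\ Y s w = j]) s)%:E)%E.
  apply: eq_integral => s; rewrite inE/= => st.
  by rewrite -(path_indicE (Y ^~ w) j (lexx 0) st).
rewrite integral_indic//; congr (lebesgue_measure _).
apply/seteqP; split => s; rewrite /ysection /= inE /A/= in_itv/=.
  by move=> [[s0 Ys] /andP[_ st]].
by move=> [st [s0 Ys]]; rewrite s0 st.
Qed.

Definition tuple_of_family (l : V -> R) : #|V|.-tuple R :=
  [tuple l (enum_val i) | i < #|V|].

Lemma family_of_tuple l : family_of (tuple_of_family l) = l.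
Proof. by apply/funext => i; rewrite /family_of tnth_mktuple enum_rankK. Qed.

Lemma measurable_tuple_of_family d' (T : measurableType d') (L : T -> V -> R) :
  (forall j, measurable_fun setT (L ^~ j)) ->
  measurable_fun setT (fun p => tuple_of_family (L p)).
Proof.
move=> mL; apply/measurable_fun_tnthP => i.
rewrite [X in measurable_fun _ X](_ : _ = L ^~ (enum_val i)); first exact: mL.
by apply/funext => p /=; rewrite tnth_mktuple.
Qed.

End path_measurability.

(** * Open orthants as a generating pi-system *)

Section boxes.
Context (R : realType) (k : nat).

(** Unbounded above, so that intersections are again boxes and the set where all coordinates exceed
    [eps] is itself one. *)
Definition box (q : 'I_k -> R) : set (k.-tuple R) :=
  [set s | forall i, q i < tnth s i].

Lemma boxI q r : box q `&` box r = box (fun i => Num.max (q i) (r i)).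
Proof.
apply/seteqP; split => [s [sq sr] i|s h].
  by rewrite gt_max sq sr.
by split => i; have := h i; rewrite gt_max => /andP[].
Qed.

Lemma measurable_box q : measurable (box q).
Proof.
rewrite (_ : box q = \bigcap_(i in [set: 'I_k])
    ((fun s : k.-tuple R => tnth s i) @^-1` [set` `]q i, +oo[])).
  apply: fin_bigcap_measurable => // i _; rewrite -[X in measurable X]setTI.
  by apply: measurable_tnth => //; exact: measurable_itv.
apply/seteqP; split => [s h i _ /=|s h i].
  by rewrite in_itv/= h.
by have := h i Logic.I; rewrite /= in_itv/= andbT.
Qed.

Lemma measurable_boxE :
  @measurable _ (k.-tuple R) = <<s range box >>.
Proof.
apply/seteqP; split; last first.
  apply: smallest_sub; first exact: sigma_algebra_measurable.
  by move=> _ [q _ <-]; exact: measurable_box.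
move=> A mA; pose T0 := g_sigma_algebraType (range box).
have mid : measurable_fun setT (id : T0 -> k.-tuple R).
  apply/measurable_fun_tnthP => i.
  have GE := RGenOInfty.measurableE R.
  apply: (measurability _ GE) => _ [_ [x ->] <-]; rewrite setTI.
  (* Letting the other thresholds tend to minus infinity exhausts the half-space in direction i. *)
  pose q m j : R := if j == i then x else - m%:R.
  rewrite (_ : _ @^-1` _ = \bigcup_m box (q m)).
    by apply: bigcupT_measurable => m; apply: sub_sigma_algebra; exists (q m).
  apply/seteqP; split => [s /=|s [m _ h]]; last first.
    by have := h i; rewrite /q eqxx /= in_itv/= andbT.
  rewrite in_itv/= andbT => xs.
  pose M := \sum_j `|tnth s j|.
  exists (Num.truncn M).+1 => // j; rewrite /q; case: eqP => [->//|_].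
  rewrite ltrNl; apply: le_lt_trans (truncnS_gt _).
  rewrite (le_trans (ler_norm _))// normrN /M (bigD1 j)//= lerDl.
  by apply: sumr_ge0.
have := mid measurableT A mA; rewrite setTI; exact.
Qed.

End boxes.

(** * Lipschitz approximation of orthants from below *)

Section ramps.
Context (R : realType) (V : finType).

Definition ramp (m : nat) (x : R) : R := Order.min 1 (Order.max 0 (m%:R * x)).

Lemma ramp_itv m x : 0 <= ramp m x <= 1.
Proof. by rewrite /ramp le_min ler01 le_max lexx/= ge_min lexx. Qed.

Lemma ramp_le0 m x : x <= 0 -> ramp m x = 0.
Proof.
move=> x0; rewrite /ramp max_l ?min_r//.
by rewrite mulr_ge0_le0.
Qed.

Lemma ramp_eq1 m x : 1 <= m%:R * x -> ramp m x = 1.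
Proof. by move=> h; rewrite /ramp min_l// le_max h orbT. Qed.

Lemma ramp_lip m x y : `|ramp m x - ramp m y| <= m%:R * `|x - y|.
Proof.
have m0 : 0 <= m%:R :> R by [].
rewrite -[X in X * `|_|]ger0_norm// -normrM mulrBr /ramp.
move: (m%:R * x) (m%:R * y) => {m m0 x y} x y.
wlog xy : x y / x <= y.
  by move=> h; case: (leP x y) => [/h//|/ltW /h]; rewrite distrC [X in _ <= X]distrC.
rewrite [X in _ <= X]distrC [X in X <= _]distrC.
rewrite [X in _ <= X]ger0_norm ?subr_ge0//.
rewrite !maxEle !minEle.
by repeat case: ifPn => /=; rewrite -?ltNge => *; rewrite ler_norml; apply/andP; split; lra.
Qed.

Lemma ramp_nondecreasing x : {homo ramp^~ x : m n / (m <= n)%N >-> m <= n}.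
Proof.
move=> m n mn; have [x0|x0] := leP x 0; first by rewrite !ramp_le0.
rewrite /ramp le_min ge_min lexx/= ge_min; apply/orP; right.
by rewrite ge_max le_max lexx/= le_max ler_pM2r// ler_nat mn orbT.
Qed.

Lemma prod_lipschitz (I : Type) (s : seq I) (f g : I -> R) :
  (forall i, 0 <= f i <= 1) -> (forall i, 0 <= g i <= 1) ->
  `|\prod_(i <- s) f i - \prod_(i <- s) g i| <= \sum_(i <- s) `|f i - g i|.
Proof.
move=> f01 g01; elim: s => [|i s IH]; first by rewrite !big_nil subrr normr0.
rewrite !big_cons; set p := \prod_(i <- s) f i; set q := \prod_(i <- s) g i.
have -> : f i * p - g i * q = (f i - g i) * p + g i * (p - q) by ring.
apply: le_trans (ler_normD _ _) _; rewrite !normrM; apply: lerD.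
  rewrite ler_piMr// ger0_norm ?prodr_ge0//.
    by apply: prodr_ile1 => j _; exact: f01.
  by move=> j _; have /andP[] := f01 j.
have /andP[g0 g1] := g01 i.
by apply: le_trans IH; rewrite ler_piMl// ger0_norm.
Qed.

Definition box_ramp (q : V -> R) m (l : V -> R) : R := \prod_j ramp m (l j - q j).

Lemma box_ramp_itv q m l : 0 <= box_ramp q m l <= 1.
Proof.
apply/andP; split.
  by apply: prodr_ge0 => j _; have /andP[] := ramp_itv m (l j - q j).
by apply: prodr_ile1 => j _; exact: ramp_itv.
Qed.

Lemma box_ramp_eq0 q m l j : l j <= q j -> box_ramp q m l = 0.
Proof.
by move=> lq; rewrite /box_ramp (bigD1 j)//= ramp_le0 ?mul0r// subr_le0.
Qed.

Lemma box_ramp_nondecreasing q l :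
  {homo (box_ramp q)^~ l : m n / (m <= n)%N >-> m <= n}.
Proof.
move=> m n mn; apply: ler_prod => j _.
by rewrite ramp_nondecreasing// andbT; have /andP[] := ramp_itv m (l j - q j).
Qed.

Lemma good_box_ramp eps q m (b : V) : (forall j, eps <= q j) ->
  good eps (fun i l => (i == b)%:R * box_ramp q m l).
Proof.
move=> eq; split.
- exists 1 => // i l; have /andP[h0 h1] := box_ramp_itv q m l.
  by rewrite ger0_norm ?mulr_ge0// -[leRHS]mul1r ler_pM//; case: (i == b).
- exists m%:R => // i l l'; rewrite -mulrBr normrM -[leRHS]mul1r ler_pM//.
    by rewrite normr_nat; case: (i == b).
  apply: le_trans (prod_lipschitz _ _ _) _; [move=> j; exact: ramp_itv..|].
  rewrite /l1dist mulr_sumr; apply: ler_sum => j _.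
  by apply: le_trans (ramp_lip _ _ _) _; rewrite opprB addrA subrK.
- by move=> i l j lj; rewrite (@box_ramp_eq0 _ _ _ j) ?mulr0//; exact: le_trans lj _.
Qed.

Lemma cvg_box_ramp q l : box_ramp q m l @[m --> \oo] --> ([forall j, q j < l j]%:R : R).
Proof.
apply: cvg_near_cst; have [/forallP h|/forallPn[j]] := boolP [forall j, q j < l j]; last first.
  by rewrite -leNgt => lj; apply: nearW => m; exact: box_ramp_eq0 lj.
have h0 j : 0 < l j - q j by rewrite subr_gt0.
near=> m; rewrite /box_ramp big1// => j _; apply: ramp_eq1.
rewrite -ler_pdivrMr// mul1r.
(* The sum is a single threshold for m that dominates each 1 / (l_j - q_j). *)
apply: (@le_trans _ _ (\sum_j (l j - q j)^-1)).
  rewrite (bigD1 j)//= lerDl; apply: sumr_ge0 => i _.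
  by rewrite invr_ge0 ltW.
by near: m; exact: nbhs_infty_ger.
Unshelve. all: by end_near. Qed.

End ramps.

(** * Both sides of the identity as positive functionals of the observable *)

Section borel_parts.
Context (R : realType) (V : finType) (beta : V -> V -> R) (n : nat).
Hypothesis beta_sym : forall i j, beta i j = beta j i.
Hypothesis beta_ge0 : forall i j, 0 <= beta i j.
Context d (Omega : measurableType d) (P : V -> (V -> R) -> probability Omega R)
  (X : V -> (V -> R) -> R -> Omega -> V).
Hypothesis X_vdjp : forall v ell, half_open_cube ell ->
  is_vdjp beta v ell (P v ell) (X v ell).
Variables (a b : V) (eps : R).
Hypothesis eps0 : 0 < eps.

Notation Theta := (#|V|.-tuple R).
Notation vol := (coords_volume R V n.+1).
Notation dom := (@coords_domain R V n.+1).
Implicit Types (U : coords R V n.+1) (f : Theta -> \bar R).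

Definition inner_cube : set Theta := box (fun=> eps).

Definition ztuple U : Theta := tuple_of_family (spin_z U).

(** The cut-off at z > eps keeps the weight bounded and makes only the values of the observable on
    [inner_cube] count. *)
Definition inner_weight U : R :=
  spin_weight beta U * \1_(dom `&` ztuple @^-1` inner_cube) U.

(* s = 1 and s = -1 give the positive and negative parts of x_a x_b. *)
Definition spin_part (s : R) U : R :=
  Num.max (s * (spin_x U a * spin_x U b)) 0.

Definition path_tuple U (p : measurableTypeR R * Omega) : Theta :=
  tuple_of_family (remaining (spin_z U) ((X a (spin_z U)) ^~ p.2) p.1).

(** Stopping at time #|V| loses nothing: from then on some clock is at most 0, outside [inner_cube].
    The condition [dom U] makes the set empty where [spin_z U] need not be an admissible starting
    point. *)
Definition visits U : set (measurableTypeR R * Omega) :=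
  [set p | [/\ dom U, 0 <= p.1 <= #|V|%:R, X a (spin_z U) p.1 p.2 = b
    & inner_cube (path_tuple U p)]].

Definition time_integral U f : \bar R :=
  \int[(@lebesgue_measure R \x P a (spin_z U))%E]_(p in visits U) f (path_tuple U p).

Definition lhs_part s U f : \bar R :=
  ((spin_part s U * inner_weight U)%:E * f (ztuple U))%E.

Definition rhs_part U f : \bar R :=
  ((spin_z U a * spin_weight beta U)%:E * time_integral U f)%E.

(* The negative part of x_a x_b is moved to the right-hand side, so that both sides are
   nonnegative in [f]. *)
Definition rhs_total U f : \bar R := (lhs_part (-1) U f + rhs_part U f)%E.

Lemma spin_weight_ge0 U : 0 <= spin_weight beta U.
Proof.
rewrite mulr_ge0 ?expR_ge0//; apply: prodr_ge0 => i _; rewrite invr_ge0.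
by have /andP[] := spin_z_itv U i.
Qed.

Lemma inner_weight_ge0 U : 0 <= inner_weight U.
Proof. by rewrite mulr_ge0 ?spin_weight_ge0. Qed.

Lemma spin_part_ge0 s U : 0 <= spin_part s U.
Proof. by rewrite le_max lexx orbT. Qed.

Lemma inner_cubeP l : inner_cube (tuple_of_family l) <-> forall i, eps < l i.
Proof.
split=> h i; last by rewrite tnth_mktuple.
by have := h (enum_rank i); rewrite tnth_mktuple enum_rankK.
Qed.

Lemma measurable_path_tuple U : dom U -> measurable_fun setT (path_tuple U).
Proof.
move=> dU; have HX := X_vdjp a (spin_z_cube dU).
apply: (@measurable_tuple_of_family _ _ _ _ (fun p : measurableTypeR R * Omega =>
  remaining (spin_z U) ((X a (spin_z U)) ^~ p.2) p.1)) => j.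
exact: (measurable_remaining_path _ (vdjp_measurable HX) (vdjp_right_continuous HX)).
Qed.

Lemma measurable_visits U : measurable (visits U).
Proof.
have [dU|ndU] := pselect (dom U); last first.
  rewrite (_ : visits U = set0); first exact: measurable0.
  by apply/seteqP; split => // p [].
have HX := X_vdjp a (spin_z_cube dU).
rewrite (_ : visits U = ([set` `[0, #|V|%:R]] `*` setT) `&`
    [set p : measurableTypeR R * Omega | 0 <= p.1 /\ X a (spin_z U) p.1 p.2 = b] `&`
    path_tuple U @^-1` inner_cube).
  apply: measurableI; last first.
    rewrite -[X in measurable X]setTI; apply: measurable_path_tuple => //.
    exact: measurable_box.
  apply: measurableI.
    by apply: measurableX => //; exact: measurable_itv.
  exact: (measurable_process (vdjp_measurable HX) (vdjp_right_continuous HX)).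
apply/seteqP; split => [p [_ pV pb pq]|p [[[/= pV _] [p0 pb]] pq]].
  split=> //; split; first by split => //=; rewrite in_itv.
  by split=> //; case/andP: pV.
by split => //; move: pV; rewrite in_itv.
Qed.

Lemma pf_time_integral U : positive_functional (time_integral U).
Proof.
apply: pf_integral; first exact: measurable_visits.
have [dU|ndU] := pselect (dom U).
  by apply: measurable_funTS; exact: measurable_path_tuple.
rewrite (_ : visits U = set0); first exact: measurable_fun_set0.
by apply/seteqP; split => // p [].
Qed.

Lemma pf_lhs_part s U : positive_functional (lhs_part s U).
Proof.
apply: (pf_mulr _ (@pf_eval _ _ R (ztuple U))).
by rewrite mulr_ge0 ?spin_part_ge0 ?inner_weight_ge0.
Qed.

Lemma pf_rhs_part U : positive_functional (rhs_part U).
Proof.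
apply: (@pf_mulr _ _ _ _ (time_integral U) _ (pf_time_integral U)).
by rewrite mulr_ge0 ?spin_weight_ge0//; have /andP[] := spin_z_itv U a.
Qed.

Lemma pf_rhs U : positive_functional (rhs_total U).
Proof. exact: (pf_sum (pf_lhs_part _ _) (pf_rhs_part _)). Qed.

Lemma eq_lhs_part s U f f' : (forall t, inner_cube t -> f t = f' t) ->
  lhs_part s U f = lhs_part s U f'.
Proof.
move=> ff'; rewrite /lhs_part.
have [zq|nzq] := pselect (inner_cube (ztuple U)); first by rewrite ff'.
by rewrite /inner_weight indicE memNset ?mulr0 ?mul0e//; case.
Qed.

Lemma eq_rhs_part U f f' : (forall t, inner_cube t -> f t = f' t) ->
  rhs_part U f = rhs_part U f'.
Proof.
move=> ff'; rewrite /rhs_part; congr (_ * _)%E.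
by apply: eq_integral => p; rewrite inE => -[_ _ _ /ff'].
Qed.

Section test_function.
Variables (h : (V -> R) -> R).
Hypothesis h_ge0 : forall l, 0 <= h l.
Let F (i : V) l := (i == b)%:R * h l.
Hypothesis good_F : good eps F.

Let h_vanish l j : l j <= eps -> h l = 0.
Proof.
by move=> lj; have := good_vanish good_F b lj; rewrite /F eqxx mul1r.
Qed.

Let h_cube l : ~ inner_cube (tuple_of_family l) -> h l = 0.
Proof.
move=> nq; have [j lj] : exists j, l j <= eps; last exact: h_vanish lj.
apply: contrapT => /forallNP h'; apply: nq; apply/inner_cubeP => j.
by rewrite ltNge; apply/negP; exact: h'.
Qed.

Definition test (s : Theta) : \bar R := (h (family_of s))%:E.

Hypothesis measurable_test : measurable_fun setT test.

Lemma ge0_measurable_test : ge0_measurable test.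
Proof. by split => // s; rewrite lee_fin. Qed.

Lemma time_integral_test U : dom U -> time_integral U test =
  (spin_occupation P X a F U)%:E.
Proof.
move=> dU; have cU := spin_z_cube dU; have HX := X_vdjp a cU.
pose E0 : set (measurableTypeR R * Omega) := [set` `[0, #|V|%:R]] `*` setT.
pose phi (p : measurableTypeR R * Omega) : \bar R :=
  (F (X a (spin_z U) p.1 p.2)
     (remaining (spin_z U) ((X a (spin_z U)) ^~ p.2) p.1))%:E.
(* Extended by 0 the two integrands agree, since [F] vanishes away from b and [h] off the inner
   cube. *)
have phiE : (phi \_ E0)%E = ((test \o path_tuple U) \_ (visits U))%E.
  apply/funext => -[t w]; rewrite !patchE.
  have [tE|tE] := pselect (E0 (t, w)); last first.
    rewrite memNset// memNset// => -[_ tV _ _]; apply: tE.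
    by split => //=; rewrite in_itv.
  rewrite mem_set//; have [tv|tv] := pselect (visits U (t, w)).
    rewrite mem_set//= /phi /test /path_tuple family_of_tuple /F/=.
    by case: tv => _ _ /= -> _; rewrite eqxx mul1r.
  rewrite memNset// /phi /F/=.
  have [Xb|/eqP/negbTE ->] := pselect (X a (spin_z U) t w = b); last by rewrite mul0r.
  rewrite h_cube ?mulr0// => q; apply: tv; split => //=.
  by case: tE => /=; rewrite in_itv.
rewrite /time_integral integral_mkcond -phiE.
have mphi : measurable_fun setT (phi \_ E0)%E.
  rewrite phiE; apply/(measurable_restrictT _ (measurable_visits U)).
  apply: measurable_funTS; apply: measurableT_comp => //.
  exact: measurable_path_tuple.
rewrite fubini_tonelli1//; last first.
  move=> p; rewrite patchE; case: ifP => // _.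
  by rewrite lee_fin mulr_ge0.
rewrite /spin_occupation /occupation /Rintegral fineK; last first.
  apply: integrable_fin_num => //.
  exact: (integrable_state_mean HX good_F).
rewrite [RHS]integral_mkcond; apply: eq_integral => t _.
rewrite /fubini_F patchE; case: ifPn => tV; last first.
  by rewrite integral0_eq// => w _; rewrite patchE memNset//= => -[/= /mem_set/(negP tV)].
have t0 : 0 <= t by move: tV; rewrite inE/= in_itv/= => /andP[].
rewrite /state_mean /Rintegral /= fineK; last first.
  by apply: integrable_fin_num => //; exact: (integrable_state HX good_F t0 t0).
by apply: eq_integral => w _; rewrite patchE mem_set//; split => //=; exact: set_mem tV.
Qed.

Let weighted (Psi : coords R V n.+1 -> R) : coords R V n.+1 -> \bar R :=
  (EFin \o (fun U => Psi U * spin_weight beta U)) \_ dom.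

Let weighted_localized Psi : localized eps Psi ->
  measurable_fun setT (weighted Psi) /\
  (\int[vol]_U weighted Psi U)%E = (rbracket beta Psi)%:E.
Proof.
move=> lP; have iP := integrable_localized beta_ge0 eps0 lP.
have mD := @measurable_coords_domain R V n.
split; first by apply/(measurable_restrictT _ mD); exact: measurable_int iP.
by rewrite /weighted -integral_mkcond /rbracket /Rintegral fineK// integrable_fin_num.
Qed.

Let Part (s : R) U := spin_part s U * h (spin_z U).

Let localized_Part s : `|s| <= 1 -> localized eps (Part s).
Proof.
move=> s1; apply: (@localized_mul _ _ _ _ _ _ 1) => //.
- have := localized_good n b good_F.
  by rewrite (_ : (fun U => _) = (fun U : coords R V n.+1 => h (spin_z U)));
    last by apply/funext => U; rewrite /F eqxx mul1r.
- apply: measurable_funTS; apply: measurable_maxr; last exact: measurable_cst.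
  apply: measurable_funM; first exact: measurable_cst.
  by apply: measurable_funM; exact: measurable_spin_x.
move=> U dU; rewrite ger0_norm ?spin_part_ge0// ge_max ler01 andbT.
rewrite (le_trans (ler_norm _))// normrM -[leRHS]mul1r ler_pM//.
by rewrite normrM -[leRHS]mul1r ler_pM// spin_x_le1.
Qed.

Let lhs_partE s U : lhs_part s U test = weighted (Part s) U.
Proof.
rewrite /lhs_part /weighted patchE /inner_weight indicE.
have [dU|ndU] := pselect (dom U); last by rewrite !memNset ?mulr0 ?mul0e//; case.
rewrite (mem_set dU) /test /= family_of_tuple -EFinM /Part.
have [zq|nzq] := pselect (inner_cube (ztuple U)).
  by rewrite mem_set// mulr1 mulrAC.
by rewrite h_cube// !mulr0 mul0r.
Qed.

Let Occ U := spin_z U a * spin_occupation P X a F U.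

Let rhs_partE U : rhs_part U test = weighted Occ U.
Proof.
rewrite /rhs_part /weighted patchE.
have [dU|ndU] := pselect (dom U).
  by rewrite mem_set// time_integral_test//= -EFinM mulrAC.
rewrite memNset// /time_integral (_ : visits U = set0) ?integral_set0 ?mule0//.
by apply/seteqP; split => // p [].
Qed.

(** This is the Lipschitz isomorphism for 1_{i = b} h(l), rearranged: x_a x_b is the difference of
    [spin_part 1] and [spin_part (-1)], and the latter is moved across. [localized] makes all three
    integrals finite. *)
Lemma matched_test : matched vol (lhs_part 1) rhs_total test.
Proof.
have l1 : localized eps (Part 1) by apply: localized_Part; rewrite normr1.
have l2 : localized eps (Part (-1)) by apply: localized_Part; rewrite normrN normr1.
have l3 : localized eps Occ.
  apply: localized_z.
  exact: (localized_spin_occupation n beta_ge0 X_vdjp a (ltW eps0) good_F).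
have [m1 E1] := weighted_localized l1.
have [m2 E2] := weighted_localized l2.
have [m3 E3] := weighted_localized l3.
split.
- by rewrite (funext (lhs_partE 1)).
- rewrite /rhs_total (_ : (fun U => _) = (fun U => weighted (Part (-1)) U +
    weighted Occ U)%E).
    exact: emeasurable_funD.
  by apply/funext => U; rewrite lhs_partE rhs_partE.
rewrite (eq_integral _ _ (fun U _ => lhs_partE 1 U)) /rhs_total.
rewrite ge0_integralD//; last 4 first.
- by move=> U _; apply: (pf_ge0 (pf_lhs_part _ U)); exact: ge0_measurable_test.
- by rewrite (funext (lhs_partE (-1))).
- by move=> U _; apply: (pf_ge0 (pf_rhs_part U)); exact: ge0_measurable_test.
- by rewrite (funext rhs_partE).
rewrite (eq_integral _ _ (fun U _ => lhs_partE (-1) U)).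
rewrite (eq_integral _ _ (fun U _ => rhs_partE U)) E1 E2 E3 -EFinD; congr EFin.
have HM := lipschitz_isomorphism n beta_sym beta_ge0 X_vdjp a eps0 good_F.
apply/eqP; rewrite addrC -subr_eq -(rbracketB beta_ge0 eps0 l1 l2) /Occ -HM; apply/eqP.
apply: eq_rbracket => U _; rewrite (bigD1 b)//= big1 ?addr0; last first.
  by move=> j /negbTE jb; rewrite /F jb mul0r !mulr0.
rewrite /F eqxx mul1r mulrA /Part -mulrBl; congr (_ * _).
rewrite /spin_part mul1r mulN1r; set x := spin_x U a * _.
by rewrite !maxEle; do 2 case: ifPn; rewrite -?ltNge => *; lra.
Qed.

End test_function.

End borel_parts.

(** * Almost everywhere equal integrands without measurability *)

Section almost_everywhere.
Context d (T : measurableType d) (R : realType) (mu : {measure set T -> \bar R}).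
Local Open Scope ereal_scope.

Import HBNNSimple.

(** The integral of a nonnegative function is a supremum over simple functions below it. Multiplying
    such a simple function by the indicator of the complement of [N] leaves its integral unchanged
    and puts it below [g]. *)
Let le_integral_off (N : set T) (f g : T -> \bar R) :
  measurable N -> mu N = 0 -> (forall x, 0 <= f x) -> (forall x, 0 <= g x) ->
  (forall x, ~ N x -> f x <= g x) -> \int[mu]_x f x <= \int[mu]_x g x.
Proof.
move=> mN N0 f0 g0 fg; rewrite !ge0_integralTE//.
apply: ge_ereal_sup => _ [h hf <-].
have mNC : measurable (~` N) by exact: measurableC.
pose h' := mul_nnsfun h (indic_nnsfun R mNC).
have -> : sintegral mu h = sintegral mu h'.
  rewrite -!integralT_nnsfun; apply: ge0_ae_eq_integral => //.
  - by apply/measurable_EFinP.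
  - by apply/measurable_EFinP.
  - by move=> x _; rewrite lee_fin.
  - by move=> x _; rewrite lee_fin.
  exists N; split => // x; apply: contra_notP => Nx _ /=.
  by rewrite mindicE mem_set ?mulr1.
apply: ereal_sup_ubound; exists h' => // x /=.
have [Nx|Nx] := pselect (N x).
  by rewrite mindicE memNset ?mulr0//; exact.
by rewrite mindicE mem_set// mulr1 (le_trans (hf x))// fg.
Qed.

(* Unlike [ae_eq_integral], neither integrand has to be measurable. *)
Lemma ae_eq_integral_any (D : set T) (f g : T -> \bar R) :
  {ae mu, forall x, D x -> f x = g x} ->
  \int[mu]_(x in D) f x = \int[mu]_(x in D) g x.
Proof.
move=> [N [mN N0 fgN]]; rewrite integral_mkcond [RHS]integral_mkcond.
have e x : ~ N x -> (f \_ D) x = (g \_ D) x.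
  move=> Nx; rewrite !patchE; case: ifPn => // /set_mem Dx.
  by apply: contrapT => fgx; apply: Nx; apply: fgN => /= /(_ Dx).
rewrite integralE [RHS]integralE; congr (_ - _); apply/eqP; rewrite eq_le; apply/andP; split;
  by apply: (le_integral_off mN N0) => // x /e; rewrite ?funeposE ?funenegE => ->.
Qed.

End almost_everywhere.

(** * A uniform margin from compact support *)

Section support.
Context (R : realType) (V : finType).

(** Each coordinate projection of [K] is compact and misses 0, hence stays at a positive distance
    from it. *)
Lemma compact_support_margin (g : (V -> R) -> R) : cube_compact_support g ->
  exists2 eps : R, 0 < eps & forall l, g l != 0 -> forall j, eps < l j.
Proof.
move=> [K [cK Kcube gK]].
have margin j : exists e : R, 0 < e /\ forall l, K l -> e < l j.
  have cp : continuous (fun l : {ptws V -> R} => l j) by exact: proj_continuous.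
  have cI : compact ((fun l : {ptws V -> R} => l j) @` K).
    by apply: continuous_compact => //; exact: continuous_subspaceT.
  have : nbhs (0 : R) (~` ((fun l : {ptws V -> R} => l j) @` K)).
    apply: open_nbhs_nbhs; split.
      by apply: closed_openC; apply: compact_closed => //; exact: norm_hausdorff.
    by move=> [l Kl l0]; have := Kcube l Kl j; rewrite l0 ltxx.
  move=> /nbhs_ballP[e/= e0 he]; exists (e / 2); split; first by rewrite divr_gt0.
  move=> l Kl; have /andP[lj _] := Kcube l Kl j.
  rewrite ltNge; apply/negP => le; apply: (he (l j)); last by exists l.
  by rewrite /ball/= sub0r normrN gtr0_norm//; lra.
have [e eP] := choice margin.
have S0 : 0 <= \sum_j (e j)^-1.
  by apply: sumr_ge0 => j _; rewrite invr_ge0 ltW//; have [] := eP j.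
(* This lies below every [e j] and stays positive when [V] is empty. *)
exists (1 + \sum_j (e j)^-1)^-1; first by rewrite invr_gt0 ltr_wpDr.
move=> l gl j; have [e0 /(_ l) eK] := eP j.
apply: le_lt_trans (eK _); last by apply: contrapT => /gK /eqP; rewrite (negbTE gl).
rewrite -[leRHS]invrK lef_pV2 ?posrE ?invr_gt0// ?ltr_wpDr//.
rewrite (bigD1 j)//= addrCA lerDl addr_ge0//.
by apply: sumr_ge0 => i _; rewrite invr_ge0 ltW//; have [] := eP i.
Qed.

End support.

(** * The isomorphism for Borel observables *)

Section borel_isomorphism.
Context (R : realType) (V : finType) (beta : V -> V -> R) (n : nat).
Hypothesis beta_sym : forall i j, beta i j = beta j i.
Hypothesis beta_ge0 : forall i j, 0 <= beta i j.
Context d (Omega : measurableType d) (P : V -> (V -> R) -> probability Omega R)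
  (X : V -> (V -> R) -> R -> Omega -> V).
Hypothesis X_vdjp : forall v ell, half_open_cube ell ->
  is_vdjp beta v ell (P v ell) (X v ell).
Variables (a b : V) (eps : R).
Hypothesis eps0 : 0 < eps.

Notation Theta := (#|V|.-tuple R).
Notation vol := (coords_volume R V n.+1).
Notation dom := (@coords_domain R V n.+1).
Implicit Types (U : coords R V n.+1) (f : Theta -> \bar R).

Let indic (A : set Theta) : Theta -> \bar R := fun s => (\1_A s)%:E.

Let m_family (j : V) : measurable_fun [set: Theta] (fun s => family_of s j).
Proof. exact: measurable_tnth. Qed.

Notation lhs := (lhs_part beta a b eps 1).
Notation rhs := (rhs_total beta P X a b eps).

Let pf1 U : positive_functional (lhs U) := pf_lhs_part beta a b eps 1 U.
Let pf2 U : positive_functional (rhs U) := pf_rhs X_vdjp a b eps U.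

Lemma matched_box (q : V -> R) : (forall j, eps <= q j) ->
  matched vol lhs rhs (indic (box (q \o enum_val))).
Proof.
move=> eq; have gq m := good_box_ramp m b eq.
have h0 m l : 0 <= box_ramp q m l by have /andP[] := box_ramp_itv q m l.
have mt m : measurable_fun setT (test (box_ramp q m)).
  apply/measurable_EFinP.
  have := measurable_good_comp b (gq m) m_family.
  by rewrite (_ : (fun s => _) = box_ramp q m \o @family_of V R)//;
    apply/funext => s /=; rewrite eqxx mul1r.
apply: (matched_cvg pf1 pf2 (f_ := fun m => test (box_ramp q m))).
- by move=> m; exact: ge0_measurable_test.
- by move=> s m n' mn; rewrite lee_fin box_ramp_nondecreasing.
- move=> s; rewrite /test /indic; apply: cvg_EFin; first exact: nearW.
  have := @cvg_box_ramp R V q (family_of s); rewrite indicE.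
  rewrite (_ : [forall j, _] = (s \in box (q \o enum_val)))//.
  apply/forallP/idP => [h|/set_mem h j].
    rewrite inE => i; have := h (enum_val i).
    by rewrite /family_of enum_valK.
  by have := h (enum_rank j); rewrite /= enum_rankK.
- by move=> m; exact: matched_test.
Qed.

Let matched_eq f f' : (forall s, @inner_cube R V eps s -> f s = f' s) ->
  matched vol lhs rhs f -> matched vol lhs rhs f'.
Proof.
move=> ff' [m1 m2 E].
have e1 U : lhs U f = lhs U f' by exact: eq_lhs_part.
have e2 U : rhs U f = rhs U f'.
  by congr (_ + _)%E; [exact: eq_lhs_part|exact: eq_rhs_part].
split; first by rewrite -(funext e1).
- by rewrite -(funext e2).
- by rewrite -(funext e1) -(funext e2).
Qed.

Lemma matched_borel f : ge0_measurable f -> matched vol lhs rhs f.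
Proof.
(* Only values on [inner_cube] count, and that cube is the box with all thresholds [eps], on which
   the indicator is 1. *)
have M1 : matched vol lhs rhs (cst 1%E).
  apply: matched_eq (matched_box (q := fun=> eps) (fun=> lexx _)) => s sq.
  by rewrite /indic indicE mem_set.
apply: (matched_ge0 pf1 pf2 _ _ _ M1 (measurable_boxE R #|V|)).
- by move=> U; rewrite /lhs_part mule1 ltry.
- move=> U; rewrite /rhs_total lte_add_pinfty//.
    by rewrite /lhs_part mule1 ltry.
  rewrite /rhs_part lte_mul_pinfty//.
    by rewrite lee_fin mulr_ge0 ?spin_weight_ge0//; have /andP[] := spin_z_itv U a.
  have mE : measurable ([set` `[0, #|V|%:R]] `*` setT : set (measurableTypeR R * Omega)).
    by apply: measurableX => //; exact: measurable_itv.
  rewrite /time_integral integral_cst; last exact: (measurable_visits X_vdjp).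
  rewrite mul1e; apply: (@le_lt_trans _ _ ((@lebesgue_measure R \x P a (spin_z U))%E
      ([set` `[0, #|V|%:R]] `*` setT))).
    apply: le_measure; rewrite ?inE//; first exact: (measurable_visits X_vdjp).
    by move=> p [_ pV _ _]; split => //=; rewrite in_itv.
  rewrite product_measure1E//.
  apply: lte_mul_pinfty; [exact: measure_ge0| |].
    rewrite ge0_fin_numE; [exact: lebesgue_measure_itvcc_fin|exact: measure_ge0].
  by apply: (@le_lt_trans _ _ 1%E); [exact: probability_le1|exact: ltry].
- have mD := @measurable_coords_domain R V n.
  apply: (@le_lt_trans _ _ (\int[vol]_U ((eps^-1 ^+ #|V|) * \1_dom U)%:E)%E).
    apply: ge0_le_integral => //.
    + by move=> U _; apply: (pf_ge0 (pf1 U)); split => //; exact: measurable_cst.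
    + by have [] := M1.
    + by apply/measurable_EFinP; apply: measurable_funM => //; exact: measurable_indic.
    move=> U _; rewrite /lhs_part mule1 lee_fin /inner_weight.
    have [[dU zq]|nq] := pselect ((dom `&` @ztuple R V n @^-1` @inner_cube R V eps) U); last first.
      by rewrite !indicE [in leLHS]memNset// !mulr0 mulr_ge0 ?exprn_ge0// invr_ge0 ltW.
    rewrite !indicE !mem_set// !mulr1 -[leRHS]mul1r ler_pM ?spin_part_ge0 ?spin_weight_ge0//.
      rewrite ge_max ler01 andbT mul1r (le_trans (ler_norm _))// normrM -[leRHS]mul1r.
      by rewrite ler_pM// spin_x_le1.
    rewrite (le_trans (ler_norm _))//; apply: spin_weight_bound => //.
    by apply/inner_cubeP.
  under eq_integral do rewrite EFinM.
  rewrite ge0_integralZl_EFin//; last 2 first.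
  + by apply/measurable_EFinP; exact: measurable_indic.
  + by rewrite exprn_ge0// invr_ge0 ltW.
  rewrite integral_indic// setIT lte_mul_pinfty//; last exact: coords_domain_fin.
  by rewrite lee_fin exprn_ge0// invr_ge0 ltW.
- by move=> _ _ [r _ <-] [r' _ <-]; rewrite boxI; eexists.
move=> _ [r _ <-].
(* Raising the thresholds to [eps] leaves the box unchanged inside [inner_cube] and makes its ramps
   good. *)
pose q j := Num.max (r (enum_rank j)) eps.
have eq j : eps <= q j by rewrite le_max lexx orbT.
apply: matched_eq (matched_box eq) => s sq; rewrite /indic !indicE; congr (_%:R%:E).
congr nat_of_bool; apply/idP/idP => /set_mem h; rewrite inE => i.
  by have := h i; rewrite /q /= enum_valK gt_max => /andP[].
by rewrite /q /= enum_valK gt_max h sq.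
Qed.

Variable g : (V -> R) -> R.
Hypothesis g_borel : borel_observable g.
Hypothesis g_margin : forall l, g l != 0 -> forall j, eps < l j.

Notation pos_test := (test (fun l => Num.max (g l) 0)).
Notation neg_test := (test (fun l => Num.max (- g l) 0)).

Let ge0_pos : ge0_measurable pos_test.
Proof.
split; last by move=> s; rewrite lee_fin le_max lexx orbT.
by apply/measurable_EFinP; apply: measurable_maxr => //; exact: measurable_cst.
Qed.

Let ge0_neg : ge0_measurable neg_test.
Proof.
split; last by move=> s; rewrite lee_fin le_max lexx orbT.
apply/measurable_EFinP; apply: measurable_maxr; last exact: measurable_cst.
exact: measurableT_comp.
Qed.

Lemma integrable_visits U f : dom U -> ge0_measurable f ->
  (time_integral P X a b eps U f < +oo)%E ->
  (@lebesgue_measure R \x P a (spin_z U))%E.-integrable setT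
    ((f \o path_tuple X a U) \_ (visits X a b eps U)).
Proof.
move=> dU [mf f0] foo; have mv := measurable_visits X_vdjp a b eps U.
apply/(integrable_mkcond _ mv)/integrableP; split.
  apply: measurable_funTS; apply: measurableT_comp => //.
  exact: (measurable_path_tuple X_vdjp).
by rewrite (eq_integral (fun p => f (path_tuple X a U p)))// => p _; rewrite /= gee0_abs.
Qed.

(** Finiteness for both parts of g makes the signed integrand integrable for the product measure, so
    Fubini applies. After time #|V|, and wherever some clock is at most [eps], g is 0, so the
    half-line and [visits] give the same integral. *)
Lemma integral_path U : dom U ->
  (time_integral P X a b eps U pos_test < +oo)%E ->
  (time_integral P X a b eps U neg_test < +oo)%E ->
  (\int[lebesgue_measure]_(t in `[0%R, +oo[)
    'E_(P a (spin_z U))[fun w => (g (remaining (spin_z U) (fun s => X a (spin_z U) s w) t) *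
       (X a (spin_z U) t w == b)%:R)%R] =
  time_integral P X a b eps U pos_test - time_integral P X a b eps U neg_test)%E.
Proof.
move=> dU /(integrable_visits dU ge0_pos) ip /(integrable_visits dU ge0_neg) im.
have cU := spin_z_cube dU; have HX := X_vdjp a cU.
rewrite /time_integral [in RHS]integral_mkcond.
rewrite [X in _ = (_ - X)%E]integral_mkcond -integralB//.
rewrite -integral12_prod_meas1; last exact: integrableB.
rewrite integral_mkcond; apply: eq_integral => t _.
rewrite /fubini_F patchE; case: ifPn => [|t0]; last first.
  rewrite integral0_eq// => w _; rewrite !patchE memNset ?subee//= => -[/= _ tV _ _].
  by move/negP: t0; apply; rewrite inE/= in_itv/= andbT; case/andP: tV.
rewrite inE/= in_itv/= andbT => t0.
rewrite unlock; apply: eq_integral => w _; rewrite /= !patchE.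
have [tv|tv] := pselect (visits X a b eps U (t, w)).
  rewrite mem_set// /test /= /path_tuple family_of_tuple /=.
  have [_ _ /= -> _] := tv; rewrite eqxx mulr1 -EFinB; congr EFin.
  by rewrite !maxEle; do 2 case: ifPn; rewrite -?ltNge => *; lra.
rewrite memNset// subee//; congr EFin.
have [Xb|/eqP/negbTE ->] := pselect (X a (spin_z U) t w = b); last by rewrite mulr0.
rewrite Xb eqxx mulr1; apply/eqP/negPn/negP => /g_margin gm; apply: tv.
split => //=; last exact/inner_cubeP.
rewrite t0 /= leNgt; apply/negP => /ltW Vt.
have [j] := remaining_le0 cU HX w Vt.
by rewrite leNgt => /negP; apply; exact: lt_trans (gm j).
Qed.

Let Ap U := lhs_part beta a b eps 1 U pos_test.
Let An U := lhs_part beta a b eps 1 U neg_test.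
Let Cp U := lhs_part beta a b eps (-1) U pos_test.
Let Cn U := lhs_part beta a b eps (-1) U neg_test.
Let Np U := rhs_part beta P X a b eps U pos_test.
Let Nn U := rhs_part beta P X a b eps U neg_test.

Let w s U := spin_part a b s U * inner_weight beta eps U.

Let mztuple : measurable_fun setT (@ztuple R V n).
Proof. by apply: measurable_tuple_of_family => j; exact: measurable_spin_z. Qed.

Let mw s : measurable_fun setT (w s).
Proof.
apply: measurable_funM.
  apply: measurable_maxr; last exact: measurable_cst.
  apply: measurable_funM; first exact: measurable_cst.
  by apply: measurable_funM; exact: measurable_spin_x.
apply: measurable_funM; first exact: measurable_spin_weight.
apply: measurable_indic; apply: measurableI; first exact: measurable_coords_domain.
by rewrite -[X in measurable X]setTI; apply: mztuple => //; exact: measurable_box.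
Qed.

Let measurable_lhs_part s f : ge0_measurable f ->
  measurable_fun setT (fun U => lhs_part beta a b eps s U f).
Proof.
move=> [mf _]; apply: emeasurable_funM; first by apply/measurable_EFinP; exact: mw.
exact: measurableT_comp.
Qed.

Let lhs_fin s U h : lhs_part beta a b eps s U (test h) \is a fin_num.
Proof. by []. Qed.

Let lhs_ge0 s U f : ge0_measurable f -> (0 <= lhs_part beta a b eps s U f)%E.
Proof. exact: (pf_ge0 (pf_lhs_part _ _ _ _ _ _)). Qed.

Let rhs_ge0 U f : ge0_measurable f -> (0 <= rhs_part beta P X a b eps U f)%E.
Proof. exact: (pf_ge0 (pf_rhs_part X_vdjp _ _ _ _)). Qed.

(** [matched_borel] gives measurability of the total only; the spin part is finite everywhere and
    can be subtracted. *)
Let measurable_rhs_part h : ge0_measurable (test h) ->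
  measurable_fun setT (fun U => rhs_part beta P X a b eps U (test h)).
Proof.
move=> fm; have [_ m2 _] := matched_borel fm.
rewrite (_ : (fun U => _) = (fun U => rhs_total beta P X a b eps U (test h) -
    lhs_part beta a b eps (-1) U (test h))%E).
  by apply: emeasurable_funB => //; exact: measurable_lhs_part.
by apply/funext => U; rewrite /rhs_total addeAC subee ?add0e// lhs_fin.
Qed.

Let F U : \bar R :=
  ((spin_x U a * spin_x U b * g (spin_z U))%:E * (spin_weight beta U)%:E)%E.

(** With p and g split into parts, where p = x_a x_b, one has p g = (p+ g+ + p- g-) - (p+ g- + p-
    g+), and |p g| is the sum of the four products. Each product is therefore integrable as soon as
    the left side of the theorem is. *)
Let F_split U :
  ((F \_ dom) U = (Ap U + Cn U) - (An U + Cp U) /\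
  `|(F \_ dom) U| = (Ap U + Cn U) + (An U + Cp U))%E.
Proof.
have -> : (F \_ dom) U = (spin_x U a * spin_x U b * g (spin_z U) *
    spin_weight beta U * \1_dom U)%:E.
  rewrite patchE indicE; case: ifPn => _; last by rewrite mulr0.
  by rewrite mulr1 EFinM.
rewrite /Ap /An /Cp /Cn /lhs_part /test family_of_tuple -!EFinM -!EFinD /=.
have -> : spin_x U a * spin_x U b * g (spin_z U) * spin_weight beta U * \1_dom U =
    (spin_x U a * spin_x U b) * g (spin_z U) * inner_weight beta eps U.
  rewrite -mulrA /inner_weight; have [->|gz] := eqVneq (g (spin_z U)) 0.
    by rewrite !(mulr0, mul0r).
  have zq : (@ztuple R V n @^-1` inner_cube eps) U by apply/inner_cubeP => j; exact: g_margin.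
  by rewrite !indicE in_setI (mem_set zq) andbT.
have := inner_weight_ge0 beta eps U.
rewrite /spin_part mul1r mulN1r.
move: (inner_weight _ _ _) (g _) (_ * spin_x U b) => m gam s m0.
have pE (x : R) : Num.max x 0 - Num.max (- x) 0 = x.
  have [x0|x0] := leP 0 x; first by rewrite max_r ?subr0// oppr_le0.
  by rewrite max_l ?sub0r ?opprK// oppr_ge0 ltW.
split; congr EFin.
  rewrite -[s in LHS]pE -[gam in LHS]pE.
  by ring.
rewrite !normrM (ger0_norm m0).
have nE (x : R) : `|x| = Num.max x 0 + Num.max (- x) 0.
  have [x0|x0] := leP 0 x.
    by rewrite ger0_norm// max_r ?addr0// oppr_le0.
  by rewrite ltr0_norm// max_l ?add0r// oppr_ge0 ltW.
by rewrite !nE; ring.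
Qed.

Lemma borel_isomorphism : vol.-integrable dom F ->
  (\int[vol]_(U in dom) F U = \int[vol]_(U in dom)
    (((spin_z U a)%:E * \int[lebesgue_measure]_(t in `[0%R, +oo[)
      'E_(P a (spin_z U))[fun w => (g (remaining (spin_z U)
         (fun s => X a (spin_z U) s w) t) * (X a (spin_z U) t w == b)%:R)%R]) *
     (spin_weight beta U)%:E))%E.
Proof.
move=> iF; have mD := @measurable_coords_domain R V n.
have iF' : vol.-integrable setT (F \_ dom) by exact/(integrable_mkcond _ mD).
have bound (f : coords R V n.+1 -> \bar R) : measurable_fun setT f -> (forall U, 0 <= f U)%E ->
    (forall U, f U <= `|(F \_ dom) U|)%E -> vol.-integrable setT f.
  move=> mf f0 fF; apply: le_integrable iF' => // U _.
  by rewrite gee0_abs.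
have iAp : vol.-integrable setT Ap.
  apply: bound => [|U|U]; [exact: measurable_lhs_part|exact: lhs_ge0|].
  by have [_ ->] := F_split U; rewrite -addeA leeDl// !adde_ge0 ?lhs_ge0.
have iCn : vol.-integrable setT Cn.
  apply: bound => [|U|U]; [exact: measurable_lhs_part|exact: lhs_ge0|].
  have [_ ->] := F_split U; rewrite (addeC (Ap U)) -addeA leeDl// !adde_ge0 ?lhs_ge0//.
have iAn : vol.-integrable setT An.
  apply: bound => [|U|U]; [exact: measurable_lhs_part|exact: lhs_ge0|].
  by have [_ ->] := F_split U; rewrite addeCA leeDl// !adde_ge0 ?lhs_ge0.
have iCp : vol.-integrable setT Cp.
  apply: bound => [|U|U]; [exact: measurable_lhs_part|exact: lhs_ge0|].
  by have [_ ->] := F_split U; rewrite addeA leeDr// !adde_ge0 ?lhs_ge0.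
have split_rhs h : ge0_measurable (test h) ->
    (\int[vol]_U lhs_part beta a b eps 1 U (test h) =
     \int[vol]_U lhs_part beta a b eps (-1) U (test h) +
     \int[vol]_U rhs_part beta P X a b eps U (test h))%E.
  move=> hm; have [_ _ ->] := matched_borel hm.
  rewrite /rhs_total ge0_integralD//.
  - by move=> U _; exact: lhs_ge0.
  - exact: measurable_lhs_part.
  - by move=> U _; exact: rhs_ge0.
  - exact: measurable_rhs_part.
have Ep : (\int[vol]_U Ap U = \int[vol]_U Cp U + \int[vol]_U Np U)%E by exact: split_rhs.
have En : (\int[vol]_U An U = \int[vol]_U Cn U + \int[vol]_U Nn U)%E by exact: split_rhs.
have fin (f : coords R V n.+1 -> \bar R) : vol.-integrable setT f ->
    (\int[vol]_U f U)%E \is a fin_num.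
  by move=> ?; exact: integrable_fin_num.
have fAp := fin _ iAp; have fAn := fin _ iAn.
have fCp := fin _ iCp; have fCn := fin _ iCn.
have iN h : ge0_measurable (test h) ->
    (\int[vol]_U lhs_part beta a b eps 1 U (test h) \is a fin_num)%E ->
    vol.-integrable setT (fun U => rhs_part beta P X a b eps U (test h)).
  move=> hm hfin; apply/integrableP; split; first exact: measurable_rhs_part.
  rewrite (eq_integral (fun U => rhs_part beta P X a b eps U (test h))); last first.
    by move=> U _; rewrite gee0_abs// rhs_ge0.
  move: hfin; rewrite split_rhs// fin_numD => /andP[_].
  by rewrite ge0_fin_numE//; apply: integral_ge0 => U _; exact: rhs_ge0.
have iNp : vol.-integrable setT Np by exact: iN.
have iNn : vol.-integrable setT Nn by exact: iN.
have fNp := fin _ iNp; have fNn := fin _ iNn.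
(* After integration Ap = Cp + Np and An = Cn + Nn, so the terms that were moved across cancel and
   only the path terms remain. *)
have LE : (\int[vol]_(U in dom) F U = \int[vol]_U Np U - \int[vol]_U Nn U)%E.
  rewrite integral_mkcond (eq_integral ((Ap \+ Cn) \- (An \+ Cp))%E); last first.
    by move=> U _; have [] := F_split U.
  rewrite integralB//; [|exact: integrableD|exact: integrableD].
  rewrite !integralD// Ep En.
  have cancel (p q r s : \bar R) : p \is a fin_num -> q \is a fin_num ->
      r \is a fin_num -> s \is a fin_num ->
      (p + r + q - (q + s + p) = r - s)%E.
    move=> /fineK <- /fineK <- /fineK <- /fineK <-.
    by rewrite -!EFinD; congr EFin; ring.
  exact: (cancel _ _ _ _ fCp fCn fNp fNn).
rewrite LE -integralB// [RHS]integral_mkcond.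
apply: ae_eq_integral_any.
have [Z1 [mZ1 Z10 hZ1]] := integrable_ae measurableT iNp.
have [Z2 [mZ2 Z20 hZ2]] := integrable_ae measurableT iNn.
exists (Z1 `|` Z2); split; first exact: measurableU.
  by rewrite measureU0.
move=> U; apply: contra_notP => /not_orP[NZ1 NZ2] _.
have fp : Np U \is a fin_num.
  by apply: contrapT => h; apply: NZ1; apply: hZ1 => /= /(_ Logic.I).
have fn : Nn U \is a fin_num.
  by apply: contrapT => h; apply: NZ2; apply: hZ2 => /= /(_ Logic.I).
rewrite patchE; have [dU|ndU] := pselect (dom U); last first.
  rewrite memNset// /Np /Nn /rhs_part /time_integral.
  rewrite (_ : visits X a b eps U = set0) ?integral_set0 ?mule0 ?subee//.
  by apply/seteqP; split => // p [].
rewrite mem_set//.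
(* A strictly positive factor lets finiteness of the weighted term pass to the time integral. *)
have c0 : 0 < spin_z U a * spin_weight beta U.
  rewrite mulr_gt0 ?spin_z_gt0// mulr_gt0 ?expR_gt0//; apply: prodr_gt0 => i _.
  by rewrite invr_gt0; exact: spin_z_gt0.
have finT h : ge0_measurable (test h) ->
    rhs_part beta P X a b eps U (test h) \is a fin_num ->
    (time_integral P X a b eps U (test h) < +oo)%E.
  move=> hm; rewrite ltey; apply: contraTneq => e; rewrite /rhs_part e.
  by rewrite gt0_muley ?lte_fin.
have Ap_fin := finT _ ge0_pos fp; have An_fin := finT _ ge0_neg fn.
rewrite (integral_path dU Ap_fin An_fin).
have Ap_num : time_integral P X a b eps U pos_test \is a fin_num.
  by rewrite ge0_fin_numE//; exact: (pf_ge0 (pf_time_integral X_vdjp _ _ _ _)).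
have An_num : time_integral P X a b eps U neg_test \is a fin_num.
  by rewrite ge0_fin_numE//; exact: (pf_ge0 (pf_time_integral X_vdjp _ _ _ _)).
have factor (z m : R) (p q : \bar R) : p \is a fin_num -> q \is a fin_num ->
    ((z * m)%:E * p - (z * m)%:E * q = z%:E * (p - q) * m%:E)%E.
  by move=> /fineK <- /fineK <-; rewrite -!EFinM -?EFinD -?EFinM; congr EFin; ring.
exact: factor.
Qed.

End borel_isomorphism.

Theorem theorem4p4 (R : realType) (V : finType) (beta : V -> V -> R) (n : nat)
  (beta_sym : forall i j, beta i j = beta j i)
  (beta_ge0 : forall i j, 0 <= beta i j)
  (beta_connected : forall i j, connect [rel k l | 0 < beta k l] i j)
  (n_gt0 : (0 < n)%N)
  (d : measure_display) (Omega : measurableType d)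
  (P : V -> (V -> R) -> probability Omega R)
  (X : V -> (V -> R) -> R -> Omega -> V)
  (X_vdjp : forall v ell, half_open_cube ell ->
     is_vdjp beta v ell (P v ell) (X v ell))
  (g : (V -> R) -> R)
  (g_borel : borel_observable g)
  (g_support : cube_compact_support g)
  (a b : V)
  (lhs_integrable : spin_integrable beta
     (fun u : V -> n.+1.-tuple R =>
        (xc (u a) * xc (u b) * g (fun i => zc (u i)))%:E)) :
  spin_bracket beta
    (fun u : V -> n.+1.-tuple R =>
       (xc (u a) * xc (u b) * g (fun i => zc (u i)))%:E) =
  spin_bracket beta
    (fun u : V -> n.+1.-tuple R =>
       let z := fun i => zc (u i) in
       ((z a)%:E *
        \int[lebesgue_measure]_(t in `[0%R, +oo[)
          'E_(P a z)[fun w =>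
            (g (remaining z (fun s => X a z s w) t) * (X a z t w == b)%:R)%R])%E).
Proof.
(* With n = m.+1 the ball has a first coordinate, so [xc] is a genuine coordinate and not the
   default 0. *)
case: n n_gt0 lhs_integrable => // m _ iF.
have [eps eps0 g_margin] := compact_support_margin g_support.
exact: (borel_isomorphism beta_sym beta_ge0 X_vdjp eps0 g_borel g_margin iF).
Qed.
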